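(* Let $I$ be an interval and let $(\Omega_\varepsilon)_{\varepsilon\in I}$ be an analytic family of strictly convex planar domains with analytic boundary. Let $(m,n)\in\mathbb{Z}\times\mathbb{N}^{*}$ be coprime integers with $m/n\in(0,1)$. Then the set of $\varepsilon\in I$ such that the outer billiard map associated to $\Omega_\varepsilon$ has an $(m,n)$-periodic invariant curve is either discrete or equal to the whole of $I$.
   Context: Analytic family: the domains are bounded and their boundaries depend analytically on $\varepsilon$; more precisely (after translations so that a common point $O$ lies inside all domains) the distance $p_\varepsilon(\theta)$ from $O$ to the tangent line $\mathcal{L}_\theta$ defined below is analytic in $(\varepsilon,\theta)$. Outer (dual) billiard: let $\Omega\subset\mathbb{R}^2$ be strictly convex with smooth boundary, oriented counterclockwise. For $z\in\mathbb{R}^2\setminus\overline\Omega$, consider the unique tangent line to $\partial\Omega$ through $z$, touching $\partial\Omega$ at a point $x$, such that the vector from $z$ to $x$ has the same orientation as $\partial\Omega$ at $x$. The outer billiard map sends $z$ to the point $F(z)$ of this line such that $x$ is the midpoint of $z$ and $F(z)$. Envelope coordinates: fix a direction $Ox$. For $\theta\in\mathbb{R}$ let $\mathcal{L}_\theta$ be the oriented line making angle $\theta+\pi/2$ with $Ox$ that is tangent to $\partial\Omega$ at a point $\alpha(\theta)$ with matching orientation. For $z\in\mathbb{R}^2\setminus\overline\Omega$ there is a unique $\theta$ modulo $2\pi$ such that $\alpha(\theta)-z$ is collinear with $\mathcal{L}_\theta$ with the same orientation; the coordinates of $z$ are $(\theta,\gamma)$, $\gamma=\|\alpha(\theta)-z\|^2/2$.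 In these coordinates the outer billiard map lifts to a map $F:\mathbb{R}\times(0,+\infty)\to\mathbb{R}\times(0,+\infty)$ commuting with $(\theta,\gamma)\mapsto(\theta+2\pi,\gamma)$, the lift being chosen so that the angle increases by an amount in $(0,\pi)$. $(m,n)$-periodic invariant curve: the graph $\Gamma=\{(\theta,\eta(\theta))\}$ of a $2\pi$-periodic Lipschitz continuous function $\eta:\mathbb{R}\to(0,+\infty)$ with $F(\Gamma)\subseteq\Gamma$ and $F^n(\theta,\eta(\theta))=(\theta+2\pi m,\eta(\theta))$ for all $\theta$. *)

(* Defs.v *)
From HB Require Import structures.
From mathcomp Require Export all_boot all_order all_algebra.
From mathcomp Require Export all_classical all_reals all_analysis.
Export Order.TTheory GRing.Theory Num.Theory numFieldNormedType.Exports.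
Set Implicit Arguments.
Unset Strict Implicit.
Unset Printing Implicit Defensive.
Local Open Scope classical_set_scope.
Local Open Scope ring_scope.

(* The topology of [R * R] is the product one, but its library norm is the sup
   norm; Euclidean lengths therefore go through [enorm]. *)
Notation plane R := (R * R)%type.

Section Plane.
Context {R : realType}.
Implicit Types (A Om : set (plane R)) (x z v : plane R) (t : R).

Definition enorm v : R := Num.sqrt (v.1 ^+ 2 + v.2 ^+ 2).

Definition dist_to x A : R := inf [set enorm (x - y) | y in A].

Definition translate v A : set (plane R) := [set x + v | x in A].

Definition rot90 v : plane R := (- v.2, v.1).

Definition boundary A : set (plane R) := closure A `\` interior A.

(* Unit vector making the angle [t + pi / 2] with the first coordinate axis,
   which plays the role of the reference direction Ox. *)
Definition dir t : plane R := (- sin t, cos t).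

End Plane.

Section Analytic.
Context {R : realType}.

Definition analytic (f : R -> R) : Prop :=
  forall a : R, exists (c : nat -> R) (r : R), 0 < r /\
    forall x, `|x - a| < r -> pseries c (x - a) @ \oo --> f x.

(* At each point of [A], [f] coincides on [A] with the sum of a power series
   converging absolutely on a bidisc; [A] need not be open, so that intervals
   of parameters may contain their endpoints. *)
Definition analytic2_on (A : set (R * R)) (f : R * R -> R) : Prop :=
  forall p, A p -> exists (c : nat -> nat -> R) (r : R),
    [/\ 0 < r,
        exists M : R, forall N : nat,
          \sum_(i < N) \sum_(j < N) `|c i j| * r ^+ (i + j) <= M
      & forall q, A q -> `|q.1 - p.1| < r -> `|q.2 - p.2| < r ->
          (fun N : nat => \sum_(i < N) \sum_(j < N)
             c i j * (q.1 - p.1) ^+ i * (q.2 - p.2) ^+ j) @ \oo --> f q].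

End Analytic.

Section Domains.
Context {R : realType}.
Implicit Types (Om : set (plane R)).

Definition strictly_convex Om : Prop :=
  forall x y (t : R), closure Om x -> closure Om y -> x != y -> 0 < t < 1 ->
    interior Om ((1 - t) *: x + t *: y).

Definition strictly_convex_domain Om : Prop :=
  [/\ open Om, Om !=set0, bounded_set Om & strictly_convex Om].

(* The boundary is a simple closed analytic curve with a regular
   parametrization. *)
Definition analytic_boundary Om : Prop :=
  exists c : R -> plane R,
    [/\ analytic (fun t => (c t).1) /\ analytic (fun t => (c t).2),
        forall t, ('D_1 c t) != 0,
        forall t, c (t + 2 * pi) = c t,
        forall s t, c s = c t -> exists k : int, s = t + k%:~R * (2 * pi)
      & range c = boundary Om].

(* [v] is a nonzero tangent vector at [x], oriented as the counterclockwise
   boundary, i.e. with the domain on its left. *)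
Definition pos_tangent Om (x v : plane R) : Prop :=
  [/\ boundary Om x, v != 0,
      exists g : R -> plane R,
        [/\ g 0 = x, is_derive (0 : R) (1 : R) g v
          & \forall t \near (0 : R), boundary Om (g t)]
    & \forall s \near (0 : R)^'+, Om (x + s *: rot90 v)].

(* The next two points exist and are unique for a strictly convex domain with
   smooth boundary (and [z] outside its closure). *)
Definition alpha Om (theta : R) : plane R :=
  get [set x | pos_tangent Om x (dir theta)].

Definition touching_point Om (z : plane R) : plane R :=
  get [set x | pos_tangent Om x (x - z)].

Definition tangent_line Om (theta : R) : set (plane R) :=
  [set alpha Om theta + t *: dir theta | t in [set: R]].

Definition outer_billiard Om (z : plane R) : plane R :=
  2 *: touching_point Om z - z.

Definition envelope_coords Om (z : plane R) (q : R * R) : Prop :=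
  [/\ ~ closure Om z,
      exists2 s : R, 0 < s & alpha Om q.1 - z = s *: dir q.1
    & q.2 = enorm (alpha Om q.1 - z) ^+ 2 / 2].

(* [F] represents a map of [R * ]0, +oo[]; its values elsewhere are
   irrelevant. *)
Definition outer_billiard_lift Om (F : R * R -> R * R) : Prop :=
  (forall theta gamma, 0 < gamma ->
     [/\ 0 < (F (theta, gamma)).2,
         theta < (F (theta, gamma)).1 < theta + pi
       & exists z, envelope_coords Om z (theta, gamma) /\
           envelope_coords Om (outer_billiard Om z) (F (theta, gamma))]) /\
  (forall theta gamma, 0 < gamma ->
     F (theta + 2 * pi, gamma) = F (theta, gamma) + (2 * pi, 0)).

Definition periodic_invariant_curve (F : R * R -> R * R) (m : int) (n : nat)
    (eta : R -> R) : Prop :=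
  let Gamma := [set (theta, eta theta) | theta in [set: R]] in
  [/\ lipschitz eta,
      forall theta, 0 < eta theta /\ eta (theta + 2 * pi) = eta theta,
      F @` Gamma `<=` Gamma
    & forall theta, iter n F (theta, eta theta)
                    = (theta + 2 * pi * m%:~R, eta theta)].

Definition has_periodic_invariant_curve Om (m : int) (n : nat) : Prop :=
  exists F, outer_billiard_lift Om F /\
    exists eta, periodic_invariant_curve F m n eta.

(* The translations [v eps] are arbitrary: only the shapes of the domains have
   to depend analytically on the parameter. *)
Definition analytic_family (I : set R) (Om : R -> set (plane R)) : Prop :=
  exists (O : plane R) (v : R -> plane R),
    (forall eps, I eps -> translate (v eps) (Om eps) O) /\
    analytic2_on (I `*` [set: R])
      (fun q => dist_to O (tangent_line (translate (v q.1) (Om q.1)) q.2)).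

Definition discrete_subset (E : set R) : Prop := E `<=` isolated E.

End Domains.

(* Main.v *)
Require Import Defs.
From mathcomp Require Import all_boot all_order all_algebra.
From mathcomp Require Import all_classical all_reals all_analysis.
From mathcomp Require Import ring lra.
Set Implicit Arguments.
Unset Strict Implicit.
Unset Printing Implicit Defensive.
Local Open Scope classical_set_scope.
Local Open Scope ring_scope.

(** Write [p] for the support function of a table, measured from the common interior
  point. The tangent lines at angles [a] and [b], with [0 < b - a < pi], meet at
  distance [fwd a b] after the tangency point at [a] and [bwd a b] before the one
  at [b]; an orbit of the outer billiard is a sequence of angles [x i] with
  [bwd (x (i-1)) (x i) = fwd (x i) (x (i+1))]. These are the critical points of the
  action [\sum_i gen (x i) (x (i+1))], where [gen] is a generating function which,
  up to sign and boundary terms, has partial derivatives half the squares of these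
  lengths.

  Fix [n >= 2] and [w = 2 pi m], and call a table flat when the minimum of the
  action over the sequences from [theta] to [theta + w] in [n] steps is the same
  number [c] for every [theta], [c] being then the global minimum. A table is flat
  exactly when it has an [(m, n)]-periodic invariant curve:
  - if it is flat, every base point starts a globally minimal sequence; minima and
    maxima of two such sequences are again minimal ([gen] is submodular), so they
    never cross, and [theta |-> x 1] is a circle map whose graph is an invariant
    curve, automatically Lipschitz ([flat_circle]);
  - if there is an invariant curve, an orbit that jumps ahead of the curve stays
    ahead, so a closed minimal sequence follows the curve ([circle_follow]); the
    reflection law then also holds at the base point, that is, the minimal action
    has derivative zero in [theta], hence is constant ([closing_flat]).

  The minimal action depends continuously on the parameter and on [theta], so the
  set of flat parameters is closed ([flat_closed]). It remains to see that it
  contains a neighbourhood of each of its accumulation points [eps0]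
  ([flat_open]). On the curve of the table [eps0] the orbit equations with fixed
  ends are nondegenerate ([deformation_trivial]): a first-order deformation would
  run ahead of the curve linearly and could not come back. Hence near [eps0] the
  minimal sequence from each [theta] is an analytic function of the parameter, and
  so is the defect in the reflection law at the base point. That defect vanishes
  at the flat parameters, which accumulate at [eps0], so it vanishes identically on
  a neighbourhood, uniformly in [theta] by compactness, and the nearby tables are
  flat. Connectedness of the interval finishes the proof.

  The parameter may be an end point of the interval, so analyticity is handled on
  arbitrary subsets [X] of the line, through power series whose coefficients
  satisfy majorant estimates ([ps_ball]). These estimates survive pointwise
  limits, which gives the analytic implicit function theorem by Newton iteration
  ([solution_identity]) without complex analysis.

  On the geometric side, the tangency point of direction [theta] is the unique
  point of the closed table that is extremal in the outer normal direction
  ([alphaP]); the derivative of [p] is its tangential coordinate, and the oriented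
  tangent line through an exterior point is unique. A lift of the billiard map
  then sends [(theta, S^2 / 2)] to [(theta', T^2 / 2)], where [S = fwd theta theta']
  and [T = bwd theta theta'] ([lift_spec], [lift_exists]). *)

(** * Functions with a majorant power series *)

Lemma cvg_finite_sum (R : realType) (T : Type) (F : set_system T) (n : nat)
    (f : nat -> T -> R) (l : nat -> R) : Filter F ->
  (forall i, (i < n)%N -> f i @ F --> l i) ->
  (fun t => \sum_(i < n) f i t) @ F --> \sum_(i < n) l i.
Proof.
move=> FF; elim: n => [|n IH] H.
  rewrite big_ord0 (_ : (fun t => _) = (fun=> 0)); first exact: cvg_cst.
  by apply/funext => t; rewrite big_ord0.
rewrite big_ord_recr/= (_ : (fun t => _) = (fun t => \sum_(i < n) f i t + f n t)).
  by apply: cvgD; [apply: IH => i /leqW; exact: H|exact: H].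
by apply/funext => t; rewrite big_ord_recr.
Qed.

Section PowerSeriesBalls.
Import ArrowAsProduct.
Context {R : realType} (X : set R).
Implicit Types (f g : R -> R) (r M x : R).

(** A ball of power series of radius [r]: the coefficients have weighted [l1]-norm at
  most [M], and the partial sums approximate [f] as fast as the geometric tail
  allows. Everything is a non-strict inequality between finitely many
  coefficients and values, so the condition is closed under pointwise limits;
  only the points of [X] matter, and [X] is arbitrary. *)
Definition ps_ball r M f := 0 < r /\ exists c : nat -> R,
  (forall N : nat, \sum_(j < N) `|c j| * r ^+ j <= M) /\
  forall x, X x -> `|x| <= r / 2 -> forall N : nat,
    `|f x - \sum_(j < N) c j * x ^+ j| <= M * (`|x| / r) ^+ N.

Lemma ps_ball_ge0 r M f : ps_ball r M f -> 0 <= M.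
Proof. by case=> _ [c [/(_ 0%N)]]; rewrite big_ord0. Qed.

Lemma ps_ball_bound r M f x : ps_ball r M f -> X x -> `|x| <= r / 2 ->
  `|f x| <= M.
Proof.
case=> _ [c [_ H]] Xx xr.
by have := H x Xx xr 0%N; rewrite big_ord0 subr0 expr0 mulr1.
Qed.

Lemma ps_ball_le r M M' f : M <= M' -> ps_ball r M f -> ps_ball r M' f.
Proof.
move=> MM [r0 [c [H1 H2]]]; split=> //; exists c; split=> [N|x Xx xr N].
  exact: le_trans (H1 N) MM.
apply: le_trans (H2 x Xx xr N) _.
by rewrite ler_wpM2r// exprn_ge0// divr_ge0// ltW.
Qed.

Lemma ps_ball_ext r M f g :
  (forall x, X x -> `|x| <= r / 2 -> f x = g x) -> ps_ball r M f -> ps_ball r M g.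
Proof.
move=> fg [r0 [c [H1 H2]]]; split=> //; exists c; split=> // x Xx xr N.
by rewrite -fg//; exact: H2.
Qed.

Lemma ps_ball_add r M M' f g : ps_ball r M f -> ps_ball r M' g ->
  ps_ball r (M + M') (fun x => f x + g x).
Proof.
move=> [r0 [c [H1 H2]]] [_ [d [K1 K2]]]; split=> //.
exists (fun j => c j + d j); split=> [N|x Xx xr N].
  apply: le_trans (lerD (H1 N) (K1 N)).
  rewrite -big_split/=; apply: ler_sum => j _; rewrite -mulrDl.
  by rewrite ler_wpM2r ?exprn_ge0 ?(ltW r0)// ler_normD.
rewrite [X in _ - X](_ : _ = \sum_(j < N) c j * x ^+ j + \sum_(j < N) d j * x ^+ j).
  rewrite opprD addrACA mulrDl.
  by apply: le_trans (ler_normD _ _) _; apply: lerD; [exact: H2|exact: K2].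
by rewrite -big_split; apply: eq_bigr => j _; rewrite mulrDl.
Qed.

Lemma ps_ball_scale r M f k : ps_ball r M f ->
  ps_ball r (`|k| * M) (fun x => k * f x).
Proof.
move=> [r0 [c [H1 H2]]]; split=> //.
exists (fun j => k * c j); split=> [N|x Xx xr N].
  rewrite (_ : \sum_(_ < _) _ = `|k| * \sum_(j < N) `|c j| * r ^+ j).
    by rewrite ler_wpM2l.
  by rewrite mulr_sumr; apply: eq_bigr => j _; rewrite normrM mulrA.
rewrite (_ : \sum_(_ < _) _ = k * \sum_(j < N) c j * x ^+ j).
  by rewrite -mulrBr normrM -mulrA ler_wpM2l// H2.
by rewrite mulr_sumr; apply: eq_bigr => j _; rewrite mulrA.
Qed.

Lemma ps_ball_monomial r k : 0 < r -> ps_ball r (r ^+ k) (fun x => x ^+ k).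
Proof.
move=> r0; split=> //; exists (fun j => (j == k)%:R); split=> [N|x Xx xr N].
  have [kN|Nk] := ltnP k N.
    rewrite (bigD1 (Ordinal kN))//= eqxx normr1 mul1r big1 ?addr0// => j.
    by rewrite -val_eqE/= => /negPf->; rewrite normr0 mul0r.
  rewrite big1 ?exprn_ge0 ?(ltW r0)// => j _.
  by rewrite ltn_eqF ?normr0 ?mul0r// (leq_trans _ Nk).
have [kN|Nk] := ltnP k N.
  rewrite (bigD1 (Ordinal kN))//= eqxx mul1r big1 ?addr0 ?subrr ?normr0.
    by rewrite mulr_ge0 ?exprn_ge0 ?divr_ge0 ?(ltW r0).
  by move=> j; rewrite -val_eqE/= => /negPf->; rewrite mul0r.
rewrite big1 ?subr0 => [|j _]; last first.
  by rewrite ltn_eqF ?mul0r// (leq_trans _ Nk).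
rewrite normrX expr_div_n; have := subnK Nk; set a := (k - N)%N => <-.
have r00 : r ^+ N != 0 by rewrite expf_neq0 ?gt_eqF.
rewrite !exprD [X in _ <= X](_ : _ = r ^+ a * `|x| ^+ N); last by field.
apply: ler_wpM2r; first by rewrite exprn_ge0.
rewrite lerXn2r ?nnegrE ?(ltW r0)// (le_trans xr)// ler_pdivrMr//; lra.
Qed.

Lemma ps_ball_cst r k : 0 < r -> ps_ball r `|k| (fun=> k).
Proof.
move=> r0; have := ps_ball_scale k (ps_ball_monomial 0 r0).
by rewrite expr0 mulr1; apply: ps_ball_ext => x _ _; rewrite expr0 mulr1.
Qed.

Lemma ps_ball_sum r n (M : nat -> R) (f : nat -> R -> R) : 0 < r ->
  (forall i, (i < n)%N -> ps_ball r (M i) (f i)) ->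
  ps_ball r (\sum_(i < n) M i) (fun x => \sum_(i < n) f i x).
Proof.
move=> r0; elim: n => [|n IH] H.
  rewrite big_ord0; apply: (@ps_ball_ext _ _ (fun=> 0)) => [x _ _|].
    by rewrite big_ord0.
  by have := ps_ball_cst 0 r0; rewrite normr0.
rewrite big_ord_recr; apply: (@ps_ball_ext _ _
  (fun x => \sum_(i < n) f i x + f n x)) => [x _ _|]; first by rewrite big_ord_recr.
by apply: ps_ball_add; [apply: IH => i /leqW|]; apply: H.
Qed.

Lemma cluster_real (T : topologicalType) (u : nat -> T) (l : T) (G : T -> R)
    (e : R) (K : nat) : cluster (u @ \oo) l -> {for l, continuous G} -> 0 < e ->
  exists2 k, (K <= k)%N & `|G (u k) - G l| < e.
Proof.
move=> cl cG e0.
have A : (u @ \oo) (u @` [set k | (K <= k)%N]).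
  by exists K => // k /= Kk; exists k.
have B : nbhs l (G @^-1` [set y | `|G l - y| < e]).
  by apply: cG; apply: (@nbhsx_ballx R R (G l) e).
have [_ [[k /= Kk <-] /= H]] := cl _ _ A B.
by exists k => //; rewrite distrC.
Qed.

Lemma cvg_near_dist (u : nat -> R) (l e : R) : u @ \oo --> l -> 0 < e ->
  exists K, forall k, (K <= k)%N -> `|l - u k| < e.
Proof.
move=> ul e0; have /cvgrPdist_lt/(_ _ e0) := ul; case=> K _ H.
by exists K => k Kk; apply: H.
Qed.

Lemma proj_cont (j : nat) (l : nat -> R) :
  {for l, continuous (fun c : nat -> R => c j)}.
Proof. exact: (@proj_continuous nat (fun=> R) j l). Qed.

(** Normal families: a pointwise limit of functions with uniformly bounded
  majorants has the same majorant, because the coefficient sequences live in a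
  product of compact intervals and the defining estimates are closed conditions
  on the coefficients. *)
Lemma ps_ball_lim r M (f : nat -> R -> R) g :
  (forall k, ps_ball r M (f k)) ->
  (forall x, X x -> `|x| <= r / 2 -> (fun k => f k x) @ \oo --> g x) ->
  ps_ball r M g.
Proof.
move=> Hf fg; have r0 : 0 < r by case: (Hf 0%N).
split=> //.
have /choice[c Hc] : forall k, exists c : nat -> R,
  (forall N : nat, \sum_(j < N) `|c j| * r ^+ j <= M) /\
  forall x, X x -> `|x| <= r / 2 -> forall N : nat,
    `|f k x - \sum_(j < N) c j * x ^+ j| <= M * (`|x| / r) ^+ N.
  by move=> k; case: (Hf k).
pose A (j : nat) : set R := [set` `[- (M / r ^+ j), M / r ^+ j]].
have cA : compact [set a : nat -> R | forall j, A j (a j)].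
  by apply: (@tychonoff _ (fun=> R) A) => j; exact: segment_compact.
have [|l [Al cl]] := cA (c @ \oo) _.
  exists 0%N => // k _ j /=.
  rewrite /A/= in_itv/= -ler_norml ler_pdivlMr ?exprn_gt0//.
  have [/(_ j.+1) + _] := Hc k; apply: le_trans.
  rewrite big_ord_recr/= lerDr sumr_ge0// => i _.
  by rewrite mulr_ge0// exprn_ge0// ltW.
exists l; split=> [N|x Xx xr N].
  apply/ler_addgt0Pr => e e0.
  have cG : {for l, continuous (fun a : nat -> R => \sum_(j < N) `|a j| * r ^+ j)}.
    apply: (@cvg_finite_sum _ _ _ N (fun j (a : nat -> R) => `|a j| * r ^+ j)
      (fun j => `|l j| * r ^+ j) (nbhs_filter l)) => j _; apply: cvgM; last exact: cvg_cst.
    by apply: cvg_norm; exact: proj_cont.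
  have [k _] := cluster_real 0 cl cG e0.
  have [/(_ N) H _] := Hc k.
  by move=> /ltW; rewrite distrC ler_norml => /andP[_]; lra.
apply/ler_addgt0Pr => e e0.
have e20 : 0 < e / 2 by rewrite divr_gt0.
have [K HK] := cvg_near_dist (fg x Xx xr) e20.
have cG : {for l, continuous (fun a : nat -> R => \sum_(j < N) a j * x ^+ j)}.
  apply: (@cvg_finite_sum _ _ _ N (fun j (a : nat -> R) => a j * x ^+ j)
    (fun j => l j * x ^+ j) (nbhs_filter l)) => j _; apply: cvgM; last exact: cvg_cst.
  exact: proj_cont.
have [k Kk Hk] := cluster_real K cl cG e20.
have [_ /(_ x Xx xr N) H] := Hc k.
have {}HK := HK k Kk.
set s := \sum_(_ < _) _; set t := \sum_(_ < _) _ in H Hk.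
rewrite (_ : g x - s = (g x - f k x) + (f k x - t) + (t - s)); last by ring.
apply: le_trans (ler_normD _ _) _; apply: le_trans (lerD (ler_normD _ _) (lexx _)) _.
by move: H HK Hk; rewrite /s; lra.
Qed.

Lemma ps_ball_cvg r M f (c : nat -> R) x : 0 < r ->
  (forall N : nat, `|f x - \sum_(j < N) c j * x ^+ j| <= M * (`|x| / r) ^+ N) ->
  `|x| <= r / 2 -> (fun N : nat => \sum_(j < N) c j * x ^+ j) @ \oo --> f x.
Proof.
move=> r0 H xr; apply/cvgrPdist_le => e e0.
have q1 : `| `|x| / r| < 1.
  rewrite ger0_norm ?divr_ge0 ?(ltW r0)// ltr_pdivrMr// mul1r (le_lt_trans xr)//.
  by rewrite ltr_pdivrMr//; lra.
have : (fun N : nat => M * (`|x| / r) ^+ N) @ \oo --> M * 0.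
  by apply: cvgM; [exact: cvg_cst|exact: cvg_expr].
rewrite mulr0 => /cvgrPdist_le/(_ e e0); apply: filterS => N.
rewrite sub0r normrN => HN; apply: le_trans (H N) _.
by apply: le_trans HN; exact: ler_norm.
Qed.

(** The products of the partial sums are polynomials whose majorants multiply, and
  they converge pointwise to the product. *)
Lemma ps_ball_mul r M M' f g : ps_ball r M f -> ps_ball r M' g ->
  ps_ball r (M * M') (fun x => f x * g x).
Proof.
move=> Hf Hg; have M0 := ps_ball_ge0 Hf; have M'0 := ps_ball_ge0 Hg.
case: Hf Hg => r0 [c [H1 H2]] [_ [d [K1 K2]]].
apply: (@ps_ball_lim _ _ (fun N x => (\sum_(j < N) c j * x ^+ j) *
   (\sum_(j < N) d j * x ^+ j))) => [N|x Xx xr]; last first.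
  by apply: cvgM; apply: (@ps_ball_cvg r) => //; [exact: H2|exact: K2].
have := ps_ball_sum r0 (fun i (_ : (i < N)%N) => ps_ball_sum r0 (fun j (_ : (j < N)%N) =>
  ps_ball_scale (c i * d j) (ps_ball_monomial (i + j) r0))).
set S := \sum_(_ < _) _; have SMM : S <= M * M'.
  rewrite (_ : S = (\sum_(i < N) `|c i| * r ^+ i) * (\sum_(i < N) `|d i| * r ^+ i)).
    by rewrite ler_pM// sumr_ge0// => i _; rewrite mulr_ge0// exprn_ge0// ltW.
  rewrite mulr_suml; apply: eq_bigr => i _; rewrite mulr_sumr.
  by apply: eq_bigr => j _; rewrite normrM exprD mulrACA.
move=> H; apply: ps_ball_le SMM _; apply: ps_ball_ext H => x _ _.
rewrite mulr_suml; apply: eq_bigr => i _; rewrite mulr_sumr.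
by apply: eq_bigr => j _; rewrite exprD mulrACA.
Qed.

Lemma ps_ball_exp r M f k : ps_ball r M f ->
  ps_ball r (M ^+ k) (fun x => f x ^+ k).
Proof.
move=> Hf; have r0 : 0 < r by case: Hf.
elim: k => [|k IH].
  by have := ps_ball_cst 1 r0; rewrite expr0 normr1.
rewrite exprS; apply: ps_ball_ext (ps_ball_mul Hf IH) => x _ _.
by rewrite exprS.
Qed.

(** The first nonzero coefficient of the series would dominate it near the origin, so
  all the coefficients vanish. *)
Lemma ps_ball_identity r M f : ps_ball r M f ->
  (forall d, 0 < d -> exists x, [/\ X x, x != 0, `|x| < d & f x = 0]) ->
  forall x, X x -> `|x| <= r / 2 -> f x = 0.
Proof.
move=> Hf acc; have M0 := ps_ball_ge0 Hf; case: Hf => r0 [c [H1 H2]].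
have c0 : forall j, c j = 0.
  apply: ltn_ind => j IH; apply/eqP; rewrite -normr_le0; apply/ler_addgt0Pr => e e0.
  rewrite add0r.
  pose d := Num.min (r / 2) (e * r ^+ j.+1 / (M + 1)).
  have d0 : 0 < d.
    rewrite lt_min !divr_gt0 ?mulr_gt0 ?exprn_gt0//; lra.
  have [x [Xx x0 xd fx]] := acc d d0.
  move: xd; rewrite lt_min => /andP[xr].
  rewrite ltr_pdivlMr; last by lra.
  move=> xe.
  have := H2 x Xx (ltW xr) j.+1; rewrite fx sub0r normrN big_ord_recr/= big1 ?add0r.
    rewrite normrM normrX expr_div_n => H.
    have xj : 0 < `|x| ^+ j by rewrite exprn_gt0// normr_gt0.
    have rj : 0 < r ^+ j.+1 by rewrite exprn_gt0.
    rewrite -(ler_pM2r xj); apply: le_trans H _.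
    rewrite mulrA ler_pdivrMr// exprSr.
    rewrite [X in _ <= X](_ : _ = `|x| ^+ j * (e * r ^+ j.+1)); last by ring.
    rewrite [X in X <= _](_ : _ = `|x| ^+ j * (`|x| * M)); last by ring.
    rewrite ler_wpM2l ?(ltW xj)//; apply: le_trans (ltW xe).
    by rewrite ler_wpM2l//; lra.
  by move=> i _; rewrite IH ?mul0r.
move=> x Xx xr; apply/eqP; rewrite -normr_le0.
have := ps_ball_cvg r0 (H2 x Xx xr) xr.
rewrite (_ : (fun N => _) = (fun=> 0)).
  by move/(cvg_unique (@Rhausdorff R) (cvg_cst _)) => <-; rewrite normr0.
by apply/funext => N; rewrite big1// => i _; rewrite c0 mul0r.
Qed.

End PowerSeriesBalls.

(** * Substitution into a power series in two variables *)

Section Functionals.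
Context {R : realType} (X : set R) (X0 : X 0).
Implicit Types (r rho M d x : R) (c : nat -> nat -> R).

Lemma cvg_shift k (u : nat -> R) (l : R) :
  u @ \oo --> l -> (fun N => u (N + k)%N) @ \oo --> l.
Proof. by rewrite -(cvg_shiftn k). Qed.

Lemma cvg_seqB (u v : nat -> R) (a b : R) : u @ \oo --> a -> v @ \oo --> b ->
  (fun N => u N - v N) @ \oo --> a - b.
Proof. exact: cvgB. Qed.

Lemma cvg_seqBc (u : nat -> R) (a k : R) : u @ \oo --> a ->
  (fun N => u N - k) @ \oo --> a - k.
Proof. by move=> H; apply: cvg_seqB => //; exact: cvg_cst. Qed.

Lemma cvg_seq_eq (u v : nat -> R) (a : R) : u =1 v -> u @ \oo --> a ->
  v @ \oo --> a.
Proof. by move=> /funext ->. Qed.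

Definition dsum c (N : nat) x y : R :=
  \sum_(i < N) \sum_(j < N) c i j * x ^+ i * y ^+ j.

Definition maj c r M := forall N : nat,
  \sum_(i < N) \sum_(j < N) `|c i j| * r ^+ (i + j) <= M.

(** Convergent double power series in the parameter and in the deviation of the
  second variable from [y0]. *)
Definition analytic_at (f : R -> R -> R) (y0 : R) := exists c r M,
  [/\ 0 < r, maj c r M & forall x s, X x -> `|x| < r -> `|s| < r ->
        (fun N => dsum c N x s) @ \oo --> f x (y0 + s)].

(** What substitution needs to know about [f]: [l] is the partial derivative in the
  second variable at the base point, and the substitution operator
  [s |-> f x (y0 + s x)] on power series is strictly differentiable at [0], with a
  Lipschitz remainder of constant [C * rho] on the ball of radius [rho]. *)
Definition smooth_at (f : R -> R -> R) (y0 : R) := exists l C r0,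
  [/\ 0 < C, 0 < r0 & forall r rho, 0 < r -> r <= rho -> rho <= r0 ->
    ps_ball X r (C * r) (fun x => f x y0 - f 0 y0) /\
    forall s s' d, ps_ball X r rho s -> ps_ball X r rho s' ->
      ps_ball X r d (fun x => s x - s' x) ->
      ps_ball X r (C * rho * d)
        (fun x => f x (y0 + s x) - f x (y0 + s' x) - l * (s x - s' x))].

Lemma dsum_delta (N a b : nat) (k : R) : (a < N)%N -> (b < N)%N ->
  \sum_(i < N) \sum_(j < N)
    (if (i == a :> nat) && (j == b :> nat) then k else 0) = k.
Proof.
move=> aN bN; rewrite (bigD1 (Ordinal aN))//= (bigD1 (Ordinal bN))//= !eqxx/=.
rewrite !big1 ?addr0// => i ia.
  by rewrite big1// => j _; rewrite -(inj_eq val_inj)/= in ia; rewrite (negPf ia).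
by rewrite -(inj_eq val_inj)/= in ia; rewrite (negPf ia).
Qed.

(** Telescoping [s^j - s'^j]. *)
Lemma ps_ball_pow_diff r rho d s s' j : ps_ball X r rho s -> ps_ball X r rho s' ->
  ps_ball X r d (fun x => s x - s' x) ->
  ps_ball X r (j%:R * rho ^+ j.-1 * d) (fun x => s x ^+ j - s' x ^+ j).
Proof.
move=> Hs Hs' Hd; have r0 : 0 < r by case: Hs.
have rho0 := ps_ball_ge0 Hs; have d0 := ps_ball_ge0 Hd.
elim: j => [|j IH].
  apply: (@ps_ball_ext _ _ _ _ (fun=> 0)) => [x _ _|]; first by rewrite !expr0 subrr.
  by rewrite mul0r mul0r; have := ps_ball_cst X 0 r0; rewrite normr0.
have := ps_ball_add (ps_ball_mul (ps_ball_exp j Hs) Hd) (ps_ball_mul Hs' IH).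
set a := (X in ps_ball _ _ X) => H.
have : ps_ball X r a (fun x => s x ^+ j.+1 - s' x ^+ j.+1).
  by apply: ps_ball_ext H => x _ _; rewrite !exprS; ring.
apply: ps_ball_le; rewrite /a /= -natr1; clear a H.
case: j {IH} => [|j] /=; first by rewrite expr0; lra.
by rewrite exprS; nra.
Qed.

(** A double series whose terms lie in balls with summable radii; the partial sums lie
  in the ball of radius the total sum and one passes to the limit. *)
Lemma ps_ball_dsum c r rho M K (g : nat -> nat -> R -> R) G : 0 < r -> 0 <= K ->
  maj c rho M ->
  (forall i j, ps_ball X r (K * (`|c i j| * rho ^+ (i + j))) (g i j)) ->
  (forall x, X x -> `|x| <= r / 2 ->
    (fun N => \sum_(i < N.+2) \sum_(j < N.+2) g i j x) @ \oo --> G x) ->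
  ps_ball X r (K * M) G.
Proof.
move=> r0 K0 cM gij HG; apply: (ps_ball_lim _ HG) => N.
have := ps_ball_sum r0 (fun i (_ : (i < N.+2)%N) =>
  ps_ball_sum r0 (fun j (_ : (j < N.+2)%N) => gij i j)).
apply: ps_ball_le.
rewrite (_ : \sum_(i < N.+2) _ = K * \sum_(i < N.+2) \sum_(j < N.+2) `|c i j| * rho ^+ (i + j)).
  by rewrite ler_wpM2l.
by rewrite mulr_sumr; apply: eq_bigr => i _; rewrite mulr_sumr.
Qed.

Lemma leq_exp2 j : j%:R <= 2 ^+ j :> R.
Proof.
elim: j => [|j IH]; first by rewrite expr0.
rewrite exprS -natr1; have : 1 <= 2 ^+ j :> R by rewrite exprn_ege1// ler1n.
lra.
Qed.

(** The difference of two substituted series, minus its linear part, is a double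
  series whose terms contain either a positive power of the parameter or a second
  power of the unknowns; both are bounded by [rho] times the difference. *)
Lemma analytic_at_smooth f y0 : analytic_at f y0 -> smooth_at f y0.
Proof.
move=> [c [r1 [M [r10 cM Hf]]]].
have M0 : 0 <= M by have := cM 0%N; rewrite big_ord0.
have f0 : f 0 y0 = c 0%N 0%N.
  have := Hf 0 0 X0; rewrite normr0 addr0 => /(_ r10 r10).
  move/(cvg_shift 1); rewrite (_ : (fun N => _) = (fun=> c 0%N 0%N)).
    by move/(cvg_unique (@Rhausdorff R) (cvg_cst _)).
  apply/funext => N; rewrite /dsum addn1 /=.
  rewrite -[RHS](@dsum_delta N.+1 0 0 (c 0%N 0%N))//.
  apply: eq_bigr => i _; apply: eq_bigr => j _.
  case: i j => [[|i] Hi] [[|j] Hj]/=; rewrite ?expr0 ?mulr1// exprS mul0r ?mulr0 ?mul0r//.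
pose C := 4 / r1 ^+ 2 * M + M / r1 + 1.
have r1' : 0 < r1 ^+ 2 by rewrite exprn_gt0.
have c10 : 0 <= M / r1 by rewrite divr_ge0// ltW.
have c20 : 0 <= 4 / r1 ^+ 2 * M by rewrite mulr_ge0// divr_ge0// ltW.
exists (c 0%N 1%N), C, (r1 / 2); split; rewrite ?divr_gt0//; first by rewrite /C; lra.
move=> r rho r0 rrho rhor1; split.
  apply: (@ps_ball_le _ _ _ (r / r1 * M)).
    by rewrite /C mulrAC; nra.
  apply: (@ps_ball_dsum c r r1 M (r / r1) (fun i j x =>
     (if (i == 0%N) && (j == 0%N) then 0 else c i j) * (x ^+ i * 0 ^+ j))) => //.
    by rewrite divr_ge0 ?ltW.
    move=> i j; case: j => [|j].
      have := ps_ball_scale (if (i == 0%N) && true then 0 else c i 0%N)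
        (ps_ball_monomial X i r0).
      set a := (X in ps_ball _ _ X) => H.
      have : ps_ball X r a (fun x => (if (i == 0%N) && (0 == 0)%N then 0 else c i 0%N)
          * (x ^+ i * 0 ^+ 0)).
        by apply: ps_ball_ext H => x _ _; rewrite expr0 mulr1.
      apply: ps_ball_le; rewrite /a; clear a H; case: i => [|i] /=.
        by rewrite normr0 mul0r !mulr_ge0 ?invr_ge0 ?exprn_ge0 ?(ltW r0) ?(ltW r10).
      rewrite addn0 mulrCA ler_wpM2l// exprS [X in _ <= _ * X]exprS.
      rewrite [X in _ <= X](_ : _ = r * r1 ^+ i); last by field; rewrite gt_eqF.
      rewrite ler_wpM2l ?(ltW r0)// lerXn2r ?nnegrE ?(ltW r0) ?(ltW r10)//; lra.
    apply: (@ps_ball_ext _ _ _ _ (fun=> 0)) => [x _ _|].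
      by rewrite exprS mul0r mulr0 mulr0.
    apply: (@ps_ball_le _ _ _ `|0|); last exact: ps_ball_cst.
    by rewrite normr0 !mulr_ge0 ?invr_ge0 ?exprn_ge0 ?(ltW r0) ?(ltW r10).
  move=> x Xx xr; rewrite f0.
  have xr1 : `|x| < r1 by apply: le_lt_trans xr _; lra.
  have := Hf x 0 Xx xr1; rewrite normr0 addr0 => /(_ r10).
  move/(cvg_shift 2) => H; have := cvg_seqBc (k := c 0%N 0%N) H.
  move=> H2; apply: (cvg_seq_eq _ H2) => N.
  rewrite /dsum /= addn2 -{1}(@dsum_delta N.+2 0 0 (c 0%N 0%N))//.
  rewrite -sumrB; apply: eq_bigr => i _; rewrite -sumrB; apply: eq_bigr => j _.
  case: i j => [[|i] Hi] [[|j] Hj] /=; rewrite ?expr0; ring.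
move=> s s' d Hs Hs' Hd.
have d0 := ps_ball_ge0 Hd; have rho0 := ps_ball_ge0 Hs.
apply: (@ps_ball_le _ _ _ (4 / r1 ^+ 2 * rho * d * M)).
  rewrite /C; have : 0 <= rho * d by rewrite mulr_ge0.
  move: (mulr_ge0 rho0 d0); nra.
apply: (@ps_ball_dsum c r r1 M _ (fun i j x =>
   (if (i == 0%N) && (j == 1%N) then 0 else c i j) * (x ^+ i * (s x ^+ j - s' x ^+ j)))) => //.
  by rewrite !mulr_ge0 ?invr_ge0 ?(ltW r1').
  move=> i j.
  have H := ps_ball_scale (if (i == 0%N) && (j == 1%N) then 0 else c i j)
    (ps_ball_mul (ps_ball_monomial X i r0) (ps_ball_pow_diff j Hs Hs' Hd)).
  apply: ps_ball_le H; case: ifPn => [_|ij].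
    by rewrite normr0 mul0r !mulr_ge0 ?invr_ge0 ?exprn_ge0 ?(ltW r1') ?(ltW r10).
  case: j ij => [|j] ij.
    by rewrite !mul0r !mulr0 !mulr_ge0 ?invr_ge0 ?exprn_ge0 ?(ltW r1') ?(ltW r10).
  rewrite [X in _ <= X](_ : _ =
     `|c i j.+1| * (4 / r1 ^+ 2 * rho * r1 ^+ (i + j.+1) * d)); last by ring.
  rewrite ler_wpM2l// mulrA ler_wpM2r//=.
  have [k kE] : exists k, (i + j)%N = k.+1.
    by case: i ij => [|i]; case: j => [|j]//= _; [exists j|exists (i + 0)%N|exists (i + j.+1)%N].
  apply: (@le_trans _ _ (2 ^+ k.+2 * rho ^+ k.+1)).
    rewrite -kE exprD mulrCA [X in X <= _](_ : _ = j.+1%:R * (r ^+ i * rho ^+ j)); last by ring.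
    rewrite ler_pM ?mulr_ge0 ?exprn_ge0 ?(ltW r0)//.
      apply: (le_trans (leq_exp2 j.+1)); rewrite ler_eXn2l ?ltr1n//.
      by rewrite -addnS leq_addl.
    by rewrite ler_wpM2r ?exprn_ge0// lerXn2r ?nnegrE ?(ltW r0).
  rewrite addnS kE.
  rewrite [X in _ <= X](_ : _ = 4 * rho * r1 ^+ k); last first.
    by rewrite !exprS; field; rewrite gt_eqF.
  rewrite !exprS; have : (2 * rho) ^+ k <= r1 ^+ k.
    rewrite lerXn2r ?nnegrE ?(ltW r10)//; lra.
  rewrite exprMn; set u := 2 ^+ k; set v := rho ^+ k; set w := r1 ^+ k => H1.
  nra.
move=> x Xx xr.
have xr1 : `|x| < r1 by apply: le_lt_trans xr _; lra.
have sr1 t : ps_ball X r rho t -> `|t x| < r1.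
  move=> Ht; apply: le_lt_trans (ps_ball_bound Ht Xx xr) _; lra.
have := cvg_seqB (Hf x (s x) Xx xr1 (sr1 s Hs)) (Hf x (s' x) Xx xr1 (sr1 s' Hs')).
move/(cvg_shift 2) => H; have := cvg_seqBc (k := c 0%N 1%N * (s x - s' x)) H.
move=> H2; apply: (cvg_seq_eq _ H2) => N.
rewrite /dsum /= addn2 -{1}(@dsum_delta N.+2 0 1 (c 0%N 1%N * (s x - s' x)))//.
rewrite -!sumrB; apply: eq_bigr => i _; rewrite -!sumrB; apply: eq_bigr => j _.
case: i j => [[|i] Hi] [[|[|j]] Hj] /=; rewrite ?expr0 ?expr1; ring.
Qed.

End Functionals.

(** * Analytic functionals of finitely many unknowns *)

Section Good.
Context {R : realType} (X : set R) (X0 : X 0) (N : nat).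
Implicit Types (r rho M d x C : R) (Phi Psi : R -> (nat -> R) -> R) (l : nat -> R).

Definition lin l (v : nat -> R) : R := \sum_(i < N) l i * v i.

(** [Phi] takes the parameter and finitely many unknowns. Substituting small power
  series for the unknowns must produce a power series, up to [l] and a remainder
  with a Lipschitz constant proportional to the size [rho] of the unknowns: this is
  exactly what makes Newton iterations contract. *)
Definition strictly_diff Phi l C rho0 := forall r rho, 0 < r -> r <= rho ->
  rho <= rho0 ->
    ps_ball X r (C * r) (fun x => Phi x (fun=> 0) - Phi 0 (fun=> 0)) /\
    forall (a b : nat -> R -> R) d,
      (forall i, ps_ball X r rho (a i)) -> (forall i, ps_ball X r rho (b i)) ->
      (forall i, ps_ball X r d (fun x => a i x - b i x)) ->
      ps_ball X r (C * rho * d) (fun x => Phi x (a^~ x) - Phi x (b^~ x)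
        - lin l (fun i => a i x - b i x)).

Definition analytic_functional Phi l := exists C rho0,
  [/\ 1 <= C, 0 < rho0, rho0 <= 1 & strictly_diff Phi l C rho0].

Lemma strictly_diff_le Phi l C C' rho0 rho1 : C <= C' -> rho1 <= rho0 ->
  strictly_diff Phi l C rho0 -> strictly_diff Phi l C' rho1.
Proof.
move=> CC rr H r rho r0 rrho rhor; have [] := H r rho r0 rrho (le_trans rhor rr).
move=> H1 H2; split; first by apply: ps_ball_le H1; rewrite ler_wpM2r// ltW.
move=> a b d Ha Hb Hd; have rho0_ := ps_ball_ge0 (Ha 0%N).
by apply: ps_ball_le (H2 a b d Ha Hb Hd); rewrite !ler_wpM2r// (ps_ball_ge0 (Hd 0%N)).
Qed.

Lemma ps_ball_lin l r d (v : nat -> R -> R) :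
  (forall i, ps_ball X r d (v i)) ->
  ps_ball X r ((\sum_(i < N) `|l i|) * d) (fun x => lin l (fun i => v i x)).
Proof.
move=> Hv; have r0 : 0 < r by case: (Hv 0%N).
have := ps_ball_sum r0 (fun i (_ : (i < N)%N) => ps_ball_scale (l i) (Hv i)).
by rewrite mulr_suml.
Qed.

(** The linear part only costs a constant: the functional itself is Lipschitz. *)
Lemma functional_lip Phi l : analytic_functional Phi l -> exists C rho0,
  [/\ 1 <= C, 0 < rho0, rho0 <= 1, strictly_diff Phi l C rho0 &
   forall r rho, 0 < r -> r <= rho -> rho <= rho0 ->
    forall a : nat -> R -> R, (forall i, ps_ball X r rho (a i)) ->
    ps_ball X r (C * rho) (fun x => Phi x (a^~ x) - Phi 0 (fun=> 0)) /\
    forall (b : nat -> R -> R) d, (forall i, ps_ball X r rho (b i)) ->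
      (forall i, ps_ball X r d (fun x => a i x - b i x)) ->
      ps_ball X r (C * d) (fun x => Phi x (a^~ x) - Phi x (b^~ x))].
Proof.
move=> [C [rho0 [C1 rho00 rho01 H]]].
pose L := \sum_(i < N) `|l i|.
have L0 : 0 <= L by rewrite sumr_ge0.
have CL : C <= C + C + L by lra.
exists (C + C + L), rho0; split => //; first by lra.
  exact: strictly_diff_le CL (lexx _) H.
move=> r rho r0 rrho rhor a Ha; have [H1 H2] := H r rho r0 rrho rhor.
have Hlip : forall (b : nat -> R -> R) d, (forall i, ps_ball X r rho (b i)) ->
      (forall i, ps_ball X r d (fun x => a i x - b i x)) ->
      ps_ball X r ((C + L) * d) (fun x => Phi x (a^~ x) - Phi x (b^~ x)).
  move=> b d Hb Hd; have d0 := ps_ball_ge0 (Hd 0%N).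
  have := ps_ball_add (H2 a b d Ha Hb Hd) (ps_ball_lin l Hd).
  move=> /(ps_ball_ext (fun x _ _ => subrK _ _)); apply: ps_ball_le.
  rewrite mulrDl lerD2r ler_wpM2r// -[leRHS]mulr1 ler_wpM2l//; lra.
split=> [|b d Hb Hd].
  have Hz i : ps_ball X r rho ((fun (_ : nat) (_ : R) => 0 : R) i).
    by apply: (@ps_ball_le _ _ _ `|0|); [rewrite normr0; lra|exact: ps_ball_cst].
  have Ha0 i : ps_ball X r rho (fun x => a i x - (fun (_ : nat) (_ : R) => 0 : R) i x).
    by apply: ps_ball_ext (Ha i) => x _ _; rewrite subr0.
  have := ps_ball_add (Hlip _ _ Hz Ha0) H1.
  move=> /(ps_ball_ext (fun x _ _ => subrKA _ _ _)); apply: ps_ball_le; nra.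
have d0 := ps_ball_ge0 (Hd 0%N).
by apply: ps_ball_le (Hlip b d Hb Hd); rewrite ler_wpM2r//; lra.
Qed.

Lemma functional_ext Phi Psi l : (forall x a, X x -> Phi x a = Psi x a) ->
  analytic_functional Phi l -> analytic_functional Psi l.
Proof.
move=> PP [C [rho0 [C1 rho00 rho01 H]]]; exists C, rho0; split=> // r rho r0 rr rr0.
have [H1 H2] := H r rho r0 rr rr0; split.
  by apply: ps_ball_ext H1 => x Xx _; rewrite !PP.
move=> a b d Ha Hb Hd.
by apply: ps_ball_ext (H2 a b d Ha Hb Hd) => x Xx _; rewrite !PP.
Qed.

Lemma functional_cst k : analytic_functional (fun _ _ => k) (fun=> 0).
Proof.
exists 1, 1; split=> // r rho r0 rrho rho1; split.
  apply: (@ps_ball_ext _ _ _ _ (fun=> 0)) => [x _ _|]; first by rewrite subrr.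
  by apply: (@ps_ball_le _ _ _ `|0|); [rewrite normr0; lra|exact: ps_ball_cst].
move=> a b d Ha Hb Hd; have d0 := ps_ball_ge0 (Hd 0%N).
apply: (@ps_ball_ext _ _ _ _ (fun=> 0)) => [x _ _|].
  by rewrite subrr /lin big1 ?subr0// => i _; rewrite mul0r.
apply: (@ps_ball_le _ _ _ `|0|); last exact: ps_ball_cst.
by rewrite normr0 mul1r mulr_ge0//; lra.
Qed.

Lemma functional_coord k j : (j < N)%N ->
  analytic_functional (fun _ a => k + a j) (fun i => (i == j)%:R).
Proof.
move=> jN; exists 1, 1; split=> // r rho r0 rrho rho1; split.
  apply: (@ps_ball_ext _ _ _ _ (fun=> 0)) => [x _ _|]; first by rewrite subrr.
  by apply: (@ps_ball_le _ _ _ `|0|); [rewrite normr0; lra|exact: ps_ball_cst].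
move=> a b d Ha Hb Hd; have d0 := ps_ball_ge0 (Hd 0%N).
apply: (@ps_ball_ext _ _ _ _ (fun=> 0)) => [x _ _|].
  rewrite /lin (bigD1 (Ordinal jN))//= eqxx mul1r big1 ?addr0; first by ring.
  by move=> i; rewrite -(inj_eq val_inj)/= => /negPf->; rewrite mul0r.
apply: (@ps_ball_le _ _ _ `|0|); last exact: ps_ball_cst.
by rewrite normr0 mul1r mulr_ge0//; lra.
Qed.

Lemma functional_add Phi Psi l l' : analytic_functional Phi l -> analytic_functional Psi l' ->
  analytic_functional (fun x a => Phi x a + Psi x a) (fun i => l i + l' i).
Proof.
move=> [C [p [C1 p0 p1 H]]] [C' [p' [C1' p0' p1' H']]].
exists (C + C'), (Num.min p p'); split; [lra|by rewrite lt_min p0|by rewrite ge_min p1|].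
move=> r rho r0 rr; rewrite le_min => /andP[rp rp'].
have [H1 H2] := H r rho r0 rr rp; have [K1 K2] := H' r rho r0 rr rp'; split.
  by rewrite mulrDl; apply: ps_ball_ext (ps_ball_add H1 K1) => x _ _; ring.
move=> a b d Ha Hb Hd; rewrite !mulrDl.
apply: ps_ball_ext (ps_ball_add (H2 a b d Ha Hb Hd) (K2 a b d Ha Hb Hd)) => x _ _.
rewrite /lin [X in _ = _ - X](_ : _ = \sum_(i < N) l i * (a i x - b i x) +
  \sum_(i < N) l' i * (a i x - b i x)); first by ring.
by rewrite -big_split; apply: eq_bigr => i _; rewrite mulrDl.
Qed.

Lemma functional_scale Phi l k : analytic_functional Phi l ->
  analytic_functional (fun x a => k * Phi x a) (fun i => k * l i).
Proof.
move=> [C [p [C1 p0 p1 H]]].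
have kC : `|k| * C <= 1 + `|k| * C by lra.
exists (1 + `|k| * C), p; split=> //.
  by rewrite lerDl mulr_ge0//; lra.
move=> r rho r0 rr rp; have [H1 H2] := H r rho r0 rr rp; split.
  apply: (@ps_ball_le _ _ _ (`|k| * (C * r))).
    by rewrite !mulrA ler_wpM2r// ltW.
  by apply: ps_ball_ext (ps_ball_scale k H1) => x _ _; rewrite mulrBr.
move=> a b d Ha Hb Hd; have d0 := ps_ball_ge0 (Hd 0%N).
have rho0 : 0 <= rho by lra.
apply: (@ps_ball_le _ _ _ (`|k| * (C * rho * d))).
  by rewrite !mulrA !ler_wpM2r.
apply: ps_ball_ext (ps_ball_scale k (H2 a b d Ha Hb Hd)) => x _ _.
rewrite !mulrBr; congr (_ - _); rewrite /lin mulr_sumr.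
by apply: eq_bigr => i _; rewrite mulrA.
Qed.

Lemma functional_opp Phi l : analytic_functional Phi l ->
  analytic_functional (fun x a => - Phi x a) (fun i => - 1 * l i).
Proof.
by move=> /(functional_scale (-1)); apply: functional_ext => x a _; rewrite mulN1r.
Qed.

(** The chain rule for strict differentiability. *)
Lemma functional_comp f Phi l : analytic_functional Phi l -> smooth_at X f (Phi 0 (fun=> 0)) ->
  exists l', analytic_functional (fun x a => f x (Phi x a)) l'.
Proof.
move=> gPhi [k [C' [r0 [C'0 r00 Hf]]]].
have [C [p [C1 p0 p1 HPhi HL]]] := functional_lip gPhi.
have C0 : 0 < C by lra.
set y0 := Phi 0 (fun=> 0) in Hf *.
pose K := C' * C * C + `|k| * C + C' + 1.
have CC0 : 0 <= C' * C * C by rewrite !mulr_ge0// ltW.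
have kC0 : 0 <= `|k| * C by rewrite mulr_ge0// ltW.
have q0 : 0 < Num.min p (r0 / C) by rewrite lt_min p0 divr_gt0.
exists (fun i => k * l i), K, (Num.min p (r0 / C)); split=> //.
- by rewrite /K; lra.
- by rewrite ge_min p1.
move=> r rho rgt0 rrho; rewrite le_min => /andP[rhop].
rewrite ler_pdivlMr// => rhor0.
have rr0 : r * C <= r0 by apply: le_trans rhor0; rewrite ler_wpM2r// ltW.
have rC t : 0 <= t -> t <= C * t by move=> t0; rewrite ler_peMl.
have [Z1 _] := Hf r (C * r) rgt0 (rC _ (ltW rgt0)) ltac:(by rewrite mulrC).
have [_ Z2] := Hf r (C * r) rgt0 (rC _ (ltW rgt0)) ltac:(by rewrite mulrC).
have rho_ge0 : 0 <= rho := le_trans (ltW rgt0) rrho.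
have Crho : r <= C * rho := le_trans rrho (rC _ rho_ge0).
have [_ Z3] := Hf r (C * rho) rgt0 Crho ltac:(by rewrite mulrC).
have zero q : 0 <= q -> ps_ball X r q (fun=> 0).
  by move=> q_ge0; apply: (@ps_ball_le _ _ _ `|0|); [rewrite normr0|exact: ps_ball_cst].
have rp : r <= p by lra.
split.
  have [H1 _] := HPhi r r rgt0 (lexx _) rp.
  have H3 : ps_ball X r (C * r) (fun x => (Phi x (fun=> 0) - y0) - 0).
    by apply: ps_ball_ext H1 => x _ _; rewrite subr0.
  have H2 := Z2 _ (fun=> 0) _ H1 (zero (C * r) (mulr_ge0 (ltW C0) (ltW rgt0))) H3.
  have := ps_ball_add (ps_ball_add H2 (ps_ball_scale k H1)) Z1.
  set m := (X in ps_ball _ _ X) => H4.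
  have mK : m <= K * r.
    have Cr1 : C * r * (C * r) <= C * C * r.
      rewrite [leLHS](_ : _ = C * C * r * r); last by ring.
      by rewrite ler_piMr ?mulr_ge0 ?(ltW C0) ?(ltW rgt0)//; lra.
    rewrite /m /K [leLHS](_ : _ = C' * (C * r * (C * r)) + (`|k| * C + C') * r); last by ring.
    rewrite [leRHS](_ : _ = C' * (C * C * r) + (`|k| * C + C') * r + r); last by ring.
    have := ler_wpM2l (ltW C'0) Cr1; lra.
  apply: ps_ball_le mK _; apply: ps_ball_ext H4 => x _ _.
  by rewrite (subrKC y0) !addr0 /y0; ring.
move=> a b d Ha Hb Hd; have d0 := ps_ball_ge0 (Hd 0%N).
have [A1 A2] := HL r rho rgt0 rrho rhop a Ha.
have [B1 _] := HL r rho rgt0 rrho rhop b Hb.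
have {}A2 := A2 b d Hb Hd.
have A3 : ps_ball X r (C * d) (fun x => (Phi x (a^~ x) - y0) - (Phi x (b^~ x) - y0)).
  by apply: ps_ball_ext A2 => x _ _; ring.
have H2 := Z3 _ _ _ A1 B1 A3.
have [_ H5] := HPhi r rho rgt0 rrho rhop.
have := ps_ball_add H2 (ps_ball_scale k (H5 a b d Ha Hb Hd)).
set m := (X in ps_ball _ _ X) => H4.
have mK : m <= K * rho * d.
  have rd : 0 <= rho * d by rewrite mulr_ge0//; lra.
  rewrite /m /K.
  rewrite [leLHS](_ : _ = (C' * C * C + `|k| * C) * (rho * d)); last by ring.
  by rewrite -[leRHS]mulrA ler_wpM2r//; lra.
apply: ps_ball_le mK _; apply: ps_ball_ext H4 => x _ _.
rewrite !(subrKC y0) [lin _ _ in RHS](_ : _ = k * lin l (fun i => a i x - b i x)).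
  by ring.
by rewrite /lin mulr_sumr; apply: eq_bigr => i _; rewrite mulrA.
Qed.

Lemma smooth_at_sqr y0 : smooth_at X (fun _ y => y ^+ 2) y0.
Proof.
exists (2 * y0), 2, 1; split=> // r rho r0 rr rho1; split.
  apply: (@ps_ball_ext _ _ _ _ (fun=> 0)) => [x _ _|]; first by rewrite subrr.
  apply: (@ps_ball_le _ _ _ `|0|); last exact: ps_ball_cst.
  by rewrite normr0; lra.
move=> s s' d Hs Hs' Hd.
rewrite (_ : 2 * rho * d = (rho + rho) * d); last by ring.
by apply: ps_ball_ext (ps_ball_mul (ps_ball_add Hs Hs') Hd) => x _ _; ring.
Qed.

(** Polarization reduces products to squares, hence to composition. *)
Lemma functional_mul Phi Psi l l' : analytic_functional Phi l -> analytic_functional Psi l' ->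
  exists m, analytic_functional (fun x a => Phi x a * Psi x a) m.
Proof.
move=> g1 g2; have [m1 H1] := functional_comp (functional_add g1 g2) (smooth_at_sqr _).
have [m2 H2] := functional_comp (functional_add g1 (functional_opp g2)) (smooth_at_sqr _).
have := functional_scale (1 / 4) (functional_add H1 (functional_opp H2)).
set m := (X in analytic_functional _ X) => H; exists m; apply: functional_ext H => x a _.
by field.
Qed.

End Good.

(** * The derivative of a power series in two variables *)

Section AnalyticDerivative.
Context {R : realType}.
Implicit Types (X : set R) (r M x y s h d : R).

(** Differentiability with a quadratic error: unlike a mere derivative, it controls
  the difference quotients of a power series with an explicit constant, which
  makes it possible to pass to the limit in the partial sums. *)
Definition quad_deriv (g : R -> R) y l := exists C d, [/\ 0 < C, 0 < d &
  forall h, `|h| <= d -> `|g (y + h) - g y - l * h| <= C * h ^+ 2].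

(** Substitute constants for the unknown series. *)
Lemma smooth_at_quad_deriv X f y : X 0 -> smooth_at X f y ->
  exists l, quad_deriv (f 0) y l.
Proof.
move=> X0 [l [C [r0 [C0 r00 H]]]]; exists l, C, r0; split=> // h hr.
have [->|h0] := eqVneq h 0.
  by rewrite addr0 subrr mulr0 subr0 normr0 expr0n mulr0.
have h_gt0 : 0 < `|h| by rewrite normr_gt0.
have [_ /(_ (fun=> h) (fun=> 0) `|h|)] := H _ _ h_gt0 (lexx _) hr.
have H1 := ps_ball_cst X h h_gt0.
have H2 : ps_ball X `|h| `|h| (fun=> 0).
  by apply: (@ps_ball_le _ _ _ `|0|); [rewrite normr0|exact: ps_ball_cst].
have H3 : ps_ball X `|h| `|h| (fun=> h - 0).
  by apply: ps_ball_ext H1 => x _ _; rewrite subr0.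
move=> /(_ H1 H2 H3) /ps_ball_bound/(_ X0); rewrite normr0 divr_ge0// => /(_ isT).
by rewrite subr0 addr0 -mulrA -expr2 real_normK ?num_real.
Qed.

Lemma smooth_at_continuous X f y e : smooth_at X f y -> 0 < e ->
  exists d, 0 < d /\ forall x s, X x -> `|x| <= d -> `|s| <= d ->
    `|f x (y + s) - f 0 y| < e.
Proof.
move=> [l [C [r0 [C0 r00 H]]]] e0.
pose t := Num.min (Num.min r0 1) (e / (2 * (C + C + `|l|))).
have L0 : 0 <= `|l| by [].
have t0 : 0 < t by rewrite !lt_min r00 ltr01 divr_gt0// mulr_gt0//; lra.
have tr0 : t <= r0 by rewrite !ge_min lexx.
have t1 : t <= 1 by rewrite !ge_min lexx orbT.
have te : t * (2 * (C + C + `|l|)) <= e.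
  by rewrite -ler_pdivlMr ?ge_min ?lexx ?orbT// mulr_gt0//; lra.
exists (t / 2); split=> [|x s Xx xt st]; first by rewrite divr_gt0.
have [H1 H2] := H _ _ t0 (lexx _) tr0.
have {}H1 := ps_ball_bound H1 Xx xt.
have B k : `|k| <= t -> ps_ball X t t (fun=> k).
  by move=> kt; apply: (@ps_ball_le _ _ _ `|k|) => //; exact: ps_ball_cst.
have st' : `|s| <= t by lra.
have := H2 (fun=> s) (fun=> 0) t (B s st') (B 0 _) (B (s - 0) _).
rewrite normr0 subr0 (ltW t0) => /(_ isT st') /ps_ball_bound/(_ Xx xt).
rewrite addr0 => {}H2.
rewrite (_ : f x (y + s) - f 0 y =
  (f x (y + s) - f x y - l * s) + l * s + (f x y - f 0 y)); last by ring.
apply: le_lt_trans (ler_normD _ _) _.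
apply: le_lt_trans (lerD (ler_normD _ _) (lexx _)) _.
have ls : `|l * s| <= `|l| * t by rewrite normrM ler_wpM2l.
have tt : C * t * t <= C * t by rewrite ler_piMr// mulr_ge0 ?ltW.
lra.
Qed.

(** Second-order Taylor bound for a monomial, with all powers of [r] made explicit so
  that it can be summed against a majorant. *)
Lemma pow_taylor r s h j : 0 < r -> `|s| <= r -> `|s + h| <= r ->
  `|(s + h) ^+ j - s ^+ j - j%:R * s ^+ j.-1 * h| * r ^+ 2 <=
    j%:R ^+ 2 * r ^+ j * h ^+ 2.
Proof.
move=> r0 sr shr; elim: j => [|j IH].
  by rewrite !expr0 subrr mul0r mul0r subrr normr0 mul0r expr0n/= mul0r mul0r.
rewrite (_ : _ - _ = (s + h) * ((s + h) ^+ j - s ^+ j - j%:R * s ^+ j.-1 * h)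
   + j%:R * s ^+ j.-1 * h ^+ 2); last first.
  case: j {IH} => [|j] /=; first by rewrite !expr0 !expr1; ring.
  by rewrite -!natr1 !exprS; ring.
set u := (_ - _ - _) in IH *.
have := sqr_ge0 h; set w := h ^+ 2 in IH * => h20; clearbody w.
apply: (@le_trans _ _ (r * (`|u| * r ^+ 2) + j%:R * r ^+ j.+1 * w)).
  apply: le_trans (ler_wpM2r (sqr_ge0 _) (ler_normD _ _)) _.
  rewrite mulrDl; apply: lerD.
    by rewrite normrM -mulrA ler_wpM2r// mulr_ge0// sqr_ge0.
  rewrite !normrM normr_nat (ger0_norm h20) normrX.
  case: j {IH u} => [|j] /=; first by rewrite !mul0r.
  rewrite mulrAC ler_wpM2r// -mulrA ler_wpM2l// -[j.+2]addn2 exprD.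
  by rewrite ler_wpM2r ?sqr_ge0// lerXn2r ?nnegrE// ltW.
apply: (@le_trans _ _ (r * (j%:R ^+ 2 * r ^+ j * w) + j%:R * r ^+ j.+1 * w)).
  by rewrite lerD2r ler_wpM2l// ltW.
rewrite [leLHS](_ : _ = (j%:R ^+ 2 + j%:R) * (r ^+ j.+1 * w)); last first.
  by rewrite (exprS r j); ring.
rewrite -[leRHS]mulrA ler_wpM2r ?mulr_ge0 ?exprn_ge0 ?(ltW r0)// -natr1.
have : 0 <= j%:R :> R by []. nra.
Qed.

(** Differentiation in the second variable sends the rectangle of indices [N x (N + 1)]
  to the square [N x N], so partial sums over rectangles are needed. *)
Lemma dsum_rect (c : nat -> nat -> R) N x s : dsum c N.+1 x s =
  \sum_(i < N) \sum_(j < N.+1) c i j * x ^+ i * s ^+ j +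
  \sum_(j < N.+1) c N j * x ^+ N * s ^+ j.
Proof. by rewrite /dsum big_ord_recr. Qed.

Lemma maj_rect (c : nat -> nat -> R) r M N : 0 < r -> maj c r M ->
  \sum_(i < N) \sum_(j < N.+1) `|c i j| * r ^+ (i + j) <= M /\
  \sum_(j < N.+1) `|c N j| * r ^+ (N + j) <= M.
Proof.
move=> r0 /(_ N.+1); rewrite big_ord_recr /= => H.
have P i j : 0 <= `|c i j| * r ^+ (i + j) by rewrite mulr_ge0// exprn_ge0// ltW.
have A : 0 <= \sum_(i < N) \sum_(j < N.+1) `|c i j| * r ^+ (i + j).
  by do 2 (apply: sumr_ge0 => ? _).
have B : 0 <= \sum_(j < N.+1) `|c N j| * r ^+ (N + j) by apply: sumr_ge0.
by split; lra.
Qed.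

(** Termwise differentiation: the factor [j] produced by it is absorbed by passing to
  a smaller radius, and [pow_taylor] identifies the sum of the derived series with
  the derivative. *)
Lemma analytic_at_deriv X (f D : R -> R -> R) y0 r0 : 0 < r0 ->
  analytic_at X f y0 ->
  (forall x s, X x -> `|x| < r0 -> `|s| < r0 ->
     quad_deriv (f x) (y0 + s) (D x (y0 + s))) ->
  analytic_at X D y0.
Proof.
move=> r00 [c [r [M [rgt0 cM Hf]]]] HD.
have r_neq0 : r != 0 by rewrite gt_eqF.
exists (fun i j => j.+1%:R * c i j.+1), (Num.min r0 (r / 8)), (M / r); split.
- by rewrite lt_min r00 divr_gt0.
- move=> N; have [_ _] := maj_rect N rgt0 cM.
  apply: (@le_trans _ _ ((\sum_(i < N) \sum_(j < N.+1) `|c i j| * r ^+ (i + j)) / r)).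
    rewrite mulr_suml; apply: ler_sum => i _; rewrite big_ord_recl/= mulrDl mulr_suml.
    rewrite -[leLHS]add0r lerD//.
      by rewrite divr_ge0 ?mulr_ge0 ?exprn_ge0 ?(ltW rgt0).
    apply: ler_sum => j _; rewrite normrM normr_nat /bump/= add1n addnS exprS.
    rewrite [leRHS](_ : _ = `|c i j.+1| * r ^+ (i + j)); last by field.
    rewrite -mulrA mulrCA ler_wpM2l//.
    have m8 : Num.min r0 (r / 8) <= r / 8 by rewrite ge_min lexx orbT.
    have m0 : 0 <= Num.min r0 (r / 8) by rewrite le_min (ltW r00) divr_ge0// ltW.
    apply: (@le_trans _ _ (j.+1%:R * (r / 8) ^+ (i + j))).
      by rewrite ler_wpM2l// lerXn2r ?nnegrE// (le_trans m0).
    rewrite expr_div_n mulrA ler_pdivrMr ?exprn_gt0// mulrC ler_wpM2l ?exprn_ge0 ?(ltW rgt0)//.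
    apply: (@le_trans _ _ (8 ^+ j)).
      elim: (nat_of_ord j) => [|k IH]; first by rewrite expr0.
      have : 1 <= 8 ^+ k :> R by rewrite exprn_ege1//; lra.
      by rewrite exprS -(natr1 k.+1); lra.
    rewrite exprD.
    by rewrite ler_peMl ?exprn_ge0// exprn_ege1//; lra.
  by rewrite ler_wpM2r ?invr_ge0 ?(ltW rgt0)//; have [] := maj_rect N rgt0 cM.
move=> x s Xx; rewrite !lt_min => /andP[xr0 xr] /andP[sr0 sr].
have M0 : 0 <= M by have := cM 0%N; rewrite big_ord0.
have [C [d [C0 d0 HC]]] := HD x s Xx xr0 sr0.
set l := D x (y0 + s) in HC *; pose c' (i j : nat) : R := j.+1%:R * c i j.+1.
pose F (N : nat) t := \sum_(i < N) \sum_(j < N.+1) c i j * x ^+ i * t ^+ j.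
have FC t : `|t| <= r / 4 -> (fun N => F N t) @ \oo --> f x (y0 + t).
  move=> tr; have := Hf x t Xx; have xr1 : `|x| < r by lra.
  have tr1 : `|t| < r by lra.
  move=> /(_ xr1 tr1) /(cvg_shift 1) H.
  rewrite -[f x _]subr0.
  apply: (@cvg_seq_eq _ (fun N => dsum c (N + 1) x t -
    \sum_(j < N.+1) c N j * x ^+ N * t ^+ j)).
    by move=> N; rewrite addn1 dsum_rect addrK.
  apply: cvg_seqB => //; apply/cvgr0Pnorm_le => e e0.
  have : (fun N : nat => M * 2^-1 ^+ N) @ \oo --> M * 0.
    by apply: cvgM; [exact: cvg_cst|apply: cvg_expr; rewrite ger0_norm; lra].
  rewrite mulr0 => /cvgr0Pnorm_le/(_ e e0); apply: filterS => N.
  rewrite ger0_norm ?mulr_ge0 ?exprn_ge0//; apply: le_trans.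
  apply: le_trans (ler_norm_sum _ _ _) _.
  have [_ H2] := maj_rect N rgt0 cM.
  apply: (@le_trans _ _ ((\sum_(j < N.+1) `|c N j| * r ^+ (N + j)) * 2^-1 ^+ N)).
    rewrite mulr_suml; apply: ler_sum => j _; rewrite !normrM !normrX.
    have A : `|x| ^+ N <= (r / 2) ^+ N by apply: lerXn2r; rewrite ?nnegrE//; lra.
    have B : `|t| ^+ j <= r ^+ j by apply: lerXn2r; rewrite ?nnegrE//; lra.
    rewrite [leRHS](_ : _ = `|c N j| * ((r / 2) ^+ N * r ^+ j)); last first.
      by rewrite exprD exprMn; ring.
    by rewrite -mulrA ler_wpM2l// ler_pM ?exprn_ge0.
  by rewrite ler_wpM2r// exprn_ge0.
have Fd N h : `|h| <= r / 8 ->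
    `|F N (s + h) - F N s - dsum c' N x s * h| <= 16 / r ^+ 2 * M * h ^+ 2.
  move=> hr; rewrite /F /dsum mulr_suml -!sumrB.
  have [H2 _] := maj_rect N rgt0 cM.
  apply: (@le_trans _ _ (16 / r ^+ 2 * (\sum_(i < N) \sum_(j < N.+1) `|c i j| * r ^+ (i + j))
     * h ^+ 2)); last first.
    by rewrite ler_wpM2r ?sqr_ge0// ler_wpM2l// divr_ge0// exprn_ge0// ltW.
  rewrite mulr_sumr mulr_suml; apply: le_trans (ler_norm_sum _ _ _) _.
  apply: ler_sum => i _.
  have -> : (\sum_(j < N) c' i j * x ^+ i * s ^+ j) * h =
      \sum_(j < N.+1) c i j * x ^+ i * (j%:R * s ^+ j.-1 * h).
    rewrite [RHS]big_ord_recl/= !mul0r mulr0 add0r mulr_suml; apply: eq_bigr => j _.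
    by rewrite /c' /bump/= add1n; ring.
  rewrite -!sumrB mulr_sumr mulr_suml; apply: le_trans (ler_norm_sum _ _ _) _.
  apply: ler_sum => j _.
  have sr4 : `|s| <= r / 4 by lra.
  have shr : `|s + h| <= r / 4 by apply: le_trans (ler_normD _ _) _; lra.
  have r40 : 0 < r / 4 by lra.
  have := pow_taylor j r40 sr4 shr; set u := (_ - _ - _) => H.
  rewrite (_ : _ - _ - _ = c i j * x ^+ i * u); last by rewrite /u; ring.
  have xi : `|x| ^+ i <= r ^+ i by apply: lerXn2r; rewrite ?nnegrE ?(ltW rgt0)//; lra.
  rewrite !normrM normrX.
  rewrite [leRHS](_ : _ = `|c i j| * (16 / r ^+ 2 * (r ^+ (i + j) * h ^+ 2))); last by ring.
  rewrite -mulrA ler_wpM2l//.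
  have r2 : 0 < r ^+ 2 by rewrite exprn_gt0.
  have u1 : `|u| <= 16 / r ^+ 2 * (r ^+ j * h ^+ 2).
    have H3 : `|u| * (r / 4) ^+ 2 <= r ^+ j * h ^+ 2.
      apply: (le_trans H); rewrite ler_wpM2r ?sqr_ge0// expr_div_n mulrA.
      rewrite ler_pdivrMr ?exprn_gt0// mulrC ler_wpM2l ?exprn_ge0 ?(ltW rgt0)//.
      apply: (@le_trans _ _ ((2 ^+ j) ^+ 2)); last by rewrite -exprM mulnC exprM (_ : 2 ^+ 2 = 4)// expr2; lra.
      by rewrite lerXn2r ?nnegrE ?exprn_ge0//; exact: leq_exp2.
    rewrite (_ : 16 / r ^+ 2 * _ = (r ^+ j * h ^+ 2) * 16 / r ^+ 2); last by ring.
    rewrite ler_pdivlMr// -ler_pdivrMr//; apply: le_trans H3.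
    by rewrite expr_div_n (_ : 4 ^+ 2 = 16) ?mulrA//; rewrite expr2; lra.
  rewrite exprD [leRHS](_ : _ = r ^+ i * (16 / r ^+ 2 * (r ^+ j * h ^+ 2))); last by ring.
  by rewrite ler_pM// exprn_ge0.
apply/cvgrPdist_le => e e0.
(* A difference quotient of step [h] has an error linear in [h], both for the function and,
  uniformly, for the partial sums. *)
pose K := 16 / r ^+ 2 * M + C + 1.
have K10 : 0 <= 16 / r ^+ 2 * M by rewrite mulr_ge0// divr_ge0// exprn_ge0// ltW.
have K0 : 0 < K by rewrite /K; lra.
pose h := Num.min (Num.min d (r / 8)) (e / (2 * K)).
have h0 : 0 < h by rewrite !lt_min d0 !divr_gt0// mulr_gt0.
have hd : `|h| <= d by rewrite gtr0_norm// !ge_min lexx.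
have hr8 : `|h| <= r / 8 by rewrite gtr0_norm// !ge_min lexx orbT.
have he : h * (2 * K) <= e by rewrite -ler_pdivlMr ?ge_min ?lexx ?orbT// mulr_gt0.
have HCh := HC h hd.
have s4 : `|s| <= r / 4 by lra.
have sh4 : `|s + h| <= r / 4 by apply: le_trans (ler_normD _ _) _; lra.
have := cvg_seqB (FC _ sh4) (FC _ s4).
move=> /cvgrPdist_le/(_ (h ^+ 2)); rewrite exprn_gt0// => /(_ isT).
apply: filterS => N HN; have HF := Fd N h hr8.
rewrite -(ler_pM2r h0).
rewrite -{1}(gtr0_norm h0) -normrM.
rewrite addrA in HN.
set A := f x (y0 + s + h) in HCh HN; set B := f x (y0 + s) in HCh HN.
set U := F N (s + h) in HN HF; set V := F N s in HN HF.
set W := dsum c' N x s in HF *.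
rewrite (_ : (l - W) * h = (U - V - W * h) + ((A - B) - (U - V)) - (A - B - l * h)); last by ring.
apply: le_trans (ler_normB _ _) _.
apply: le_trans (lerD (ler_normD _ _) (lexx _)) _.
apply: le_trans (lerD (lerD HF HN) HCh) _.
have hh : h ^+ 2 * (2 * K) <= e * h by rewrite expr2 -mulrA mulrCA mulrC ler_wpM2r// ltW.
by rewrite /K in hh *; have := sqr_ge0 h; nra.
Qed.
End AnalyticDerivative.

(** * Analytic families of functions *)

Section AnalyticFamilies.
Context {R : realType}.
Implicit Types (I : set R) (f : R -> R -> R).

Lemma quad_deriv_is_derive (g : R -> R) y l : quad_deriv g y l ->
  is_derive y (1 : R) g l.
Proof.
move=> [C [d [C0 d0 H]]].
have Hl : (fun h : R => h^-1 *: (g (h *: (1 : R) + y) - g y)) @ 0^' --> l.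
  apply/cvgrPdist_le => e e0.
  near=> h.
  have h0 : h != 0 by near: h; exact: nbhs_dnbhs_neq.
  have hd : `|h| <= d.
    near: h; apply: dnbhs0_le => //.
  have he : `|h| <= e / C.
    near: h; apply: dnbhs0_le => //; rewrite divr_gt0//.
  have := H h hd; rewrite /GRing.scale/= mulr1 (addrC h) => H1.
  have hp : 0 < `|h| by rewrite normr_gt0.
  rewrite -(ler_pM2r hp) -normrM.
  rewrite (_ : (l - _) * h = - (g (y + h) - g y - l * h)); last by field.
  rewrite normrN; apply: (le_trans H1).
  rewrite -(real_normK (num_real h)) expr2 mulrA ler_wpM2r// mulrC.
  by rewrite -ler_pdivlMr.
apply: DeriveDef.
  by apply: cvgP Hl.
exact: cvg_lim Hl.
Unshelve. all: by end_near.
Qed.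

(** Near each parameter in [I], a convergent power series in the displacement of the
  parameter and of the variable. *)
Definition analytic_fam I f := forall eps0 y0, I eps0 ->
  analytic_at (fun x => I (eps0 + x)) (fun x y => f (eps0 + x) y) y0.

Lemma analytic2_on_fam I (F : R * R -> R) : analytic2_on (I `*` [set: R]) F ->
  analytic_fam I (fun eps y => F (eps, y)).
Proof.
move=> HF eps0 y0 I0; have [c [r [r0 [M HM] H]]] := HF (eps0, y0) (conj I0 Logic.I).
exists c, r, M; split=> // x s Ix xr sr.
have := H (eps0 + x, y0 + s) (conj Ix Logic.I).
by rewrite /= !(addrC _ x) !(addrC _ s) !addrK => /(_ xr sr).
Qed.

Lemma analytic_fam_smooth I f eps0 y0 : analytic_fam I f -> I eps0 ->
  smooth_at (fun x => I (eps0 + x)) (fun x y => f (eps0 + x) y) y0.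
Proof.
by move=> Hf I0; apply: analytic_at_smooth; [rewrite addr0|exact: Hf].
Qed.

(** Analyticity of the derivative is what allows the construction to be iterated, as
  the reflection law involves [p'] and its regularity involves [p'']. *)
Lemma analytic_fam_deriv I f : analytic_fam I f -> exists D : R -> R -> R,
  analytic_fam I D /\
  forall eps y, I eps -> is_derive y (1 : R) (f eps) (D eps y).
Proof.
move=> Hf.
have H eps y : exists l, I eps -> quad_deriv (f eps) y l.
  have [Ie|nI] := pselect (I eps); last by exists 0.
  have [|l Hl] := smooth_at_quad_deriv _ (analytic_fam_smooth y Hf Ie).
    by rewrite addr0.
  by exists l => _; rewrite addr0 in Hl.
pose D eps y := sval (cid (H eps y)).
have HD eps y : I eps -> quad_deriv (f eps) y (D eps y) := svalP (cid (H eps y)).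
exists D; split=> [eps0 y0 I0|eps y Ie]; last exact/quad_deriv_is_derive/HD.
by apply: (analytic_at_deriv (r0 := 1)) (Hf _ y0 I0) _ => // x s Ix _ _; exact: HD.
Qed.

Lemma analytic_fam_continuous I f eps0 y0 e : analytic_fam I f -> I eps0 -> 0 < e ->
  exists d, 0 < d /\ forall eps y, I eps -> `|eps - eps0| <= d -> `|y - y0| <= d ->
    `|f eps y - f eps0 y0| < e.
Proof.
move=> Hf I0 e0.
have [d [d0 H]] := smooth_at_continuous (analytic_fam_smooth y0 Hf I0) e0.
exists d; split=> // eps y Ie ed yd.
have := H (eps - eps0) (y - y0).
by rewrite !subrKC addr0; apply.
Qed.

End AnalyticFamilies.

(** * Elementary calculus *)

Section RealCalculus.
Context {R : realType}.
Implicit Types (f g : R -> R) (x a b : R).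

Lemma drv_ext f g x (d1 d2 : R) : f =1 g -> d1 = d2 ->
  is_derive x (1 : R) f d1 -> is_derive x (1 : R) g d2.
Proof. by move=> /funext -> ->. Qed.

Lemma drv_cst x k : is_derive x (1 : R) (fun=> k : R) 0.
Proof. exact: is_derive_cst. Qed.

Lemma drv_id x : is_derive x (1 : R) (fun t : R => t) 1.
Proof. exact: is_derive_id. Qed.

Lemma drv_add f g x df dg : is_derive x (1 : R) f df -> is_derive x (1 : R) g dg ->
  is_derive x (1 : R) (fun t => f t + g t) (df + dg).
Proof. by move=> ? ?; exact: is_deriveD. Qed.

Lemma drv_sub f g x df dg : is_derive x (1 : R) f df -> is_derive x (1 : R) g dg ->
  is_derive x (1 : R) (fun t => f t - g t) (df - dg).
Proof. by move=> ? ?; exact: is_deriveB. Qed.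

Lemma drv_mul f g x df dg : is_derive x (1 : R) f df -> is_derive x (1 : R) g dg ->
  is_derive x (1 : R) (fun t => f t * g t) (df * g x + f x * dg).
Proof.
move=> Hf Hg; apply: (@is_derive_eq _ _ _ _ _ _ _ _ (is_deriveM Hf Hg)).
by rewrite addrC /GRing.scale/= mulrC.
Qed.

Lemma drv_comp f g x df dg : is_derive x (1 : R) g dg ->
  is_derive (g x) (1 : R) f df -> is_derive x (1 : R) (fun t => f (g t)) (df * dg).
Proof. by move=> Hg Hf; exact: (is_derive1_comp (f := f)). Qed.

Lemma drv_inv f x df : f x != 0 -> is_derive x (1 : R) f df ->
  is_derive x (1 : R) (fun t => (f t)^-1) (- df / f x ^+ 2).
Proof.
move=> f0 Hf; apply: (@is_derive_eq _ _ _ _ _ _ _ _ (is_deriveV f0 Hf)).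
by rewrite /GRing.scale/=; field.
Qed.

Lemma drv_div f g x df dg : g x != 0 -> is_derive x (1 : R) f df ->
  is_derive x (1 : R) g dg ->
  is_derive x (1 : R) (fun t => f t / g t) ((df * g x - f x * dg) / g x ^+ 2).
Proof.
move=> g0 Hf Hg; apply: (@is_derive_eq _ _ _ _ _ _ _ _ (drv_mul Hf (drv_inv g0 Hg))).
by field.
Qed.

Lemma drv_sinB x a : is_derive x (1 : R) (fun t => sin (t - a)) (cos (x - a)).
Proof.
apply: (@is_derive_eq _ _ _ _ _ _ _ _
  (drv_comp (drv_sub (drv_id x) (drv_cst x a)) (is_derive_sin (x - a)))).
by rewrite subr0 mulr1.
Qed.

Lemma drv_cosB x a : is_derive x (1 : R) (fun t => cos (t - a)) (- sin (x - a)).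
Proof.
apply: (@is_derive_eq _ _ _ _ _ _ _ _
  (drv_comp (drv_sub (drv_id x) (drv_cst x a)) (is_derive_cos (x - a)))).
by rewrite subr0 mulr1.
Qed.

Lemma drv_sinBr x b : is_derive x (1 : R) (fun t => sin (b - t)) (- cos (b - x)).
Proof.
apply: (@is_derive_eq _ _ _ _ _ _ _ _
  (drv_comp (drv_sub (drv_cst x b) (drv_id x)) (is_derive_sin (b - x)))).
by rewrite sub0r mulrN1.
Qed.

Lemma drv_cosBr x b : is_derive x (1 : R) (fun t => cos (b - t)) (sin (b - x)).
Proof.
apply: (@is_derive_eq _ _ _ _ _ _ _ _
  (drv_comp (drv_sub (drv_cst x b) (drv_id x)) (is_derive_cos (b - x)))).
by rewrite sub0r mulrN1 opprK.
Qed.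

Lemma drv_continuous f x df : is_derive x (1 : R) f df -> {for x, continuous f}.
Proof. by move=> [Hf _]; apply/differentiable_continuous; exact/derivable1_diffP. Qed.

(** The derivative is only required on the closed segment, as tangent lengths blow up
  when the angle between the lines reaches [0] or [pi]. *)
Lemma mean_value f df a b : a < b ->
  (forall x, a <= x <= b -> is_derive x (1 : R) f (df x)) ->
  exists c, a < c < b /\ f b - f a = df c * (b - a).
Proof.
move=> ab H; have [||c + ->] := @MVT _ f df a b ab.
- by move=> x; rewrite in_itv/= => /andP[/ltW ax /ltW xb]; apply: H; rewrite ax.
- apply: derivable_within_continuous => x; rewrite in_itv/= => xab.
  by have [] := H x xab.
by rewrite in_itv/= => cab; exists c.
Qed.

Lemma is_derive_unique f x (d1 d2 : R) : is_derive x (1 : R) f d1 ->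
  is_derive x (1 : R) f d2 -> d1 = d2.
Proof. by move=> [_ <-] [_ <-]. Qed.

Lemma sin_le_id x : 0 <= x -> sin x <= x.
Proof.
rewrite le_eqVlt => /predU1P[<-|x0]; first by rewrite sin0.
have [c [_]] := mean_value x0 (fun y _ => is_derive_sin y).
rewrite sin0 !subr0 => ->; have := cos_le1 c; nra.
Qed.

Lemma sin_ge_half x : 0 <= x <= pi / 2 -> x / 2 <= sin x.
Proof.
move=> /andP[+ xpi]; rewrite le_eqVlt => /predU1P[<-|x0]; first by rewrite sin0 mul0r.
have x20 : 0 < x / 2 by lra.
have [c [/andP[c0 cx]]] := mean_value x20 (fun y _ => is_derive_sin y).
rewrite sin0 !subr0 => sx; have pi0 := pi_gt0 R.
have cosb (y : R) : 0 <= y -> y <= pi / 4 -> 0 <= cos y /\ 1 / 2 <= cos y ^+ 2.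
  move=> y0 y4; have := @cos_ge0_pihalf R (y *+ 2); rewrite cos_mulr2n => H1.
  have H2 := @cos_ge0_pihalf R y.
  split; first by apply: H2; apply/andP; split; lra.
  have : 0 <= cos y ^+ 2 *+ 2 - 1 by apply: H1; rewrite (mulr2n y); apply/andP; split; lra.
  by rewrite (mulr2n (_ ^+ 2)); lra.
have [A1 A2] : 0 <= cos c /\ 1 / 2 <= cos c ^+ 2 by apply: cosb; lra.
have [B1 B2] : 0 <= cos (x / 2) /\ 1 / 2 <= cos (x / 2) ^+ 2 by apply: cosb; lra.
have -> : sin x = sin ((x / 2) *+ 2) by congr (sin _); rewrite (mulr2n (x / 2)); lra.
rewrite sin_mulr2n (mulr2n (_ * _)) sx.
suff : 1 / 2 <= cos c * cos (x / 2).
  by move=> /(ler_wpM2l (ltW x20)); lra.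
rewrite leNgt; apply/negP => H.
have H0 : 0 <= cos c * cos (x / 2) by rewrite mulr_ge0.
have : (cos c * cos (x / 2)) ^+ 2 < (1 / 2) ^+ 2 by rewrite ltrXn2r//; lra.
rewrite exprMn; move: A2 B2; set u := cos c ^+ 2; set v := cos (x / 2) ^+ 2.
by move=> A2 B2; have := ler_pM (ltac:(lra) : 0 <= 1 / 2 :> R) (ltac:(lra) : 0 <= 1 / 2 :> R) A2 B2; lra.
Qed.

Lemma one_sub_cos_le x : 0 <= x -> 1 - cos x <= x ^+ 2 / 2.
Proof.
move=> x0; have -> : cos x = cos ((x / 2) *+ 2) by congr (cos _); rewrite (mulr2n (x / 2)); lra.
rewrite cos_mulr2n cos2sin2.
have sx : `|sin (x / 2)| <= x / 2.
  move: x0; rewrite le_eqVlt => /predU1P[<-|x0]; first by rewrite mul0r sin0 normr0.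
  have x20 : 0 < x / 2 by lra.
  have [c [_]] := mean_value x20 (fun y _ => is_derive_sin y).
  rewrite sin0 !subr0 => ->; rewrite normrM (gtr0_norm x20) ler_piMl ?(ltW x20)//.
  by rewrite ler_norml cos_geN1 cos_le1.
have : sin (x / 2) ^+ 2 <= (x / 2) ^+ 2.
  by rewrite -(real_normK (num_real (sin _))) lerXn2r ?nnegrE//; lra.
by rewrite (mulr2n (1 - _)) !expr2; lra.
Qed.

Lemma sin_pos x : 0 < x < pi -> 0 < sin x :> R.
Proof. exact: sin_gt0_pi. Qed.

End RealCalculus.

(** * Tangent lengths and the generating function *)

Section Tangents.
Context {R : realType}.
Implicit Types (p dp : R -> R) (a b : R).

(** The oriented tangent lines at angles [a] and [b] meet in one point; [fwd] is its
  signed distance after the tangency point at [a], and [bwd] its signed distance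
  before the tangency point at [b]. *)
Definition fwd p dp a b := (p b - p a * cos (b - a)) / sin (b - a) - dp a.
Definition bwd p dp a b := dp b - (p b * cos (b - a) - p a) / sin (b - a).
(** A generating function of the billiard map in terms of angles: its partial
  derivatives are [bwd^2 / 2] in [b] and [- fwd^2 / 2] in [a], up to the values of
  [energy_pot] with opposite signs, which cancel along a sequence. *)
Definition gen p a b :=
  (p a * p b - (p a ^+ 2 + p b ^+ 2) / 2 * cos (b - a)) / sin (b - a).

(** What is used of a support function and its derivative. The last two fields express
  strict convexity and smoothness of the boundary: distinct tangent lines meet
  strictly after one tangency point and strictly before the other. *)
Record support_fun p dp : Prop := SupportFun {
  sf_per : forall t, p (t + 2 * pi) = p t ;
  sf_der : forall t, is_derive t (1 : R) p (dp t) ;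
  sf_pos : forall t, 0 < p t ;
  sf_bnd : exists M, forall t, p t <= M /\ `|dp t| <= M ;
  sf_lip : exists L, forall s t, `|dp s - dp t| <= L * `|s - t| ;
  sf_fwd : forall a b, 0 < b - a < pi -> 0 < fwd p dp a b ;
  sf_bwd : forall a b, 0 < b - a < pi -> 0 < bwd p dp a b }.

(** Reversing the orientation exchanges the two lengths and the two variables; this
  gives every statement about one variable from the one about the other. *)
Lemma fwd_refl p dp a b :
  fwd (fun t => p (- t)) (fun t => - dp (- t)) (- b) (- a) = bwd p dp a b.
Proof. by rewrite /fwd /bwd !opprK [in - a + _]addrC; ring. Qed.

Lemma bwd_refl p dp a b :
  bwd (fun t => p (- t)) (fun t => - dp (- t)) (- b) (- a) = fwd p dp a b.
Proof. by rewrite /fwd /bwd !opprK [in - a + _]addrC; ring. Qed.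

Lemma gen_refl p a b : gen (fun t => p (- t)) (- b) (- a) = gen p a b.
Proof. by rewrite /gen !opprK [in - a + _]addrC; ring. Qed.

Lemma support_fun_refl p dp : support_fun p dp ->
  support_fun (fun t => p (- t)) (fun t => - dp (- t)).
Proof.
move=> [per der pos [M bnd] [L lip] Hf Hb]; split.
- by move=> t; rewrite -(per (- (t + 2 * pi))); congr p; ring.
- move=> t; apply: (drv_ext _ _
    (drv_comp (drv_sub (drv_cst t 0) (drv_id t)) (der (0 - t)))).
    by move=> s; rewrite sub0r.
  by rewrite !sub0r; ring.
- by move=> t.
- by exists M => t; rewrite normrN; exact: bnd.
- exists L => s t; rewrite (_ : _ - _ = - (dp (- s) - dp (- t))); last by ring.
  rewrite normrN; apply: le_trans (lip _ _) _.
  by rewrite (_ : - s - - t = - (s - t)) ?normrN//; ring.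
- move=> a b ab; rewrite -[a]opprK -[b]opprK fwd_refl; apply: Hb; lra.
- move=> a b ab; rewrite -[a]opprK -[b]opprK bwd_refl; apply: Hf; lra.
Qed.

Section OneTable.
Context (p dp : R -> R) (sf : support_fun p dp).
Local Notation S := (fwd p dp).
Local Notation T := (bwd p dp).
Local Notation h := (gen p).

Lemma dp_per t : dp (t + 2 * pi) = dp t.
Proof.
have H1 := sf_der sf (t + 2 * pi).
have := drv_comp (drv_add (drv_id t) (drv_cst t (2 * pi))) H1.
rewrite addr0 mulr1 (_ : (fun t => _) = p) => [H2|].
  exact: is_derive_unique H2 (sf_der sf t).
by apply/funext => s; rewrite (sf_per sf).
Qed.

Lemma sin_neq0 a b : 0 < b - a < pi -> sin (b - a) != 0 :> R.
Proof. by move=> ab; rewrite gt_eqF// sin_pos. Qed.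

Lemma cos2E (x : R) : cos x ^+ 2 = 1 - sin x ^+ 2. Proof. exact: cos2sin2. Qed.

(** When the second line turns, its intersection with the first one moves at a speed
  proportional to its distance to the tangency point of the second. *)
Lemma der_fwd_r a b : 0 < b - a < pi ->
  is_derive b (1 : R) (S a) (T a b / sin (b - a)).
Proof.
move=> ab; have s0 := sin_neq0 ab; have dpb := sf_der sf b.
apply: (drv_ext (frefl _) _ (drv_sub (drv_div s0
  (drv_sub dpb (drv_mul (drv_cst b (p a)) (drv_cosB b a))) (drv_sinB b a))
  (drv_cst b (dp a)))).
rewrite /bwd; have := cos2E (b - a); move: s0.
set s := sin _; set c := cos _ => s0 c2.
apply/eqP; rewrite -subr_eq0; apply/eqP.
transitivity (p a * (s ^+ 2 + c ^+ 2 - 1) / s ^+ 2); first by field.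
by rewrite c2; field.
Qed.

Lemma der_bwd_l a b : 0 < b - a < pi ->
  is_derive a (1 : R) (fun t => T t b) (- (S a b / sin (b - a))).
Proof.
move=> ab; have s0 := sin_neq0 ab; have dpa := sf_der sf a.
apply: (drv_ext (frefl _) _ (drv_sub (drv_cst a (dp b)) (drv_div s0
  (drv_sub (drv_mul (drv_cst a (p b)) (drv_cosBr a b)) dpa) (drv_sinBr a b)))).
rewrite /fwd; have := cos2E (b - a); move: s0.
set s := sin _; set c := cos _ => s0 c2.
apply/eqP; rewrite -subr_eq0; apply/eqP.
transitivity (- p b * (s ^+ 2 + c ^+ 2 - 1) / s ^+ 2); first by field.
by rewrite c2; field.
Qed.

Definition energy_pot a := (p a ^+ 2 - dp a ^+ 2) / 2.

Lemma der_gen_r a b : 0 < b - a < pi ->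
  is_derive b (1 : R) (h a) (T a b ^+ 2 / 2 + energy_pot b).
Proof.
move=> ab; have s0 := sin_neq0 ab; have dpb := sf_der sf b.
have n2 : (2 : R) != 0 by rewrite gt_eqF.
have dsq := drv_mul (drv_div (g := fun=> 2) (x := b) n2 (drv_add (drv_cst b (p a ^+ 2)) (drv_mul dpb dpb))
  (drv_cst b 2)) (drv_cosB b a).
apply: (drv_ext _ _
  (drv_div s0 (drv_sub (drv_mul (drv_cst b (p a)) dpb) dsq) (drv_sinB b a))).
  by move=> t; rewrite /gen -expr2.
rewrite /bwd /energy_pot; have := cos2E (b - a); move: s0.
set s := sin _; set c := cos _ => s0 c2.
apply/eqP; rewrite -subr_eq0; apply/eqP.
transitivity (p a ^+ 2 * (s ^+ 2 + c ^+ 2 - 1) / (2 * s ^+ 2)); first by field.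
by rewrite c2; field.
Qed.

Lemma fwd_incr a b b' : 0 < b - a -> b < b' -> b' - a < pi -> S a b < S a b'.
Proof.
move=> ab bb b'a; rewrite -subr_gt0.
have [|c [cbb ->]] := mean_value (f := S a) (df := fun c => T a c / sin (c - a)) bb.
  by move=> c /andP[bc cb]; apply: der_fwd_r; apply/andP; split; lra.
have ca : 0 < c - a < pi by move/andP: cbb => [? ?]; apply/andP; split; lra.
by rewrite mulr_gt0 ?subr_gt0// divr_gt0 ?(sf_bwd sf)// sin_pos.
Qed.

Lemma bwd_decr a a' b : b - a < pi -> a < a' -> 0 < b - a' -> T a' b < T a b.
Proof.
move=> ab aa a'b; rewrite -subr_lt0.
have [|c [caa ->]] := mean_value (f := T^~ b)
    (df := fun c => - (S c b / sin (b - c))) aa.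
  by move=> c /andP[bc cb]; apply: der_bwd_l; apply/andP; split; lra.
have cb : 0 < b - c < pi by move/andP: caa => [? ?]; apply/andP; split; lra.
rewrite mulNr oppr_lt0.
by rewrite mulr_gt0 ?subr_gt0// divr_gt0 ?(sf_fwd sf)// sin_pos.
Qed.

Lemma fwd_le a b b' : 0 < b - a -> b <= b' -> b' - a < pi -> S a b <= S a b'.
Proof.
move=> ab; rewrite le_eqVlt => /predU1P[->//|bb] b'a.
by rewrite ltW// fwd_incr.
Qed.

Lemma bwd_ge a a' b : b - a < pi -> a <= a' -> 0 < b - a' -> T a' b <= T a b.
Proof.
move=> ab; rewrite le_eqVlt => /predU1P[->//|aa] a'b.
by rewrite ltW// bwd_decr.
Qed.

Lemma fwd_inj a b b' : 0 < b - a < pi -> 0 < b' - a < pi -> S a b = S a b' -> b = b'.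
Proof.
move=> /andP[b0 b1] /andP[b0' b1'] E; apply: le_anti; apply/andP; split.
  by rewrite leNgt; apply/negP => H; have := fwd_incr b0' H b1; rewrite E ltxx.
by rewrite leNgt; apply/negP => H; have := fwd_incr b0 H b1'; rewrite E ltxx.
Qed.

Lemma p_mvt a b : a <= b -> exists c, a <= c <= b /\ p b - p a = dp c * (b - a).
Proof.
rewrite le_eqVlt => /predU1P[->|ab]; first by exists b; rewrite !subrr mulr0 !lexx.
have [c [/andP[ac cb] ->]] := mean_value ab (fun x _ => sf_der sf x).
by exists c; rewrite !ltW.
Qed.

Lemma p_lip M a b : (forall t, `|dp t| <= M) -> a <= b -> `|p b - p a| <= M * (b - a).
Proof.
move=> HM ab; have [c [_ ->]] := p_mvt ab.
by rewrite normrM (ger0_norm (_ : 0 <= b - a)) ?subr_ge0// ler_wpM2r ?subr_ge0.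
Qed.

Lemma gen_diag a : h a a = 0.
Proof. by rewrite /gen subrr sin0 invr0 mulr0. Qed.

(** The numerator of the generating function, rewritten so that its quadratic
  smallness near the diagonal is visible. *)
Lemma gen_num a b : p a * p b - (p a ^+ 2 + p b ^+ 2) / 2 * cos (b - a) =
  (p a ^+ 2 + p b ^+ 2) / 2 * (1 - cos (b - a)) - (p b - p a) ^+ 2 / 2.
Proof. by field. Qed.

(** The numerator is of second order in the step, so short steps have small action. *)
Lemma gen_small M a b : (forall t, p t <= M) -> (forall t, `|dp t| <= M) ->
  0 <= b - a <= pi / 2 -> `|h a b| <= 2 * M ^+ 2 * (b - a).
Proof.
move=> pM dpM /andP[ab0 abpi].
move: (ab0); rewrite le_eqVlt => /predU1P[E|ab].
  by rewrite -E mulr0 (_ : b = a) ?gen_diag ?normr0//; lra.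
have hs : (b - a) / 2 <= sin (b - a) by apply: sin_ge_half; rewrite ab0.
have s0 : 0 < sin (b - a) by apply: lt_le_trans hs; lra.
rewrite /gen normrM normfV (gtr0_norm s0) ler_pdivrMr// gen_num.
have M0 : 0 <= M by apply: le_trans (dpM 0).
have pp t : p t ^+ 2 <= M ^+ 2.
  by rewrite lerXn2r ?nnegrE// ltW// (sf_pos sf).
have A : 0 <= (p a ^+ 2 + p b ^+ 2) / 2 * (1 - cos (b - a)) <= M ^+ 2 * ((b - a) ^+ 2 / 2).
  have := pp a; have := pp b; have := sqr_ge0 (p a); have := sqr_ge0 (p b).
  have := cos_le1 (b - a); have := one_sub_cos_le ab0 => H1 H2 H3 H4 H5 H6.
  apply/andP; split; first by rewrite mulr_ge0//; lra.
  by rewrite ler_pM//; lra.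
have B : 0 <= (p b - p a) ^+ 2 <= M ^+ 2 * (b - a) ^+ 2.
  rewrite sqr_ge0/= -exprMn -(real_normK (num_real (p b - p a))).
  by rewrite lerXn2r ?nnegrE ?mulr_ge0// p_lip// -subr_ge0.
apply: (@le_trans _ _ (M ^+ 2 * (b - a) ^+ 2)).
  by rewrite ler_norml; apply/andP; split; move/andP: A B => [? ?] /andP[? ?]; lra.
rewrite [leRHS](_ : _ = M ^+ 2 * ((b - a) * (2 * sin (b - a)))); last by ring.
by rewrite ler_wpM2l ?sqr_ge0// expr2 ler_wpM2l//; lra.
Qed.

(** Past a quarter turn the numerator is positive; before it [gen_small] applies. *)
Lemma gen_lower M a b : (forall t, p t <= M) -> (forall t, `|dp t| <= M) ->
  0 <= b - a < pi -> - (2 * M ^+ 2 * pi) <= h a b.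
Proof.
move=> pM dpM /andP[ab0 abpi]; have pi0 := pi_gt0 R.
have M2 : 0 <= M ^+ 2 by exact: sqr_ge0.
have [lepi|gtpi] := lerP (b - a) (pi / 2).
  have := gen_small pM dpM (introT andP (conj ab0 lepi)).
  rewrite ler_norml => /andP[H _]; apply: le_trans H.
  by rewrite lerN2 ler_wpM2l//; lra.
apply: (@le_trans _ _ 0); first by rewrite oppr_le0 mulr_ge0 ?(ltW pi0)// mulr_ge0.
have s0 : 0 < sin (b - a) by apply: sin_pos; apply/andP; split; lra.
rewrite /gen divr_ge0 ?(ltW s0)// subr_ge0.
have pa := sf_pos sf a; have pb := sf_pos sf b.
have : cos (b - a) <= 0.
  rewrite -[b - a](subrK (pi / 2)) cosDpihalf oppr_le0 ltW// sin_pos//.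
  by apply/andP; split; lra.
move=> c0; apply: (@le_trans _ _ 0); last by rewrite mulr_ge0// ltW.
by rewrite mulr_ge0_le0// divr_ge0// addr_ge0// sqr_ge0.
Qed.

(** The action of a step tends to infinity when it approaches a half turn; this keeps
  the steps of minimizers away from [pi]. *)
Lemma gen_blowup m a b : 0 < m -> (forall t, m <= p t) ->
  pi / 2 <= b - a < pi -> m ^+ 2 <= h a b * (pi - (b - a)).
Proof.
move=> m0 pm /andP[ab0 abpi]; have pi0 := pi_gt0 R.
have s0 : 0 < sin (b - a) by apply: sin_pos; apply/andP; split; lra.
have s1 : sin (b - a) <= pi - (b - a).
  have -> : sin (b - a) = sin (pi - (b - a)) by rewrite (sinB pi) sinpi cospi; ring.
  by apply: sin_le_id; lra.
have c0 : cos (b - a) <= 0.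
  rewrite -[b - a](subrK (pi / 2)) cosDpihalf oppr_le0.
  move: ab0; rewrite le_eqVlt => /predU1P[<-|ab0]; first by rewrite subrr sin0.
  by rewrite ltW// sin_pos//; apply/andP; split; lra.
have H : m ^+ 2 <= h a b * sin (b - a).
  rewrite /gen divfK ?gt_eqF//; apply: (@le_trans _ _ (p a * p b)).
    by rewrite expr2 ler_pM ?pm//; exact: ltW.
  rewrite lerBrDr -lerBrDl subrr mulr_ge0_le0// divr_ge0// addr_ge0// sqr_ge0//.
have h0 : 0 <= h a b by rewrite -(pmulr_lge0 _ s0) (le_trans _ H)// sqr_ge0.
by apply: le_trans H _; rewrite ler_wpM2l.
Qed.

Lemma fwd_small M L a b : (forall t, p t <= M) -> (forall t, `|dp t| <= M) ->
  0 <= L -> (forall s t, `|dp s - dp t| <= L * `|s - t|) ->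
  0 < b - a <= pi / 2 -> S a b <= (2 * L + 4 * M) * (b - a).
Proof.
move=> pM dpM L0 lip /andP[ab abpi].
have ab0 := ltW ab; have pi4 : pi <= 4 :> R.
  by have [/andP[_ H] _] := pihalf_02_cos_pihalf R; lra.
have M0 : 0 <= M by apply: le_trans (dpM 0).
have hs : (b - a) / 2 <= sin (b - a) by apply: sin_ge_half; rewrite ab0.
have s0 : 0 < sin (b - a) by apply: lt_le_trans hs; lra.
have [c [/andP[ac cb] E]] := p_mvt (ltW (ltac:(lra) : a < b)).
rewrite /fwd lerBlDr ler_pdivrMr//.
have c1 := one_sub_cos_le ab0; have c2 := cos_le1 (b - a).
have [d [/andP[d0 db] Ed]] := mean_value (f := sin) ab (fun y _ => is_derive_sin y).
rewrite sin0 !subr0 in Ed.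
have d1 := one_sub_cos_le (ltW d0).
have L1 : dp c <= dp a + L * (b - a).
  have := lip c a; rewrite ler_norml => /andP[_ H].
  have : `|c - a| <= b - a by rewrite ger0_norm; lra.
  by move=> /(ler_wpM2l L0); lra.
set D := b - a in L1 E Ed ab ab0 abpi hs s0 c1 c2 db *.
clearbody D; have D2 : D <= 2 by lra.
have d2 : d ^+ 2 <= 2 * D by rewrite expr2; nra.
have HA : p a * (1 - cos D) <= M * (D ^+ 2 / 2).
  by rewrite ler_pM ?(ltW (sf_pos sf a))//; lra.
have HB : dp c * D <= (dp a + L * D) * D by rewrite ler_wpM2r.
have HC : dp a * (D - sin D) <= M * D ^+ 2.
  apply: le_trans (ler_norm _) _; rewrite normrM ler_pM//.
  have -> : D - sin D = (1 - cos d) * D by rewrite Ed; ring.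
  by rewrite ger0_norm ?mulr_ge0 ?subr_ge0 ?cos_le1// expr2 ler_wpM2r//; lra.
have HD : (2 * L + 4 * M) * D * (D / 2) <= (2 * L + 4 * M) * D * sin D.
  by rewrite ler_wpM2l// mulr_ge0//; lra.
by rewrite expr2 in HA HC; nra.
Qed.

End OneTable.

Lemma der_gen_l p dp a b : support_fun p dp -> 0 < b - a < pi ->
  is_derive a (1 : R) (fun t => gen p t b)
    (- (fwd p dp a b ^+ 2 / 2) - energy_pot p dp a).
Proof.
move=> sf ab; have := der_gen_r (support_fun_refl sf) (a := - b) (b := 0 - a).
rewrite sub0r bwd_refl (_ : - a - - b = b - a); last by ring.
move=> /(_ ab); rewrite -[in is_derive _ _ _](sub0r a) => H.
apply: (drv_ext _ _ (drv_comp (drv_sub (drv_cst a 0) (drv_id a)) H)).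
  by move=> t; rewrite sub0r gen_refl.
by rewrite /energy_pot !sub0r opprK sqrrN; field.
Qed.

End Tangents.

(** * Minimal configurations *)

Section Configurations.
Context {R : realType} (p dp : R -> R) (sf : support_fun p dp).
Local Notation S := (fwd p dp).
Local Notation T := (bwd p dp).
Local Notation h := (gen p).
Implicit Types (a b c t : R) (x y : nat -> R) (n : nat).

Lemma near_ball_continuous (f : R -> R) b e : {for b, continuous f} -> 0 < e ->
  exists d, 0 < d /\ forall t, `|t - b| < d -> `|f t - f b| < e.
Proof.
move=> /cvgrPdist_lt/(_ e) cf e0; have /nbhs_ballP[d /= d0 H] := cf e0.
exists d; split=> // t tb; rewrite distrC; apply: H.
by rewrite -ball_normE/= distrC.
Qed.

Lemma dp_continuous b : {for b, continuous dp}.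
Proof.
have [L lip] := sf_lip sf.
have L0 : 0 <= L by have := lip 1 0; rewrite subr0 normr1 mulr1; apply: le_trans.
apply/cvgrPdist_le => e e0; near=> t.
apply: le_trans (lip _ _) _.
apply: (@le_trans _ _ ((L + 1) * `|b - t|)); first by rewrite ler_wpM2r//; lra.
rewrite mulrC -ler_pdivlMr; last by lra.
near: t; apply: cvgr_dist_le; [exact: cvg_id|].
by rewrite divr_gt0//; lra.
Unshelve. all: by end_near.
Qed.

Lemma bwd_cont_r a b : 0 < b - a < pi -> {for b, continuous (T a)}.
Proof.
move=> ab; have s0 := sin_neq0 ab.
apply: cvgB; first exact: dp_continuous.
have cp := drv_continuous (sf_der sf b).
apply: cvgM; last by apply: cvgV => //; exact: drv_continuous (drv_sinB b a).
apply: cvgB; last exact: cvg_cst.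
by apply: cvgM; [exact: cp|exact: drv_continuous (drv_cosB b a)].
Qed.

(** Splitting a step strictly decreases the generating function: the derivative
  of the split action in the intermediate point is half the difference of the
  squared tangent lengths, and the tangent length of a short step is small. *)
Lemma gen_split a b : 0 < b - a < pi ->
  exists t, a < t < b /\ h a t + h t b < h a b.
Proof.
move=> ab; have [M bnd] := sf_bnd sf; have [L lip] := sf_lip sf.
have pM t : p t <= M by have [] := bnd t.
have dpM t : `|dp t| <= M by have [] := bnd t.
have L0 : 0 <= L by have := lip 1 0; rewrite subr0 normr1 mulr1; apply: le_trans.
have M0 : 0 <= M by apply: le_trans (dpM 0).
have T0 := sf_bwd sf ab; have pi0 := pi_gt0 R.
have [d [d0 Hd]] := near_ball_continuous (bwd_cont_r ab) (ltac:(lra) : 0 < T a b / 2).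
pose C := 2 * L + 4 * M + 1; have C0 : 0 < C by rewrite /C; lra.
pose e := Num.min (Num.min d ((b - a) / 2)) (Num.min (pi / 4) (T a b / (4 * C))).
have e0 : 0 < e by rewrite !lt_min d0 !divr_gt0 ?mulr_gt0//; lra.
have [ed eba epi eT] : [/\ e <= d, e <= (b - a) / 2, e <= pi / 4 & e <= T a b / (4 * C)].
  by split; rewrite !ge_min lexx ?orbT.
pose phi t := h a t + h t b.
have gt_inc s t : b - e < s -> s < t -> t < b -> phi s < phi t.
  move=> bs st tb; rewrite -subr_gt0.
  have [|c [/andP[sc ct] ->]] := mean_value (f := phi)
      (df := fun c => T a c ^+ 2 / 2 - S c b ^+ 2 / 2) st.
    move=> c /andP[sc ct].
    have H1 : 0 < c - a < pi by apply/andP; split; lra.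
    have H2 : 0 < b - c < pi by apply/andP; split; lra.
    apply: (drv_ext (frefl _) _ (drv_add (der_gen_r sf H1) (der_gen_l sf H2))).
    by ring.
  rewrite mulr_gt0 ?subr_gt0//.
  have H1 : T a b / 2 < T a c.
    have : `|T a c - T a b| < T a b / 2 by apply: Hd; rewrite ltr0_norm; lra.
    by rewrite ltr_norml => /andP[]; lra.
  have H2 : 0 < S c b by apply: (sf_fwd sf); apply/andP; split; lra.
  have H3 : S c b < T a c.
    have := fwd_small sf pM dpM L0 lip (ltac:(apply/andP; split; lra) : 0 < b - c <= pi / 2).
    have : C * (b - c) <= C * e by rewrite ler_wpM2l ?(ltW C0)//; lra.
    have : C * e <= T a b / 4.
      by rewrite mulrC -ler_pdivlMr// (le_trans eT)// invfM mulrA.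
    have : (2 * L + 4 * M) * (b - c) <= C * (b - c) by rewrite ler_wpM2r /C; lra.
    by lra.
  by rewrite ltr_pM2r ?ltrXn2r//; lra.
clearbody e; clear eT ed Hd lip L0 T0 C0 d0 bnd.
exists (b - e / 2); split; first by apply/andP; split; lra.
(* The split at [b] is trivial; it is reached as a limit from the left, and comparison with
  the fixed point [t1] keeps the inequality strict. *)
pose t1 := b - e / 4.
apply: (@lt_le_trans _ _ (phi t1)); first by apply: gt_inc; rewrite /t1; lra.
apply/ler_addgt0Pr => k k0.
have ch := drv_continuous (der_gen_r sf ab).
have [d' [d'0 Hd']] := near_ball_continuous ch (ltac:(lra) : 0 < k / 2).
pose K := 2 * M ^+ 2 + 1; have K0 : 0 < K by rewrite /K; have := sqr_ge0 M; lra.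
pose e' := Num.min (Num.min d' (e / 4)) (k / (2 * K)).
have e'0 : 0 < e' by rewrite !lt_min d'0 !divr_gt0// mulr_gt0.
have [e'd e'e e'k] : [/\ e' <= d', e' <= e / 4 & e' <= k / (2 * K)].
  by split; rewrite !ge_min lexx ?orbT.
clearbody e'; pose s := b - e' / 2.
have ts : phi t1 < phi s by apply: gt_inc; rewrite /t1 /s; lra.
apply: (le_trans (ltW ts)); rewrite /phi.
have A : h a s <= h a b + k / 2.
  have : `|h a s - h a b| < k / 2 by apply: Hd'; rewrite /s ltr0_norm; lra.
  by rewrite ltr_norml => /andP[]; lra.
have B : h s b <= k / 2.
  have := gen_small sf pM dpM (ltac:(rewrite /s; apply/andP; split; lra) : 0 <= b - s <= pi / 2).
  rewrite ler_norml => /andP[_ H]; apply: (le_trans H).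
  apply: (@le_trans _ _ (K * e')).
    have M20 := sqr_ge0 M; rewrite ler_pM ?mulr_ge0 /K /s//; clear - e'0; lra.
  by rewrite mulrC -ler_pdivlMr// (le_trans e'k)// invfM mulrA.
by lra.
Qed.

(** Steps may vanish, which makes the set of configurations closed on that
  side; minimizers have none ([min_gap]). The side [pi] is excluded because the
  action blows up there. *)
Definition config n w x := x n = x 0%N + w /\
  forall i, (i < n)%N -> 0 <= x i.+1 - x i < pi.

Definition action n x := \sum_(i < n) h (x i) (x i.+1).

Definition is_min n w x := config n w x /\
  forall y, config n w y -> y 0%N = x 0%N -> action n x <= action n y.

Definition upd x k t : nat -> R := fun j => if j == k then t else x j.

Lemma action_upd n x k t : (k.+1 < n)%N ->
  action n (upd x k.+1 t) - action n x =
  h (x k) t + h t (x k.+2) - (h (x k) (x k.+1) + h (x k.+1) (x k.+2)).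
Proof.
move=> kn; have kn' := ltnW kn; rewrite /action.
rewrite (bigD1 (Ordinal kn'))//= (bigD1 (Ordinal kn))/=; last first.
  by rewrite -(inj_eq val_inj)/= neq_ltn ltnSn orbT.
rewrite [in X in _ - X](bigD1 (Ordinal kn'))//= [in X in _ - X](bigD1 (Ordinal kn))/=; last first.
  by rewrite -(inj_eq val_inj)/= neq_ltn ltnSn orbT.
rewrite /upd !eqxx !(ltn_eqF (ltnSn _)) (gtn_eqF (ltnSn _)).
rewrite (eq_bigr (fun i : 'I_n => h (x i) (x i.+1))); first by ring.
move=> i; rewrite -!(inj_eq val_inj)/= => /andP[ik ik1].
by rewrite (negPf ik1) eqSS (negPf ik).
Qed.

Lemma min_local n w x k t : is_min n w x -> (k.+1 < n)%N ->
  0 <= t - x k < pi -> 0 <= x k.+2 - t < pi ->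
  h (x k) (x k.+1) + h (x k.+1) (x k.+2) <= h (x k) t + h t (x k.+2).
Proof.
move=> [[xn gap] mn] kn t1 t2; rewrite -subr_ge0 -(action_upd x t kn) subr_ge0.
apply: mn; last by [].
split=> [|i iN]; first by rewrite /upd (gtn_eqF kn).
rewrite /upd eqSS; have [->|ik] := eqVneq i k.
  by rewrite (ltn_eqF (ltnSn _)).
by have [->|ik1] := eqVneq i k.+1; [|exact: gap].
Qed.

(** If some step vanished while a neighbouring one did not, moving the common point so
  as to split the nonzero step would decrease the action ([gen_split]); and not all
  steps vanish. *)
Lemma min_gap n w x : 0 < w -> is_min n w x ->
  forall i, (i < n)%N -> 0 < x i.+1 - x i < pi.
Proof.
move=> w0 xmin; have [[xn gap] _] := xmin.
have step i : (i.+1 < n)%N -> (x i < x i.+1) = (x i.+1 < x i.+2).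
  move=> iN; have := gap i (ltnW iN); have := gap i.+1 iN.
  rewrite !subr_ge0 => /andP[g1 g1'] /andP[g0 g0'].
  apply/idP/idP => H; rewrite lt_neqAle ?g1 ?g0 andbT; apply/eqP => E.
    have [|t [/andP[t1 t2]]] := @gen_split (x i) (x i.+1); first by apply/andP; split; lra.
    have := min_local xmin iN (t := t).
    rewrite -E gen_diag addr0; lra.
  have [|t [/andP[t1 t2]]] := @gen_split (x i.+1) (x i.+2); first by apply/andP; split; lra.
  have := min_local xmin iN (t := t).
  rewrite E gen_diag add0r; lra.
have all0 i : (i < n)%N -> (x i < x i.+1) = (x 0%N < x 1%N).
  by elim: i => [//|i IH] iN; rewrite -step// IH// ltnW.
have [pos|neg] := boolP (x 0%N < x 1%N).
  by move=> i iN; have /andP[_ ->] := gap i iN; rewrite subr_gt0 all0// pos.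
have : forall i, (i <= n)%N -> x i = x 0%N.
  elim=> [//|i IH] iN; rewrite -IH 1?ltnW//; apply/eqP.
  have := all0 i iN; rewrite (negPf neg) => /negbT; rewrite -leNgt => H.
  by have := gap i iN; rewrite subr_ge0 eq_le H => /andP[->].
by move=> /(_ n (leqnn n)); rewrite xn => /eqP; rewrite -subr_eq0 addrC addKr gt_eqF.
Qed.

(** The Euler-Lagrange equation: the boundary terms [energy_pot] cancel and the two
  tangent lengths are positive. *)
Lemma min_crit n w x : 0 < w -> is_min n w x ->
  forall i, (i.+1 < n)%N -> T (x i) (x i.+1) = S (x i.+1) (x i.+2).
Proof.
move=> w0 xmin i iN; have g0 := min_gap w0 xmin (ltnW iN).
have g1 := min_gap w0 xmin iN.
pose A := Num.max (x i) (x i.+2 - pi); pose B := Num.min (x i.+2) (x i + pi).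
have AB : A < x i.+1 < B.
  by rewrite gt_max lt_min; move: g0 g1 => /andP[? ?] /andP[? ?]; apply/andP; split; apply/andP; split; lra.
have tAB t : A < t < B -> 0 < t - x i < pi /\ 0 < x i.+2 - t < pi.
  by rewrite gt_max lt_min => /andP[/andP[? ?] /andP[? ?]]; split; apply/andP; split; lra.
pose phi t := h (x i) t + h t (x i.+2).
have dphi t : A < t < B ->
    is_derive t (1 : R) phi (T (x i) t ^+ 2 / 2 - S t (x i.+2) ^+ 2 / 2).
  move=> /tAB[H1 H2].
  by apply: (drv_ext (frefl _) _ (drv_add (der_gen_r sf H1) (der_gen_l sf H2))); ring.
have [AB1 AB2] := andP AB.
have := @derive1_at_min R phi A B (x i.+1) (ltW (lt_trans AB1 AB2)) _ _ _.
have H0 t : t \in `]A, B[ -> derivable phi t 1.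
  by rewrite in_itv/= => /dphi [].
have H1 : x i.+1 \in `]A, B[ by rewrite in_itv/= AB.
have H2 t : t \in `]A, B[ -> phi (x i.+1) <= phi t.
  rewrite in_itv/= => /tAB[/andP[? ?] /andP[? ?]].
  by apply: (min_local xmin iN); apply/andP; split; lra.
move=> /(_ H0 H1 H2) => D0.
have := is_derive_unique D0 (dphi _ AB) => E.
have : T (x i) (x i.+1) ^+ 2 = S (x i.+1) (x i.+2) ^+ 2 by lra.
move=> /eqP; rewrite eqrXn2 ?ltW ?(sf_bwd sf) ?(sf_fwd sf)//.
by move/eqP.
Qed.

End Configurations.

(** * A constant minimal action yields a circle map *)

Section Periodic.
Context {R : realType}.

Lemma periodic_nat (f : R -> R) w : (forall t, f (t + w) = f t) ->
  forall (k : nat) t, f (t + w * k%:R) = f t.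
Proof.
move=> per; elim=> [|k IH] t; first by rewrite mulr0 addr0.
by rewrite -natr1 mulrDr mulr1 addrA per.
Qed.

Lemma periodic_reduce (f : R -> R) : (forall t, f (t + 2 * pi) = f t) ->
  forall t, exists s, 0 <= s <= 2 * pi /\ f s = f t.
Proof.
move=> per; have pi0 : 0 < 2 * pi :> R by rewrite mulr_gt0// pi_gt0.
have pos t : 0 <= t -> exists s, 0 <= s <= 2 * pi /\ f s = f t.
  move=> t0; pose k := Num.truncn (t / (2 * pi)).
  have /andP[k1 k2] : k%:R <= t / (2 * pi) < k.+1%:R.
    by apply: truncn_itv; rewrite divr_ge0// ltW.
  exists (t - 2 * pi * k%:R); split.
    move: k1 k2; rewrite ler_pdivlMr// ltr_pdivrMr// -natr1 => k1 k2.
    by apply/andP; split; lra.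
  by rewrite -(periodic_nat per k) subrK.
move=> t; pose k := (Num.truncn (`|t| / (2 * pi))).+1.
have kt : `|t| <= 2 * pi * k%:R.
  by rewrite mulrC -ler_pdivrMr// ltW// truncnS_gt.
have [|s [s1 s2]] := pos (t + 2 * pi * k%:R).
  by have := ler_norm (- t); rewrite normrN; lra.
by exists s; rewrite s2 periodic_nat.
Qed.

Lemma continuous_within (f : R -> R) (A : set R) : (forall x, {for x, continuous f}) ->
  {within A, continuous f}.
Proof. by move=> H; apply: continuous_subspaceT => x; exact: H. Qed.

Lemma periodic_bounds (f : R -> R) : (forall t, f (t + 2 * pi) = f t) ->
  (forall x, {for x, continuous f}) -> exists s1 s2, forall t, f s1 <= f t <= f s2.
Proof.
move=> per cf; have pi0 : 0 <= 2 * pi :> R by rewrite mulr_ge0// pi_ge0.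
have [s1 _ H1] := EVT_min pi0 (continuous_within (A := [set` `[0, 2 * pi]]) cf).
have [s2 _ H2] := EVT_max pi0 (continuous_within (A := [set` `[0, 2 * pi]]) cf).
exists s1, s2 => t; have [s [s0 <-]] := periodic_reduce per t.
by rewrite H1 ?H2// in_itv.
Qed.
End Periodic.

Section FlatAction.
Context {R : realType} (p dp : R -> R) (sf : support_fun p dp).
Context (N : nat) (w : R) (w0 : 0 < w).
Local Notation n := N.+2.
Local Notation S := (fwd p dp).
Local Notation T := (bwd p dp).
Local Notation h := (gen p).
Hypothesis (pw : forall t, p (t + w) = p t) (dpw : forall t, dp (t + w) = dp t).
Implicit Types (a b c t : R) (x y : nat -> R).

Lemma shiftB (k a b : R) : b + k - (a + k) = b - a. Proof. by ring. Qed.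

Lemma fwd_w a b : S (a + w) (b + w) = S a b.
Proof. by rewrite /fwd shiftB !pw dpw. Qed.

Lemma bwd_w a b : T (a + w) (b + w) = T a b.
Proof. by rewrite /bwd shiftB !pw dpw. Qed.

Lemma gen_w a b : h (a + w) (b + w) = h a b.
Proof. by rewrite /gen shiftB !pw. Qed.

Lemma gen_2pi a b : h (a + 2 * pi) (b + 2 * pi) = h a b.
Proof. by rewrite /gen shiftB !(sf_per sf). Qed.

(** The mixed derivative of the generating function is negative, because [bwd]
  decreases in its first variable. *)
Lemma gen_submodular a a' b b' : a <= a' -> a' < b -> b <= b' -> b' - a < pi ->
  h a b + h a' b' <= h a b' + h a' b.
Proof.
move=> aa ab + b'a; rewrite le_eqVlt => /predU1P[->//|bb].
suff : 0 <= (h a b' - h a' b') - (h a b - h a' b) by lra.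
have [|c [/andP[bc cb] ->]] := mean_value (f := fun t => h a t - h a' t)
    (df := fun c => T a c ^+ 2 / 2 - T a' c ^+ 2 / 2) bb.
  move=> c /andP[bc cb].
  have H1 : 0 < c - a < pi by apply/andP; split; lra.
  have H2 : 0 < c - a' < pi by apply/andP; split; lra.
  by apply: (drv_ext (frefl _) _ (drv_sub (der_gen_r sf H1) (der_gen_r sf H2))); ring.
rewrite mulr_ge0 ?subr_ge0 ?(ltW bb)// ler_wpM2r//.
have T0 : 0 < T a' c by apply: (sf_bwd sf); apply/andP; split; lra.
have TT : T a' c <= T a c by apply: (bwd_ge sf); lra.
by rewrite lerXn2r ?nnegrE; lra.
Qed.

(** The variational form of the existence of an invariant curve: the minimal action does
  not depend on the base point. *)
Definition flat c := (forall theta, exists x,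
    [/\ x 0%N = theta, config n w x & action p n x = c]) /\
  forall x, config n w x -> c <= action p n x.

Context (c : R) (fl : flat c).

Definition opt x := config n w x /\ action p n x = c.

Lemma opt_min x : opt x -> is_min p n w x.
Proof. by move=> [cx ax]; split=> // y cy _; rewrite ax; apply: (proj2 fl). Qed.

Lemma opt_gap x : opt x -> forall i, (i < n)%N -> 0 < x i.+1 - x i < pi.
Proof. by move=> /opt_min xm; exact: (min_gap sf w0 xm). Qed.

Definition shift_conf x : nat -> R := fun i => if (i < n)%N then x i.+1 else x 1%N + w.

(** A closed configuration can be started at its second point; minimality is not lost
  because it is global and not relative to a base point. *)
Lemma opt_shift x : opt x -> opt (shift_conf x).
Proof.
move=> ox; have [[xn gap] ax] := ox; split; first split.
- by rewrite /shift_conf ltnn.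
- move=> i iN; rewrite /shift_conf iN; case: ltnP => i1; first exact: gap.
  have -> : i.+1 = n by apply/eqP; rewrite eqn_leq iN i1.
  by rewrite xn shiftB; exact: gap.
- rewrite -ax /action big_ord_recr [RHS]big_ord_recl [RHS]addrC; congr (_ + _).
    apply: eq_bigr => i _; rewrite /shift_conf lift0 /=.
    by have iN := ltn_ord i; rewrite ltnW ltnS iN.
  by rewrite /shift_conf /= ltnn ltnSn xn gen_w.
Qed.

Lemma opt_crit x i : opt x -> (i < N.+1)%N -> T (x i) (x i.+1) = S (x i.+1) (x i.+2).
Proof. by move=> /opt_min xm iN; apply: (min_crit sf w0 xm). Qed.

Lemma opt_crit0 x : opt x -> T (x N.+1) (x n) = S (x 0%N) (x 1%N).
Proof.
move=> ox; have := opt_crit (opt_shift ox) (ltnSn N).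
rewrite /shift_conf ltnn !ltnSn ltnW// => ->.
by have [[-> _] _] := ox; rewrite fwd_w.
Qed.

(** Submodularity bounds the sum of the two actions by [2 * c]; both are at least [c]. *)
Lemma opt_minmax x y : opt x -> opt y ->
  opt (fun i => Num.min (x i) (y i)) /\ opt (fun i => Num.max (x i) (y i)).
Proof.
move=> ox oy; have gx := opt_gap ox; have gy := opt_gap oy.
have [[xn _] ax] := ox; have [[yn _] ay] := oy.
set u := fun i => Num.min _ _; set v := fun i => Num.max _ _.
have cu : config n w u.
  split; first by rewrite /u xn yn addr_minl.
  move=> i iN; have /andP[? ?] := gx i iN; have /andP[? ?] := gy i iN; rewrite /u.
  by apply/andP; split; case: (ltrP (x i) (y i)) => ?; case: (ltrP (x i.+1) (y i.+1)) => ?; lra.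
have cv : config n w v.
  split; first by rewrite /v xn yn addr_maxl.
  move=> i iN; have /andP[? ?] := gx i iN; have /andP[? ?] := gy i iN; rewrite /v.
  by apply/andP; split; case: (ltrP (x i) (y i)) => ?; case: (ltrP (x i.+1) (y i.+1)) => ?; lra.
have uv : action p n u + action p n v <= c + c.
  rewrite -{1}ax -ay -!big_split; apply: ler_sum => i _; rewrite /u /v.
  have /andP[? ?] := gx i (ltn_ord i); have /andP[? ?] := gy i (ltn_ord i).
  case: (ltrP (x i) (y i)) => ?; case: (ltrP (x i.+1) (y i.+1)) => ? //.
  - by apply: gen_submodular; lra.
  - by rewrite [leRHS]addrC; apply: gen_submodular; lra.
  - by rewrite [leLHS]addrC.
have [_ fc] := fl; have := fc u cu; have := fc v cv.
by move=> H1 H2; split; split=> //; lra.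
Qed.

(** Two ordered minimal configurations that touch at the base point agree there in
  their next and previous steps: the forward lengths are ordered one way, the
  backward lengths the other way, and the reflection law equates them. *)
Lemma opt_ordered_eq x y : opt x -> opt y -> (forall i, x i <= y i) ->
  x 0%N = y 0%N -> forall i, (i <= n)%N -> x i = y i.
Proof.
move=> ox oy xy E.
have [[xn _] _] := ox; have [[yn _] _] := oy.
have gx := opt_gap ox; have gy := opt_gap oy.
have H : x 1%N = y 1%N.
  apply: (fwd_inj sf (a := x 0%N)); [exact: gx|by rewrite E; exact: gy|].
  apply: le_anti; apply/andP; split.
    have /andP[? ?] := gx 0%N isT; have /andP[? ?] := gy 0%N isT.
    by apply: (fwd_le sf) => //; rewrite E.
  rewrite [X in S X (y _)]E -(opt_crit0 ox) -(opt_crit0 oy).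
  have /andP[? ?] := gx N.+1 (ltnSn _); have /andP[? ?] := gy N.+1 (ltnSn _).
  have En : x n = y n by rewrite xn yn E.
  by rewrite En; apply: (bwd_ge sf) => //; rewrite -En.
suff : forall i, (i < n)%N -> x i = y i /\ x i.+1 = y i.+1.
  by move=> K [|i] iN; [|case: (K i iN)].
elim=> [//|i IH] iN; have [E1 E2] := IH (ltnW iN); split=> //.
apply: (fwd_inj sf (a := x i.+1)); [exact: gx|by rewrite E2; exact: gy|].
by rewrite -(opt_crit ox)// [X in S X (y _)]E2 -(opt_crit oy)// E1 E2.
Qed.

Lemma opt_eq x y : opt x -> opt y -> x 0%N = y 0%N ->
  forall i, (i <= n)%N -> x i = y i.
Proof.
move=> ox oy E i iN; have [om oM] := opt_minmax ox oy.
have := opt_ordered_eq om oM _ _ iN; rewrite /= E minxx maxxx => H.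
have := H _ erefl; case: ltrP => _ -> // j; by rewrite ge_min le_max lexx.
Qed.

(** The lift of an invariant curve: [g] sends an angle to the next one and [u] is the
  tangent length at the given angle, which is both the forward length of the step
  leaving it and the backward length of the step arriving at it. *)
Record circle (g u : R -> R) : Prop := Circle {
  ci_gap : forall t, 0 < g t - t < pi ;
  ci_fwd : forall t, S t (g t) = u t ;
  ci_bwd : forall t, T t (g t) = u (g t) ;
  ci_iter : forall t, iter n g t = t + w ;
  ci_cont : forall t, {for t, continuous u} }.

Definition optx theta := projT1 (cid (proj1 fl theta)).

Lemma optxP theta : optx theta 0%N = theta /\ opt (optx theta).
Proof. by rewrite /optx; case: cid => x []. Qed.

(** Well defined because minimal configurations with the same base point agree. *)
Definition circle_map theta := optx theta 1%N.
Local Notation g := circle_map.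

Lemma opt_follow x i : opt x -> (i < n)%N -> x i.+1 = g (x i).
Proof.
elim: i x => [|i IH] x ox iN.
  by have [E oE] := optxP (x 0%N); rewrite /g (opt_eq ox oE).
have := IH _ (opt_shift ox) (ltnW iN).
by rewrite /shift_conf iN (ltnW iN).
Qed.

Lemma circle_map_fwd_bwd t : T t (g t) = S (g t) (g (g t)) /\ 0 < g t - t < pi.
Proof.
have [E oE] := optxP t.
have := opt_crit oE (ltn0Sn _); have := opt_gap oE (ltn0Sn _).
by rewrite (opt_follow oE (i := 1))// (opt_follow oE (i := 0))// E.
Qed.

Lemma circle_map_iter t : iter n g t = t + w.
Proof.
have [E oE] := optxP t; have [[xn _] _] := oE; rewrite -[in RHS]E -xn.
suff : forall i, (i <= n)%N -> iter i g t = optx t i by apply.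
elim=> [|i IH] iN; first by rewrite /= E.
by rewrite iterS IH ?(opt_follow oE)// ltnW.
Qed.

(** Were the second points not in the order of the first ones, the pointwise minimum
  of the two configurations would be minimal, so that the second points, and then,
  following the shifted configurations around, the base points would agree. *)
Lemma circle_map_incr s t : s < t -> g s < g t.
Proof.
move=> st; have [E oE] := optxP s; have [F oF] := optxP t.
rewrite ltNge; apply/negP => gts.
have [om _] := opt_minmax oE oF.
have := fun e => @opt_eq _ _ oE om e 1%N.
rewrite /= E F; rewrite (min_l (ltW st)) => /(_ erefl isT).
rewrite -/(g s) -/(g t) (min_r gts) => gst.
have := fun e => @opt_eq _ _ (opt_shift oE) (opt_shift oF) e N.+1.
rewrite {1 2}/shift_conf /= -/(g s) -/(g t) => /(_ gst (leqnSn _)).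
rewrite /shift_conf ltnSn; have [[-> _] _] := oE; have [[-> _] _] := oF.
by rewrite E F => /addIr ?; lra.
Qed.

Lemma opt_translate x : opt x -> opt (fun i => x i + 2 * pi).
Proof.
move=> [[xn gap] ax]; split; first split.
- by rewrite xn addrAC.
- by move=> i iN; rewrite shiftB; exact: gap.
- by rewrite -ax; apply: eq_bigr => i _; rewrite gen_2pi.
Qed.

Lemma circle_map_per t : g (t + 2 * pi) = g t + 2 * pi.
Proof.
have [E oE] := optxP t; have := opt_follow (opt_translate oE) (i := 0) isT.
by rewrite /= (opt_follow oE (i := 0))// E.
Qed.

Lemma circle_map_surj t : exists s, g s = t.
Proof.
exists (iter N.+1 g (t - w)); rewrite -iterS.
have := circle_map_iter (t - w); by rewrite subrK.
Qed.

Lemma circle_map_cont t : {for t, continuous g}.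
Proof.
apply/cvgrPdist_lt => e e0.
have [a Ha] := circle_map_surj (g t - e); have [b Hb] := circle_map_surj (g t + e).
have ltg s s' : g s < g s' -> s < s'.
  rewrite !ltNge; apply: contra; rewrite le_eqVlt => /predU1P[->//|/circle_map_incr/ltW//].
have at_ : a < t by apply: ltg; rewrite Ha; lra.
have tb : t < b by apply: ltg; rewrite Hb; lra.
near=> s.
have : a < s < b.
  near: s; have : nbhs t `]a, b[%classic.
    by apply: near_in_itvoo; rewrite in_itv/= at_.
  by apply: filterS => s /=; rewrite in_itv.
move=> /andP[/circle_map_incr + /circle_map_incr]; rewrite Ha Hb ltr_norml => ? ?.
by apply/andP; split; lra.
Unshelve. all: by end_near.
Qed.

Lemma circle_map_gap_bounds : exists k, 0 < k /\ forall t, k <= g t - t <= pi - k.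
Proof.
have [||s1 [s2 H]] := @periodic_bounds R (fun t => g t - t).
- by move=> t; rewrite circle_map_per; ring.
- by move=> t; apply: cvgB; [exact: circle_map_cont|exact: cvg_id].
have [_ /andP[? _]] := circle_map_fwd_bwd s1; have [_ /andP[_ ?]] := circle_map_fwd_bwd s2.
exists (Num.min (g s1 - s1) (pi - (g s2 - s2))); split.
  by rewrite lt_min; apply/andP; split; lra.
move=> t; have /andP[? ?] := H t.
set k := Num.min _ _.
have k1 : k <= g s1 - s1 by rewrite ge_min lexx.
have k2 : k <= pi - (g s2 - s2) by rewrite ge_min lexx orbT.
by apply/andP; split; lra.
Qed.
End FlatAction.

(** * Lipschitz regularity of the circle *)

Section Lipschitz.
Context {R : realType}.

(** A Lipschitz estimate for nearby points propagates by subdivision. *)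
Lemma local_lipschitz (f : R -> R) d L : 0 < d ->
  (forall s t, s <= t -> t - s <= d -> `|f t - f s| <= L * (t - s)) ->
  forall s t, `|f s - f t| <= L * `|s - t|.
Proof.
move=> d0 H.
have step (k : nat) : forall s t, s <= t -> t - s <= d * k%:R -> `|f t - f s| <= L * (t - s).
  elim: k => [|k IH] s t st.
    by rewrite mulr0 => ts; apply: H => //; lra.
  rewrite -natr1 mulrDr mulr1 => ts.
  have [td|td] := lerP (t - s) d; first exact: H.
  rewrite (_ : f t - f s = (f t - f (t - d)) + (f (t - d) - f s)); last by ring.
  apply: le_trans (ler_normD _ _) _.
  rewrite (_ : L * (t - s) = L * (t - (t - d)) + L * (t - d - s)); last by ring.
  by apply: lerD; [apply: H|apply: IH]; lra.
have main s t : s <= t -> `|f t - f s| <= L * (t - s).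
  move=> st; apply: (step (Num.truncn ((t - s) / d)).+1) => //.
  by rewrite mulrC -ler_pdivrMr// ltW// truncnS_gt.
move=> s t; have [st|/ltW ts] := lerP s t.
  by rewrite (distrC (f s)) main.
by rewrite main.
Qed.

Lemma sin_lower (k x : R) : 0 < k -> k <= x <= pi - k -> k / 2 <= sin x.
Proof.
move=> k0 /andP[kx xk]; have [xp|xp] := lerP x (pi / 2).
  by apply: le_trans (sin_ge_half _); [lra|apply/andP; split; lra].
have -> : sin x = sin (pi - x) by rewrite (sinB pi) sinpi cospi; ring.
by apply: le_trans (sin_ge_half _); [lra|apply/andP; split; lra].
Qed.

(** Away from the degenerate steps all the functions involved have bounded
  derivatives. *)
Lemma fwd_lip_l (p dp : R -> R) k : support_fun p dp -> 0 < k ->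
  exists L, 0 <= L /\ forall a a' b, a <= a' -> b - a <= pi - k -> k <= b - a' ->
    `|fwd p dp a' b - fwd p dp a b| <= L * (a' - a).
Proof.
move=> sf k0; have [M bnd] := sf_bnd sf; have [L lip] := sf_lip sf.
have pM t : p t <= M by have [] := bnd t.
have dpM t : `|dp t| <= M by have [] := bnd t.
have L0 : 0 <= L by have := lip 1 0; rewrite subr0 normr1 mulr1; apply: le_trans.
have M0 : 0 <= M by apply: le_trans (dpM 0).
exists (16 * M / k ^+ 2 + L); split.
  by rewrite addr_ge0 ?divr_ge0 ?mulr_ge0 ?exprn_ge0 ?(ltW k0).
move=> a a' b; rewrite le_eqVlt => /predU1P[->|aa] ba ba'.
  by rewrite !subrr normr0 mulr0.
pose Q t := (p b - p t * cos (b - t)) / sin (b - t).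
pose dQ t := (- (dp t * cos (b - t) + p t * sin (b - t)) * sin (b - t)
  + (p b - p t * cos (b - t)) * cos (b - t)) / sin (b - t) ^+ 2.
have sl t : a <= t <= a' -> k / 2 <= sin (b - t).
  by move=> /andP[? ?]; apply: sin_lower => //; apply/andP; split; lra.
have [|c [/andP[ac cb] E]] := mean_value (f := Q) (df := dQ) aa.
  move=> c acb; have s0 : sin (b - c) != 0 by rewrite gt_eqF//; have := sl c acb; lra.
  apply: (drv_ext (frefl _) _ (drv_div s0 (drv_sub (drv_cst c (p b))
    (drv_mul (sf_der sf c) (drv_cosBr c b))) (drv_sinBr c b))).
  by rewrite /dQ; congr (_ / _); ring.
rewrite (_ : _ - _ = (Q a' - Q a) - (dp a' - dp a)); last by rewrite /fwd /Q; ring.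
apply: le_trans (ler_normB _ _) _; rewrite mulrDl.
have aa0 : 0 <= a' - a by lra.
apply: lerD; last by apply: le_trans (lip _ _) _; rewrite (ger0_norm aa0).
rewrite E normrM (ger0_norm aa0) ler_wpM2r// /dQ normrM normfV.
have sc := sl c (ltac:(apply/andP; split; lra)).
set s := sin _ in sc *; set co := cos _.
have s_pos : 0 < s by lra.
have ss : k ^+ 2 / 4 <= s ^+ 2 by rewrite !expr2; nra.
have k2 : 0 < k ^+ 2 by rewrite exprn_gt0.
have s2 : 0 < s ^+ 2 by rewrite exprn_gt0.
rewrite (gtr0_norm s2) ler_pdivrMr//.
have co1 : `|co| <= 1 by rewrite ler_norml cos_geN1 cos_le1.
have s1 : `|s| <= 1 by rewrite ler_norml sin_geN1 sin_le1.
have bM x y : `|x| <= M -> `|y| <= 1 -> `|x * y| <= M.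
  by move=> xM y1; rewrite normrM -[leRHS]mulr1 ler_pM.
have pM' t : `|p t| <= M by rewrite gtr0_norm// (sf_pos sf).
apply: (@le_trans _ _ (4 * M)).
  apply: le_trans (ler_normD _ _) _.
  have B1 := bM _ _ (dpM c) co1; have B2 := bM _ _ (pM' c) s1; have B3 := bM _ _ (pM' c) co1.
  have H1 : `|- (dp c * co + p c * s) * s| <= 2 * M.
    rewrite normrM normrN -[leRHS]mulr1 ler_pM// (le_trans (ler_normD _ _))//; lra.
  have H2 : `|(p b - p c * co) * co| <= 2 * M.
    rewrite normrM -[leRHS]mulr1 ler_pM// (le_trans (ler_normB _ _))//.
    by have := pM' b; lra.
  lra.
rewrite [leRHS](_ : _ = 16 * M * s ^+ 2 / k ^+ 2); last by ring.
rewrite ler_pdivlMr//.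
have : M * (k ^+ 2 / 4) <= M * s ^+ 2 by rewrite ler_wpM2l.
lra.
Qed.

Lemma bwd_lip_r (p dp : R -> R) k : support_fun p dp -> 0 < k ->
  exists L, 0 <= L /\ forall a b b', b <= b' -> b' - a <= pi - k -> k <= b - a ->
    `|bwd p dp a b' - bwd p dp a b| <= L * (b' - b).
Proof.
move=> sf k0; have [L [L0 H]] := fwd_lip_l (support_fun_refl sf) k0.
exists L; split=> // a b b' bb ba ba'; rewrite distrC -!fwd_refl.
apply: le_trans (H _ _ _ _ _ _) _; [lra|lra|lra|].
by rewrite ler_wpM2l//; lra.
Qed.
End Lipschitz.

Section FlatCircle.
Context {R : realType} (p dp : R -> R) (sf : support_fun p dp).
Context (N : nat) (w : R) (w0 : 0 < w).
Hypothesis (pw : forall t, p (t + w) = p t) (dpw : forall t, dp (t + w) = dp t).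

(** The Lipschitz bound is one-sided in two ways: [u] is a forward length towards a
  monotone image, hence decreases at most linearly, and a backward length from a
  monotone preimage, hence increases at most linearly. *)
Lemma flat_circle c : flat p N w c -> exists g u,
  [/\ circle p dp N w g u, forall s t, s < t -> g s < g t,
      forall t, g (t + 2 * pi) = g t + 2 * pi
    & exists L, forall s t, `|u s - u t| <= L * `|s - t| ].
Proof.
move=> fl; pose g := circle_map fl; pose u t := fwd p dp t (g t).
have fb := circle_map_fwd_bwd sf w0 pw dpw fl.
have incr := circle_map_incr sf w0 pw dpw fl.
have [k [k0 Hk]] := circle_map_gap_bounds sf w0 pw dpw fl.
have surj := circle_map_surj sf w0 pw dpw fl.
have ulip : exists L, forall s t, `|u s - u t| <= L * `|s - t|.
  have k20 : 0 < k / 2 by rewrite divr_gt0.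
  have [L1 [L10 H1]] := fwd_lip_l sf k20; have [L2 [L20 H2]] := bwd_lip_r sf k20.
  exists (L1 + L2); apply: (local_lipschitz k20) => s t.
  rewrite le_eqVlt => /predU1P[->|st] tsk; first by rewrite !subrr normr0 mulr0.
  have ts0 : 0 <= t - s by lra.
  have /andP[gs1 gs2] := Hk s; have /andP[gt1 gt2] := Hk t.
  rewrite -/g in gs1 gs2 gt1 gt2.
  have LL1 : L1 * (t - s) <= (L1 + L2) * (t - s) by rewrite ler_wpM2r//; lra.
  have LL2 : L2 * (t - s) <= (L1 + L2) * (t - s) by rewrite ler_wpM2r//; lra.
  rewrite ler_norml; apply/andP; split.
    have A : fwd p dp t (g s) <= fwd p dp t (g t).
      by apply: (fwd_le sf); [lra|exact/ltW/incr|lra].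
    have := H1 s t (g s) (ltW st) (ltac:(lra)) (ltac:(lra)).
    by rewrite ler_norml => /andP[? _]; rewrite /u; lra.
  have [s' Es] := surj s; have [t' Et] := surj t.
  have us : u s = bwd p dp s' s by rewrite /u -Es; have [->] := fb s'.
  have ut : u t = bwd p dp t' t by rewrite /u -Et; have [->] := fb t'.
  have st' : s' < t'.
    rewrite ltNge le_eqVlt; apply/negP => /predU1P[E|/incr]; last by rewrite Es Et; lra.
    by move: st; rewrite -Es -Et E ltxx.
  have /andP[? ?] := Hk s'; have /andP[? ?] := Hk t'; rewrite us ut.
  have B : bwd p dp t' t <= bwd p dp s' t by apply: (bwd_ge sf); lra.
  have := H2 s' s t (ltW st) (ltac:(lra)) (ltac:(lra)).
  by rewrite ler_norml => /andP[_ ?]; lra.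
exists g, u; split => //; last exact: (circle_map_per sf w0 pw dpw fl).
split.
- by move=> t; have [] := fb t.
- by [].
- by move=> t; have [] := fb t.
- exact: (circle_map_iter sf w0 pw dpw fl).
- move=> t; have [L HL] := ulip.
  have L0 : 0 <= L by have := HL 1 0; rewrite subr0 normr1 mulr1; apply: le_trans.
  apply/cvgrPdist_le => e e0; near=> s.
  apply: le_trans (HL _ _) _; apply: (@le_trans _ _ ((L + 1) * `|t - s|)).
    by rewrite ler_wpM2r//; lra.
  rewrite mulrC -ler_pdivlMr; last by lra.
  near: s; apply: cvgr_dist_le; [exact: cvg_id|].
  by rewrite divr_gt0//; lra.
Unshelve. all: by end_near.
Qed.
End FlatCircle.

(** * Minimal configurations near an invariant circle *)

Section Dini.
Context {R : realType}.
Implicit Types (f M : R -> R) (a b t : R).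

Lemma drv0_small f x k : is_derive x (1 : R) f 0 -> 0 < k ->
  exists d, 0 < d /\ forall t, `|t - x| < d -> `|f t - f x| <= k * `|t - x|.
Proof.
move=> [df d0] k0.
have : (fun h : R => h^-1 *: (f (h *: (1 : R) + x) - f x)) @ 0^' --> 'D_(1 : R) f x.
  exact: df.
rewrite d0 => /cvgrPdist_le/(_ k k0) /nbhs_ballP[d /= dd H]; exists d; split=> // t tx.
have [->|tx0] := eqVneq t x; first by rewrite !subrr normr0 mulr0.
have := H (t - x); rewrite -ball_normE/= sub0r normrN subr_eq0 => /(_ tx tx0).
rewrite sub0r normrN /GRing.scale/= mulr1 subrK normrM normfV.
by rewrite ler_pdivrMl ?normr_gt0 ?subr_eq0// mulrC.
Qed.

(** Only an upper bound for the increments is assumed. Tilting the function by a small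
  slope, a minimum on the segment can only be at the right end. *)
Lemma dini_le M a b : (forall x, {for x, continuous M}) ->
  (forall x k, 0 < k -> exists d, 0 < d /\
     forall t, `|t - x| < d -> M t <= M x + k * `|t - x|) ->
  a <= b -> M b <= M a.
Proof.
move=> cM H; rewrite le_eqVlt => /predU1P[->//|ab]; apply/ler_addgt0Pr => e e0.
pose k := e / (b - a); have k0 : 0 < k by rewrite divr_gt0// subr_gt0.
pose phi t := M t - k * (t - a).
have cphi : {within [set` `[a, b]], continuous phi}.
  apply: continuous_within => x; apply: cvgB; first exact: cM.
  by apply: cvgM; [exact: cvg_cst|apply: cvgB; [exact: cvg_id|exact: cvg_cst]].
have [s sab Hs] := EVT_min (ltW ab) cphi.
move: (sab); rewrite in_itv/= => /andP[as_]; rewrite le_eqVlt => /predU1P[sb|sb].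
  have := Hs a; rewrite in_itv/= lexx (ltW ab) => /(_ isT).
  have kE : k * (b - a) = e by rewrite /k divfK// gt_eqF// subr_gt0.
  by rewrite /phi subrr mulr0 subr0 sb kE; lra.
have k20 : 0 < k / 2 by rewrite divr_gt0.
have [d [d0 Hd]] := H s _ k20.
pose t := Num.min b (s + d / 2).
have st : s < t by rewrite lt_min sb /=; lra.
have tb : t <= b by rewrite ge_min lexx.
have td : t - s < d by have : t <= s + d / 2 by [rewrite ge_min lexx orbT]; lra.
have := Hd t; rewrite gtr0_norm ?subr_gt0// => /(_ td) H1.
have := Hs t; rewrite in_itv/= tb (le_trans as_ (ltW st)) => /(_ isT).
have : 0 < k * (t - s) by rewrite mulr_gt0// subr_gt0.
by rewrite /phi; lra.
Qed.

(** The hypothesis bounds the increments on both sides of each point, hence it is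
  symmetric under reflection and gives both inequalities. *)
Lemma dini_constant M : (forall x, {for x, continuous M}) ->
  (forall x k, 0 < k -> exists d, 0 < d /\
     forall t, `|t - x| < d -> M t <= M x + k * `|t - x|) ->
  forall a b, M a = M b.
Proof.
move=> cM H.
have le a b : a <= b -> M b <= M a by exact: dini_le.
have ge a b : a <= b -> M a <= M b.
  move=> ab; have := @dini_le (fun t => M (- t)) (- b) (- a); rewrite !opprK; apply.
  - move=> x; apply: (@continuous_comp _ _ _ (fun t : R => - t) M); last exact: cM.
    by apply: cvgN; exact: cvg_id.
  - move=> x k k0; have [d [d0 Hd]] := H (- x) k k0; exists d; split=> // t tx.
    by have := Hd (- t); rewrite -opprD normrN; apply.
  - by rewrite lerN2.
move=> a b; have [/[dup]/le ? /ge ?|/ltW/[dup]/le ? /ge ?] := lerP a b;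
  by apply: le_anti; apply/andP.
Qed.
End Dini.

Section CircleMinimizers.
Context {R : realType} (p dp : R -> R) (sf : support_fun p dp).
Context (N : nat) (w : R) (w0 : 0 < w).
Local Notation n := N.+2.
Local Notation S := (fwd p dp).
Local Notation T := (bwd p dp).
Local Notation h := (gen p).
Hypothesis (pw : forall t, p (t + w) = p t) (dpw : forall t, dp (t + w) = dp t).

Lemma fwd_cont_l a b : 0 < b - a < pi -> {for a, continuous (fun t => S t b)}.
Proof.
move=> ab; have s0 := sin_neq0 ab.
apply: cvgB; last exact: (dp_continuous sf).
have cp := drv_continuous (sf_der sf a).
apply: cvgM; last by apply: cvgV => //; exact: drv_continuous (drv_sinBr a b).
apply: cvgB; first exact: cvg_cst.
by apply: cvgM; [exact: cp|exact: drv_continuous (drv_cosBr a b)].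
Qed.

Lemma near_gt_continuous (f f' : R -> R) x : {for x, continuous f} ->
  {for x, continuous f'} -> f x < f' x -> \forall t \near x, f t < f' t.
Proof.
move=> cf cf' ff; pose e := (f' x - f x) / 2.
have e0 : 0 < e by rewrite divr_gt0// subr_gt0.
have /cvgrPdist_lt/(_ e e0) A := cf; have /cvgrPdist_lt/(_ e e0) B := cf'.
near=> t.
have : `|f x - f t| < e by near: t.
have : `|f' x - f' t| < e by near: t.
by rewrite !ltr_norml /e => /andP[? ?] /andP[? ?]; lra.
Unshelve. all: by end_near.
Qed.

Context (g u : R -> R) (ci : circle p dp N w g u).

(** Continuity of [u] is enough: [g t] is the angle at which the forward length takes
  the value [u t], and the forward length is strictly monotone. *)
Lemma circle_cont t : {for t, continuous g}.
Proof.
apply/cvgrPdist_lt => e0 e0_gt0.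
have /andP[g1 g2] := ci_gap ci t.
pose e := Num.min e0 (Num.min ((g t - t) / 2) ((pi - (g t - t)) / 2)).
have e_gt0 : 0 < e by rewrite !lt_min e0_gt0 !divr_gt0 ?subr_gt0//; lra.
have [ee ee1 ee2] : [/\ e <= e0, e <= (g t - t) / 2 & e <= (pi - (g t - t)) / 2].
  by split; rewrite !ge_min lexx ?orbT.
have gm : 0 < g t - e - t < pi by apply/andP; split; lra.
have gp : 0 < g t + e - t < pi by apply/andP; split; lra.
have A : \forall s \near t, S s (g t - e) < u s.
  apply: near_gt_continuous; [exact: fwd_cont_l|exact: ci_cont ci t|].
  by rewrite -(ci_fwd ci t); apply: (fwd_incr sf); lra.
have B : \forall s \near t, u s < S s (g t + e).
  apply: near_gt_continuous; [exact: ci_cont ci t|exact: fwd_cont_l|].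
  by rewrite -(ci_fwd ci t); apply: (fwd_incr sf); lra.
near=> s.
have ts : `|t - s| < e / 2.
  near: s; apply: cvgr_dist_lt; [exact: cvg_id|by rewrite divr_gt0].
have s1 : S s (g t - e) < u s by near: s.
have s2 : u s < S s (g t + e) by near: s.
move: ts; rewrite ltr_norml => /andP[ts1 ts2].
have /andP[g3 g4] := ci_gap ci s; rewrite -(ci_fwd ci s) in s1 s2.
have C : g t - e < g s.
  rewrite ltNge; apply/negP => /(fwd_le sf g3) H; move: s1; rewrite ltNge H//; lra.
have D : g s < g t + e.
  rewrite ltNge; apply/negP => H; move: s2; rewrite ltNge (fwd_le sf)//; lra.
by rewrite ltr_norml; apply/andP; split; lra.
Unshelve. all: by end_near.
Qed.

Lemma circle_iterS t : g (t + w) = g t + w.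
Proof. by rewrite -(ci_iter ci (g t)) -iterSr iterS (ci_iter ci). Qed.

Lemma circle_inj : injective g.
Proof.
move=> s t E; have := ci_iter ci s; rewrite iterSr E -iterSr (ci_iter ci).
by move/addIr.
Qed.

Lemma circle_incr s t : s < t -> g s < g t.
Proof.
have [] := @itv_continuous_inj_mono R g `]-oo, +oo[.
- by apply: continuous_within; exact: circle_cont.
- by move=> ? ? _ _; exact: circle_inj.
- by move=> H; apply: H; rewrite in_itv.
move=> H; have := H (t + pi) t; rewrite !in_itv/= => /(_ isT isT).
have := pi_gt0 R => pi0; rewrite ltrDl pi0 => /(_ isT).
by have /andP[? ?] := ci_gap ci t; have /andP[? ?] := ci_gap ci (t + pi); lra.
Qed.

Lemma circle_surj t : exists s, g s = t.
Proof.
by exists (iter N.+1 g (t - w)); rewrite -iterS (ci_iter ci) subrK.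
Qed.

Lemma circle_mono s t : (g s < g t) = (s < t).
Proof.
apply/idP/idP; last exact: circle_incr.
by rewrite !ltNge; apply: contra; rewrite le_eqVlt => /predU1P[->//|/circle_incr/ltW].
Qed.

Lemma circle_u_w t : u (t + w) = u t.
Proof.
by rewrite -!(ci_fwd ci) circle_iterS (fwd_w pw dpw).
Qed.

(** An orbit that jumps ahead of [g] once has a larger tangent length than the circle
  at the next point, hence jumps ahead again. *)
Lemma circle_above a b : 0 < b - a < pi -> g a < b -> u b < T a b.
Proof.
move=> /andP[ab1 ab2] gab; have [y Ey] := circle_surj b.
rewrite -Ey circle_mono in gab; have /andP[? ?] := ci_gap ci y.
by rewrite -{1}Ey -(ci_bwd ci) Ey; apply: (bwd_decr sf) => //; lra.
Qed.

Lemma circle_below a b : 0 < b - a < pi -> b < g a -> T a b < u b.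
Proof.
move=> /andP[ab1 ab2] gab; have [y Ey] := circle_surj b.
rewrite -Ey circle_mono in gab; have /andP[? ?] := ci_gap ci y.
by rewrite -{2}Ey -(ci_bwd ci) Ey; apply: (bwd_decr sf) => //; lra.
Qed.

Lemma circle_above_fwd b c : 0 < c - b < pi -> (u b < S b c) = (g b < c).
Proof.
move=> /andP[? ?]; have /andP[? ?] := ci_gap ci b; rewrite -(ci_fwd ci).
apply/idP/idP => H; last by apply: (fwd_incr sf).
by rewrite ltNge; apply/negP => H'; move: H; rewrite ltNge (fwd_le sf).
Qed.

Lemma circle_below_fwd b c : 0 < c - b < pi -> (S b c < u b) = (c < g b).
Proof.
move=> /andP[? ?]; have /andP[? ?] := ci_gap ci b; rewrite -(ci_fwd ci).
apply/idP/idP => H; last by apply: (fwd_incr sf).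
by rewrite ltNge; apply/negP => H'; move: H; rewrite ltNge (fwd_le sf).
Qed.

(** A minimal configuration that left the circle at its first step would stay strictly
  ahead of it, or strictly behind it, and could not end at [x 0 + w]. *)
Lemma circle_follow x : is_min p n w x -> forall i, (i < n)%N -> x i.+1 = g (x i).
Proof.
move=> xm; have gap := min_gap sf w0 xm; have crit := min_crit sf w0 xm.
have [[xn _] _] := xm.
have H0 : x 1%N = g (x 0%N).
  apply: le_anti; apply/andP; split; rewrite leNgt; apply/negP => H.
    have K i : (i < n)%N -> g (x i) < x i.+1.
      elim: i => [//|i IH] iN; have {}IH := IH (ltnW iN).
      rewrite -circle_above_fwd ?gap// -crit//; apply: circle_above => //.
      by apply: gap; exact: ltnW.
    have J i : (i < n)%N -> iter i.+1 g (x 0%N) < x i.+1.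
      elim: i => [_|i IH iN]; first exact: H.
      rewrite iterS; apply: lt_trans (K _ iN).
      by rewrite circle_mono; apply: IH; exact: ltnW.
    by have := J N.+1 (ltnSn _); rewrite (ci_iter ci) xn ltxx.
  have K i : (i < n)%N -> x i.+1 < g (x i).
    elim: i => [//|i IH] iN; have {}IH := IH (ltnW iN).
    rewrite -circle_below_fwd ?gap// -crit//; apply: circle_below => //.
    by apply: gap; exact: ltnW.
  have J i : (i < n)%N -> x i.+1 < iter i.+1 g (x 0%N).
    elim: i => [_|i IH iN]; first exact: H.
    rewrite iterS; apply: lt_trans (K _ iN) _.
    by rewrite circle_mono; apply: IH; exact: ltnW.
  by have := J N.+1 (ltnSn _); rewrite (ci_iter ci) xn ltxx.
elim=> [//|i IH] iN; apply: (fwd_inj sf (a := x i.+1)).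
- exact: gap.
- exact: (ci_gap ci).
- rewrite -crit// (IH (ltnW iN)) (ci_bwd ci) -(IH (ltnW iN)).
  by rewrite (ci_fwd ci).
Qed.

(** Minimality does not impose the reflection law at the fixed base point; an invariant
  circle does. *)
Lemma circle_closing x : is_min p n w x -> T (x N.+1) (x n) = S (x 0%N) (x 1%N).
Proof.
move=> xm; have F := circle_follow xm; have [[xn _] _] := xm.
by rewrite (F N.+1)// (ci_bwd ci) -(F N.+1)// xn circle_u_w (F 0%N)// (ci_fwd ci).
Qed.

End CircleMinimizers.

Section ClosingFlat.
Context {R : realType} (p dp : R -> R) (sf : support_fun p dp).
Context (N : nat) (w : R) (w0 : 0 < w).
Local Notation n := N.+2.
Hypothesis (pw : forall t, p (t + w) = p t) (dpw : forall t, dp (t + w) = dp t).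

(** Moving the two end points of a minimizer gives an upper bound for the minimal
  action at neighbouring base points. Its derivative is the defect in the
  reflection law at the base point, so the minimal action is constant. *)
Lemma closing_flat (M : R -> R) :
  (forall theta, exists x, [/\ x 0%N = theta, is_min p n w x & action p n x = M theta]) ->
  (forall t, {for t, continuous M}) ->
  (forall x, is_min p n w x -> bwd p dp (x N.+1) (x n) = fwd p dp (x 0%N) (x 1%N)) ->
  exists c, flat p N w c.
Proof.
move=> ex cM clos.
have cst := dini_constant cM.
suff K : forall (x k : R), 0 < k -> exists d, 0 < d /\
     forall t, `|t - x| < d -> M t <= M x + k * `|t - x|.
  exists (M 0); split=> [t|x cx].
    have [x [x0 [cx xm] ax]] := ex t; exists x; split=> //.
    by rewrite ax; exact: (cst K).
  have [y [y0 [cy ym] ay]] := ex (x 0%N).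
  by rewrite (cst K 0 (x 0%N)) -ay; apply: ym.
move=> th k k0; have [x [x0 xm ax]] := ex th.
have gap := min_gap sf w0 xm; have [[xn _] _] := xm.
(* The part of the action that changes when the two end points move by a common amount. *)
pose psi t := gen p t (x 1%N) + gen p (x N.+1) (t + w).
have g0 := gap 0%N isT; have gN := gap N.+1 (ltnSn _).
rewrite x0 in g0; rewrite xn x0 in gN.
have dpsi : is_derive th (1 : R) psi 0.
  have H := drv_comp (drv_add (drv_id th) (drv_cst th w)) (der_gen_r sf gN).
  apply: (drv_ext (frefl _) _ (drv_add (der_gen_l sf g0) H)).
  have := clos x xm; rewrite xn x0 => ->.
  by rewrite /energy_pot pw dpw; ring.
have [d [d0 Hd]] := drv0_small dpsi k0.
have /andP[g1 g2] := g0; have /andP[g3 g4] := gN.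
(* Close enough for the two end steps to remain admissible. *)
pose e := Num.min d (Num.min (Num.min (x 1%N - th) (pi - (x 1%N - th)))
  (Num.min (th + w - x N.+1) (pi - (th + w - x N.+1)))).
exists e; split; first by rewrite !lt_min d0 g1 g3 !subr_gt0 g2 g4.
move=> t; rewrite !lt_min => /andP[td /andP[/andP[t1 t2] /andP[t3 t4]]].
pose y i := if i == 0%N then t else if i == n then t + w else x i.
have cy : config n w y.
  split; first by rewrite /y eqxx.
  move: t1 t2 t3 t4; rewrite !ltr_norml => /andP[? ?] /andP[? ?] /andP[? ?] /andP[? ?].
  move=> [|i] iN; rewrite /y /=.
    by apply/andP; split; lra.
  rewrite eqSS (ltn_eqF iN); have [->|iN'] := eqVneq i.+1 N.+1.
    by apply/andP; split; lra.
  by have [_] := xm.1; apply.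
have ay : action p n y - action p n x = psi t - psi th.
  have E z : action p n z = gen p (z 0%N) (z 1%N) +
      (\sum_(i < N) gen p (z i.+1) (z i.+2) + gen p (z N.+1) (z n)).
    rewrite /action big_ord_recl big_ord_recr /=; congr (_ + (_ + _)).
  rewrite !E /y !eqxx /psi x0 xn x0 /= (ltn_eqF (ltnSn _)).
  rewrite (eq_bigr (fun i : 'I_N => gen p (x i.+1) (x i.+2))); first by ring.
  by move=> i _; rewrite !eqSS !ltn_eqF// leqW.
have [z [z0 [_ zm] az]] := ex t.
have := zm y cy; rewrite {1}/y/= z0 => /(_ erefl); rewrite az => My.
have := Hd t td; rewrite ler_norml => /andP[_]; lra.
Qed.
End ClosingFlat.

(** * Uniform bounds in a family of tables *)

Section CompactUniform.
Context {R : realType}.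

(** A local radius on a compact set can be chosen uniformly, provided that the property
  persists for smaller radii. *)
Lemma compact_uniform (T : topologicalType) (K : set T) (Q : R -> T -> Prop) :
  compact K -> (forall d d' y, 0 < d' -> d' <= d -> Q d y -> Q d' y) ->
  (forall y, K y -> exists d, 0 < d /\ \forall y' \near y, Q d y') ->
  exists d, 0 < d /\ forall y, K y -> Q d y.
Proof.
move=> /compact_near_coveringP cK anti H.
have A : \forall d \near (0 : R)^'+, K `<=` Q d.
  apply: cK => y Ky; have [d [d0 Hd]] := H y Ky.
  have B : \forall e \near (0 : R)^'+, 0 < e <= d.
    near=> e; apply/andP; split; near: e; [exact: nbhs_right_gt|exact: nbhs_right_le].
  exists ([set y' | Q d y'], [set e | 0 < e <= d]) => //=.
  by move=> [y' e] /= [Qd /andP[e0 ed]]; apply: anti Qd.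
near (0 : R)^'+ => d.
exists d; split; first by near: d; exact: nbhs_right_gt.
by near: d.
Unshelve. all: by end_near.
Qed.
End CompactUniform.

Section Family.
Context {R : realType} (I : set R) (P DP : R -> R -> R).
Hypothesis sfP : forall eps, I eps -> support_fun (P eps) (DP eps).
Hypothesis (anP : analytic_fam I P) (anDP : analytic_fam I DP).
Implicit Types (eps d e t a b : R) (x y : nat -> R).

(** By periodicity in the angle a compact set of base points suffices. *)
Lemma family_bounds eps0 : I eps0 -> exists m M d, [/\ 0 < m, 0 < d &
  forall eps, I eps -> `|eps - eps0| <= d -> forall t,
    [/\ m <= P eps t, P eps t <= M & `|DP eps t| <= M] ].
Proof.
move=> I0.
pose Q d t := forall eps, I eps -> `|eps - eps0| <= d ->
    [/\ d <= P eps t, P eps t <= d^-1 & `|DP eps t| <= d^-1].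
have cK : compact [set` `[0 : R, 2 * pi]] by exact: segment_compact.
have [|t _|d [d0 Hd]] := compact_uniform (Q := Q) cK.
- move=> d d' t d'0 d'd H eps Ie ed; have [|H1 H2 H3] := H eps Ie.
    exact: le_trans ed d'd.
  have dd : d^-1 <= d'^-1 by rewrite lef_pV2 ?posrE// (lt_le_trans d'0).
  by split; [exact: le_trans H1|exact: le_trans dd|exact: le_trans dd].
- have p0 := sf_pos (sfP I0) t.
  have p20 : 0 < P eps0 t / 2 by rewrite divr_gt0.
  have [d1 [d10 H1]] := analytic_fam_continuous t anP I0 p20.
  have [d2 [d20 H2]] := analytic_fam_continuous t anDP I0 (ltr01 : 0 < 1 :> R).
  pose M := 2 * P eps0 t + `|DP eps0 t| + 1.
  have M0 : 0 < M by rewrite /M; have := normr_ge0 (DP eps0 t); lra.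
  pose d := Num.min (Num.min d1 d2) (Num.min (P eps0 t / 2) M^-1).
  have d0 : 0 < d by rewrite !lt_min d10 d20 p20 invr_gt0.
  exists d; split=> //; near=> t' => eps Ie ed.
  have [k1 k2 k3 k4] : [/\ d <= d1, d <= d2, d <= P eps0 t / 2 & d <= M^-1].
    by split; rewrite !ge_min lexx ?orbT.
  have td : `|t' - t| <= d.
    by rewrite distrC; near: t'; apply: cvgr_dist_le => //; exact: cvg_id.
  have {}H1 := H1 eps t' Ie (le_trans ed k1) (le_trans td k1).
  have {}H2 := H2 eps t' Ie (le_trans ed k2) (le_trans td k2).
  have Md : M <= d^-1 by rewrite -[M]invrK lef_pV2 ?posrE ?invr_gt0.
  move: H1; rewrite ltr_norml => /andP[? ?]; split; [lra|by rewrite /M in Md; have := normr_ge0 (DP eps0 t); lra|].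
  apply: le_trans Md; rewrite -[DP eps t'](subrK (DP eps0 t)).
  by apply: le_trans (ler_normD _ _) _; rewrite /M; lra.
exists d, d^-1, d; split=> // eps Ie ed t.
have sf := sfP Ie.
have [s [sI]] := periodic_reduce (f := fun t => P eps t) (sf_per sf) t.
have [s' [s'I]] := periodic_reduce (f := fun t => DP eps t) (dp_per sf) t.
have /= Hs := Hd s; rewrite in_itv/= in Hs.
have /= Hs' := Hd s'; rewrite in_itv/= in Hs'.
move=> <- <-; have [A1 A2 A3] := Hs sI eps Ie ed; have [B1 B2 B3] := Hs' s'I eps Ie ed.
by split.
Unshelve. all: by end_near.
Qed.

Lemma family_cvg (f : R -> R -> R) eps0 a0 (X : Type) (G : set_system X)
    (el al : X -> R) :
  analytic_fam I f -> I eps0 -> Filter G ->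
  (forall d, 0 < d -> \forall q \near G,
     [/\ I (el q), `|el q - eps0| <= d & `|al q - a0| <= d]) ->
  (fun q => f (el q) (al q)) @ G --> f eps0 a0.
Proof.
move=> anf I0 FG HG; apply/cvgrPdist_lt => e e0.
have [d [d0 Hd]] := analytic_fam_continuous a0 anf I0 e0.
apply: filterS (HG d d0) => q [Iq q1 q2].
by rewrite distrC; exact: Hd.
Qed.

(** Joint continuity includes the vanishing steps, where the formula has a vanishing
  denominator and [gen_small] takes over. *)
Lemma gen_continuous eps0 a0 b0 e : I eps0 -> 0 <= b0 - a0 < pi -> 0 < e ->
  exists d, 0 < d /\ forall eps a b, I eps -> `|eps - eps0| <= d ->
    `|a - a0| <= d -> `|b - b0| <= d -> 0 <= b - a < pi ->
    `|gen (P eps) a b - gen (P eps0) a0 b0| < e.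
Proof.
move=> I0 /andP[]; rewrite le_eqVlt => /predU1P[ab0 _|ab0 abpi] e0.
  have [m [M [d [m0 d0 bnd]]]] := family_bounds I0.
  have pi0 := pi_gt0 R.
  have M2 := sqr_ge0 M.
  pose d' := Num.min d (Num.min (pi / 8) (e / (4 * (M ^+ 2 + 1)) / 2)).
  have d'0 : 0 < d' by rewrite !lt_min d0 !divr_gt0 ?mulr_gt0//; lra.
  have [k1 k2 k3] : [/\ d' <= d, d' <= pi / 8 & d' <= e / (4 * (M ^+ 2 + 1)) / 2].
    by split; rewrite !ge_min lexx ?orbT.
  exists d'; split=> // eps a b Ie ed ad bd /andP[ab abpi].
  have E : b0 = a0 by lra.
  rewrite E gen_diag subr0.
  move: ad bd; rewrite E !ler_norml => /andP[? ?] /andP[? ?].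
  have B := bnd eps Ie (le_trans ed k1).
  apply: le_lt_trans (gen_small (sfP Ie) (M := M) _ _ _) _.
  - by move=> t; have [] := B t.
  - by move=> t; have [] := B t.
  - by apply/andP; split; lra.
  have : 2 * M ^+ 2 * (b - a) <= 2 * M ^+ 2 * (2 * d') by rewrite ler_wpM2l; lra.
  have : d' * (2 * (4 * (M ^+ 2 + 1))) <= e.
    by rewrite -ler_pdivlMr ?mulr_gt0//; [rewrite invfM mulrA mulrAC|lra].
  by have := mulr_gt0 d'0 (ltac:(lra) : 0 < M ^+ 2 + 1); lra.
pose G := within [set q : R * R * R | I q.1.1] (nbhs (eps0, a0, b0)).
pose H (q : R * R * R) := gen (P q.1.1) q.1.2 q.2.
have s0 : sin (b0 - a0) != 0 by rewrite gt_eqF// sin_pos// ab0.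
have near_box d : 0 < d -> \forall q \near G, I q.1.1 /\ `|q.1.1 - eps0| <= d /\
    `|q.1.2 - a0| <= d /\ `|q.2 - b0| <= d.
  move=> d0; rewrite /G near_withinE; near=> q => Iq; split=> //.
  rewrite (distrC q.1.1) (distrC q.1.2) (distrC q.2); split; [|split].
  - near: q; apply: (@cvgr_dist_le _ _ _ (nbhs (eps0, a0, b0)) _ (fun q : R * R * R => q.1.1)) => //.
    by apply: cvg_comp; [exact: cvg_fst|exact: cvg_fst].
  - near: q; apply: (@cvgr_dist_le _ _ _ (nbhs (eps0, a0, b0)) _ (fun q : R * R * R => q.1.2)) => //.
    by apply: cvg_comp; [exact: cvg_fst|exact: cvg_snd].
  - near: q; apply: (@cvgr_dist_le _ _ _ (nbhs (eps0, a0, b0)) _ (fun q : R * R * R => q.2)) => //.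
    exact: cvg_snd.
have FG : Filter G by exact: within_filter.
have cPa : (fun q => P q.1.1 q.1.2) @ G --> P eps0 a0.
  apply: (family_cvg (el := fun q : R * R * R => q.1.1)) => // d d0.
  by apply: filterS (near_box d d0) => q [? [? [? ?]]].
have cPb : (fun q => P q.1.1 q.2) @ G --> P eps0 b0.
  apply: (family_cvg (el := fun q : R * R * R => q.1.1)) => // d d0.
  by apply: filterS (near_box d d0) => q [? [? [? ?]]].
have cD : (fun q : R * R * R => q.2 - q.1.2) @ G --> b0 - a0.
  apply: cvgB; apply: cvg_within_filter; first exact: cvg_snd.
  by apply: cvg_comp; [exact: cvg_fst|exact: cvg_snd].
have ccos : (fun q : R * R * R => cos (q.2 - q.1.2)) @ G --> cos (b0 - a0).
  by apply: continuous_cvg => //; exact: continuous_cos.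
have csin : (fun q : R * R * R => sin (q.2 - q.1.2)) @ G --> sin (b0 - a0).
  by apply: continuous_cvg => //; exact: continuous_sin.
have cH : H @ G --> gen (P eps0) a0 b0.
  apply: cvgM; last exact: cvgV.
  apply: cvgB; first exact: cvgM.
  apply: cvgM; last exact: ccos.
  by apply: cvgM; [apply: cvgD; apply: cvgM|exact: cvg_cst].
have /cvgrPdist_lt/(_ e e0) := cH.
rewrite /G near_withinE => /nbhs_ballP[d /= d0 Hd].
exists (d / 2); split=> [|eps a b Ie ed ad bd _]; first by rewrite divr_gt0.
rewrite distrC; apply: (Hd (eps, a, b)) => //.
have dd t s : `|t - s| <= d / 2 -> ball s d t.
  by move=> ts; rewrite -ball_normE/= distrC (le_lt_trans ts)//; lra.
by split; [split|]; apply: dd.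
Unshelve. all: by end_near.
Qed.

Definition config_action eps th n y := action (P eps) n (fun i => th + y i).

Lemma action_continuous eps0 th0 n y0 e : I eps0 ->
  (forall i, (i < n)%N -> 0 <= y0 i.+1 - y0 i < pi) -> 0 < e ->
  exists d, 0 < d /\ forall eps th y, I eps -> `|eps - eps0| <= d ->
    `|th - th0| <= d -> (forall i, (i <= n)%N -> `|y i - y0 i| <= d) ->
    (forall i, (i < n)%N -> 0 <= y i.+1 - y i < pi) ->
    `|config_action eps th n y - config_action eps0 th0 n y0| < e.
Proof.
move=> I0; elim: n e => [|n IH] e gap e0.
  by exists 1; split=> // *; rewrite /config_action /action !big_ord0 subrr normr0.
have e20 : 0 < e / 2 by rewrite divr_gt0.
have [d1 [d10 H1]] := IH (e / 2) (fun i iN => gap i (leqW iN)) e20.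
have g0 : 0 <= th0 + y0 n.+1 - (th0 + y0 n) < pi.
  by rewrite (_ : _ - _ = y0 n.+1 - y0 n); [exact: gap|ring].
have [d2 [d20 H2]] := gen_continuous I0 g0 e20.
pose d := Num.min d1 (d2 / 2).
have [k1 k2] : d <= d1 /\ d <= d2 / 2 by split; rewrite ge_min lexx ?orbT.
exists d; split=> [|eps th y Ie ed td yd yg]; first by rewrite lt_min d10 divr_gt0.
rewrite /config_action /action !big_ord_recr/= opprD addrACA.
apply: le_lt_trans (ler_normD _ _) _; have -> : e = e / 2 + e / 2 by lra.
apply: ltrD.
  apply: H1 => //; [exact: le_trans k1|exact: le_trans k1| |].
    by move=> i iN; apply: le_trans (yd i (leqW iN)) k1.
  by move=> i iN; apply: yg; exact: leqW.
have sumd i : (i <= n.+1)%N -> `|th + y i - (th0 + y0 i)| <= d2.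
  move=> iN; rewrite opprD addrACA; apply: le_trans (ler_normD _ _) _.
  by have := yd i iN; lra.
apply: H2 => //; first by lra.
- by apply: sumd; exact: leqnSn.
- exact: sumd.
- by rewrite (_ : _ - _ = y n.+1 - y n); [exact: yg|ring].
Qed.
End Family.

(** * Minimal action in a family of tables *)

Section Minimizers.
Import ArrowAsProduct.
Context {R : realType} (I : set R) (P DP : R -> R -> R).
Hypothesis sfP : forall eps, I eps -> support_fun (P eps) (DP eps).
Hypothesis (anP : analytic_fam I P) (anDP : analytic_fam I DP).
Context (N : nat) (w : R) (w0 : 0 < w).
Local Notation n := N.+2.
Hypothesis wn : w < pi * n%:R.
Implicit Types (eps d e t a b : R) (x y : nat -> R).

(** Relative configurations with steps bounded away from [pi], as a compact subset of
  the space of sequences; entries beyond [n] are only required to be bounded. *)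
Definition Kset k := [set y : nat -> R | (forall i, 0 <= y i <= w) /\
  [/\ y 0%N = 0, y n = w & forall i, (i < n)%N -> 0 <= y i.+1 - y i <= pi - k]].

Lemma Kset_compact k : compact (Kset k).
Proof.
pose B := [set y : nat -> R | forall i, [set` `[0, w]] (y i)].
have cB : compact B.
  by apply: (@tychonoff _ (fun=> R) (fun=> [set` `[0, w]])) => i; exact: segment_compact.
have pc i : continuous (fun y : nat -> R => y i) by move=> y; exact: proj_cont.
have cl (f : (nat -> R) -> R) a b : continuous f -> closed [set y | a <= f y <= b].
  move=> cf; rewrite (_ : [set y | _] = f @^-1` [set` `[a, b]]).
    apply: (@preimage_closed _ _ f [set` `[a, b]]) => [y _|]; first exact: cf.
    exact: interval_closed.
  by apply/funext => y; rewrite /preimage/= in_itv.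
rewrite (_ : Kset k = B `&` ([set y | 0 <= y 0%N <= 0] `&` ([set y | w <= y n <= w] `&`
  (\bigcap_(i in [set i | (i < n)%N]) [set y | 0 <= y i.+1 - y i <= pi - k])))).
  apply: compact_closedI => //; apply: closedI; first exact: (cl (fun y => y 0%N)).
  apply: closedI; first exact: (cl (fun y => y n)).
  apply: closed_bigI => i _; apply: (cl (fun y => y i.+1 - y i)).
  by move=> y; exact: (cvgB (pc i.+1 y) (pc i y)).
apply/seteqP; split => y /=.
  move=> [y1 [y2 y3 y4]]; split; first by move=> i /=; rewrite in_itv/= y1.
  by split; [rewrite /= y2 lexx|split; [rewrite /= y3 lexx|exact: y4]].
move=> [yB [/= /le_anti y2 [/le_anti y3 y4]]]; split.
  by move=> i; have := yB i; rewrite /= in_itv.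
by split.
Qed.

(** The entries beyond [n] are set to zero to land in the compact set [Kset]. *)
Definition rel x : nat -> R := fun i => if (i <= n)%N then x i - x 0%N else 0.

(** Admissible because [w < pi * n]; its action bounds the minimal action from above. *)
Definition unif (th : R) : nat -> R := fun i => th + w / n%:R * i%:R.

Lemma n_gt0 : 0 < n%:R :> R. Proof. by rewrite ltr0n. Qed.

Lemma unif_config th : config n w (unif th).
Proof.
have n0 := n_gt0; split=> [|i _]; first by rewrite /unif mulr0 addr0 divfK// gt_eqF.
rewrite /unif -(natr1 i) (_ : _ - _ = w / n%:R); last by ring.
by rewrite divr_ge0 ?(ltW w0)// ltr_pdivrMr.
Qed.

Lemma config_mono x : config n w x -> forall i j, (i <= j)%N -> (j <= n)%N -> x i <= x j.
Proof.
move=> [_ gap] i; elim=> [|j IH]; first by rewrite leqn0 => /eqP->.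
rewrite leq_eqVlt => /predU1P[->//|ij] jn.
apply: le_trans (IH ij (ltnW jn)) _.
by have /andP[+ _] := gap j jn; rewrite subr_ge0.
Qed.

Lemma rel_action eps x : config_action P eps (x 0%N) n (rel x) = action (P eps) n x.
Proof.
apply: eq_bigr => i _; rewrite /rel (ltnW (ltn_ord i)) ltn_ord.
by rewrite !subrKC.
Qed.

Lemma rel_Kset k x : config n w x ->
  (forall i, (i < n)%N -> x i.+1 - x i <= pi - k) -> Kset k (rel x).
Proof.
move=> cx gk; have [xn gap] := cx; have mono := config_mono cx; split.
  move=> i; rewrite /rel; case: ifPn => iN; last by rewrite lexx ltW.
  by rewrite subr_ge0 mono//= lerBlDl -xn mono.
split; rewrite /rel ?leqnn//= ?subrr//; first by rewrite xn addrAC subrr add0r.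
move=> i iN; rewrite iN (ltnW iN) (_ : _ - _ - _ = x i.+1 - x i); last by ring.
by have /andP[-> _] := gap i iN; rewrite gk.
Qed.

Lemma Kset_config k th y : 0 < k -> Kset k y -> config n w (fun i => th + y i).
Proof.
move=> k0 [_ [y0 yn yg]]; split; first by rewrite y0 yn addr0.
move=> i iN; rewrite (_ : _ - _ = y i.+1 - y i); last by ring.
by have /andP[-> ?] := yg i iN; rewrite /=; lra.
Qed.

(** Low-action configurations have steps bounded away from [pi], uniformly in
  the parameter, because the generating function blows up there. *)
Lemma low_action_Kset eps0 : I eps0 -> exists k d, [/\ 0 < k, 0 < d &
  forall eps, I eps -> `|eps - eps0| <= d -> forall x, config n w x ->
    action (P eps) n x <= action (P eps) n (unif (x 0%N)) ->
    Kset k (rel x) /\ Kset k (rel (unif (x 0%N)))].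
Proof.
move=> I0; have [m [M [d [m0 d0 bnd]]]] := family_bounds sfP anP anDP I0.
have n0 := n_gt0; have pi0 := pi_gt0 R.
pose s := w / n%:R.
have s0 : 0 < s by rewrite divr_gt0.
have spi : s < pi by rewrite ltr_pdivrMr.
have sins : 0 < sin s by apply: sin_pos; rewrite s0.
pose C := n%:R * (2 * M ^+ 2 / sin s) + n%:R * (2 * M ^+ 2 * pi).
have M2 := sqr_ge0 M.
have C0 : 0 <= C.
  have A : 0 <= 2 * M ^+ 2 by lra.
  have A1 := mulr_ge0 (ltW n0) (mulr_ge0 A (ltW pi0)).
  have A2 : 0 <= (sin s)^-1 by rewrite invr_ge0 ltW.
  by have := mulr_ge0 (ltW n0) (mulr_ge0 A A2); rewrite /C; lra.
have m2 : 0 < m ^+ 2 by rewrite exprn_gt0.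
pose k := Num.min (Num.min (pi / 2) (pi - s)) (m ^+ 2 / (C + 1)).
have k0 : 0 < k by rewrite !lt_min subr_gt0 spi !divr_gt0//; lra.
have [k1 k2 k3] : [/\ k <= pi / 2, k <= pi - s & k <= m ^+ 2 / (C + 1)].
  by split; rewrite !ge_min lexx ?orbT.
exists k, d; split=> // eps Ie ed x cx ax; have B := bnd eps Ie ed.
have sf := sfP Ie.
have pM t : P eps t <= M by have [] := B t.
have pm t : m <= P eps t by have [] := B t.
have dpM t : `|DP eps t| <= M by have [] := B t.
split; last first.
  apply: rel_Kset; first exact: unif_config.
  move=> i _; rewrite /unif -(natr1 i) (_ : _ - _ = s); last by rewrite /s; ring.
  by lra.
apply: rel_Kset => // i iN; rewrite leNgt; apply/negP => gi.
have [_ gap] := cx; have /andP[gi0 gipi] := gap i iN.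
have A1 : action (P eps) n (unif (x 0%N)) <= n%:R * (2 * M ^+ 2 / sin s).
  rewrite mulr_natl -[n in X in _ <= X]card_ord -sumr_const; apply: ler_sum => j _.
  rewrite /gen /unif -[j.+1%:R]natr1.
  rewrite (_ : x 0%N + s * (j%:R + 1) - (x 0%N + s * j%:R) = s); last by ring.
  rewrite ler_pM2r ?invr_gt0//.
  set u := P eps _; set v := P eps (_ + _ * (_ + _)).
  have u0 : 0 < u by exact: (sf_pos sf). have v0 : 0 < v by exact: (sf_pos sf).
  have uM : u <= M by exact: pM. have vM : v <= M by exact: pM.
  have uu : u ^+ 2 <= M ^+ 2 by rewrite lerXn2r ?nnegrE//; lra.
  have vv : v ^+ 2 <= M ^+ 2 by rewrite lerXn2r ?nnegrE//; lra.
  have uv : u * v <= M ^+ 2 by rewrite expr2 ler_pM// ltW.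
  have := cos_geN1 s; have := sqr_ge0 u; have := sqr_ge0 v => H1 H2 H3.
  have : - ((u ^+ 2 + v ^+ 2) / 2 * cos s) <= (u ^+ 2 + v ^+ 2) / 2.
    by rewrite -mulrN -[leRHS]mulr1 ler_wpM2l//; lra.
  by lra.
have A2 : gen (P eps) (x i) (x i.+1) - n%:R * (2 * M ^+ 2 * pi) <= action (P eps) n x.
  have G j : (j < n)%N -> - (2 * M ^+ 2 * pi) <= gen (P eps) (x j) (x j.+1).
    by move=> jn; apply: (gen_lower sf) => //; exact: gap.
  have c0 : 0 <= 2 * M ^+ 2 * pi by rewrite mulr_ge0 ?(ltW pi0)//; lra.
  move: c0 G; set c := 2 * M ^+ 2 * pi => c0 G.
  rewrite /action (bigD1 (Ordinal iN))//= lerD2l.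
  apply: (@le_trans _ _ (\sum_(j < n | j != Ordinal iN) - c)).
    rewrite sumr_const mulNrn lerN2 -[c *+ _]mulr_natl ler_wpM2r//.
    by rewrite ler_nat (leq_trans (max_card _))// card_ord.
  by apply: ler_sum => j _; exact: G.
have A3 := gen_blowup m0 pm (ltac:(apply/andP; split; lra) : pi / 2 <= x i.+1 - x i < pi).
have hC : gen (P eps) (x i) (x i.+1) <= C by rewrite /C; lra.
have g0 : 0 < pi - (x i.+1 - x i) by lra.
have : gen (P eps) (x i) (x i.+1) * (pi - (x i.+1 - x i)) <= C * (pi - (x i.+1 - x i)).
  by rewrite ler_pM2r.
have : C * (pi - (x i.+1 - x i)) <= C * k by rewrite ler_wpM2l//; lra.
have : k * (C + 1) <= m ^+ 2 by rewrite -ler_pdivlMr//; lra.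
by lra.
Qed.

Lemma near_coords (y0 : nat -> R) d k : 0 < d ->
  \forall y \near y0, forall i, (i <= k)%N -> `|y i - y0 i| <= d.
Proof.
move=> d0; elim: k => [|k IH].
  near=> y => i; rewrite leqn0 => /eqP->; rewrite distrC.
  by near: y; apply: cvgr_dist_le => //; exact: proj_cont.
near=> y => i; rewrite leq_eqVlt => /predU1P[->|].
  by rewrite distrC; near: y; apply: cvgr_dist_le => //; exact: proj_cont.
by rewrite ltnS => ik; move: i ik; near: y.
Unshelve. all: by end_near.
Qed.

(** The competitor [unif] restricts the search to a compact set. *)
Lemma exists_min eps th : I eps -> exists x, x 0%N = th /\ is_min (P eps) n w x.
Proof.
move=> Ie; have [k [d [k0 d0 H]]] := low_action_Kset Ie.
have {}H := H eps Ie; rewrite subrr normr0 in H; have {}H := H (ltW d0).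
have u0 : unif th 0%N = th by rewrite /unif mulr0 addr0.
have [|_ Ku] := H _ (unif_config th); first by rewrite u0.
rewrite u0 in Ku.
have cf : {within Kset k, continuous (config_action P eps th n)}.
  apply/subspace_continuousP => y0 K0; apply/cvgrPdist_lt => e e0.
  have gap0 i : (i < n)%N -> 0 <= y0 i.+1 - y0 i < pi.
    by move=> iN; have [_ [_ _ /(_ i iN) /andP[-> ?]]] := K0; rewrite /=; lra.
  have [d' [d'0 Hd]] := action_continuous sfP anP anDP th Ie gap0 e0.
  rewrite near_withinE; near=> y => Ky; rewrite distrC; apply: Hd => //.
  - by rewrite subrr normr0 ltW.
  - by rewrite subrr normr0 ltW.
  - by near: y; exact: near_coords.
  - by move=> i iN; have [_ [_ _ /(_ i iN) /andP[-> ?]]] := Ky; rewrite /=; lra.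
have [y Ky ymin] : exists2 y, Kset k y & forall z, Kset k z ->
    config_action P eps th n y <= config_action P eps th n z.
  have [||y Ky ymin] := compact_EVT_min (f := config_action P eps th n) (A := Kset k) _ _ cf.
  - by exists (rel (unif th)).
  - exact: Kset_compact.
  by exists y; [exact: set_mem|move=> z Kz; apply: ymin; exact: mem_set].
have Hu : config_action P eps th n (rel (unif th)) = action (P eps) n (unif th).
  by rewrite -rel_action u0.
exists (fun i => th + y i); have [_ [y0 _ _]] := Ky; split; first by rewrite y0 addr0.
split; first exact: Kset_config Ky.
move=> z cz; rewrite y0 addr0 => z0.
have [zu|uz] := lerP (action (P eps) n z) (action (P eps) n (unif th)).
  have [|Kz _] := H z cz; first by rewrite z0.
  by rewrite -(rel_action eps z) z0; exact: ymin.
apply: le_trans (ltW uz); rewrite -Hu; exact: ymin.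
Unshelve. all: by end_near.
Qed.

Lemma min_Kset eps0 : I eps0 -> exists k d, [/\ 0 < k, 0 < d &
  forall eps, I eps -> `|eps - eps0| <= d -> forall x, is_min (P eps) n w x ->
    Kset k (rel x)].
Proof.
move=> I0; have [k [d [k0 d0 H]]] := low_action_Kset I0.
exists k, d; split=> // eps Ie ed x [cx xm].
have A : action (P eps) n x <= action (P eps) n (unif (x 0%N)).
  by apply: xm; [exact: unif_config|rewrite /unif mulr0 addr0].
by have [] := H eps Ie ed x cx A.
Qed.

(** The minimal action with given base point, as a function of the parameter and of
  the base point. *)
Definition value eps th : R :=
  if pselect (I eps) is left Ie then action (P eps) n (projT1 (cid (exists_min th Ie))) else 0.

Lemma valueP eps th : I eps -> exists x,
  [/\ x 0%N = th, is_min (P eps) n w x & action (P eps) n x = value eps th].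
Proof.
move=> Ie; rewrite /value; case: pselect => // Ie'.
by case: cid => x /= [x0 xm]; exists x.
Qed.

Lemma value_le eps x : I eps -> config n w x -> value eps (x 0%N) <= action (P eps) n x.
Proof.
by move=> Ie cx; have [y [y0 [cy ym] <-]] := valueP (x 0%N) Ie; exact: ym.
Qed.

(** Minima of a jointly continuous function over a fixed compact set are continuous. *)
Lemma value_continuous eps0 th0 e : I eps0 -> 0 < e -> exists d, 0 < d /\
  forall eps th, I eps -> `|eps - eps0| <= d -> `|th - th0| <= d ->
    `|value eps th - value eps0 th0| < e.
Proof.
move=> I0 e0; have [k [d1 [k0 d10 HK]]] := min_Kset I0.
have Kgap y : Kset k y -> forall i, (i < n)%N -> 0 <= y i.+1 - y i < pi.
  by move=> [_ [_ _ yg]] i iN; have /andP[-> ?] := yg i iN; rewrite /=; lra.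
pose Q d y := forall eps th, I eps -> `|eps - eps0| <= d -> `|th - th0| <= d ->
  Kset k y -> value eps0 th0 - e < config_action P eps th n y.
have [|y0 K0|d2 [d20 H2]] := compact_uniform (Q := Q) (@Kset_compact k).
- move=> d d' y d'0 dd H eps th Ie ed td; apply: H => //; exact: le_trans dd.
- have [d [d0 Hd]] := action_continuous sfP anP anDP th0 I0 (Kgap y0 K0) e0.
  exists d; split=> //; near=> y => eps th Ie ed td Ky.
  have : `|config_action P eps th n y - config_action P eps0 th0 n y0| < e.
    by apply: Hd => //; [near: y; exact: near_coords|exact: Kgap].
  rewrite ltr_norml => /andP[+ _].
  have := value_le I0 (Kset_config th0 k0 K0).
  have -> : th0 + y0 0%N = th0 by have [_ [-> _ _]] := K0; rewrite addr0.
  rewrite /config_action; lra.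
have [x0 [x00 x0m x0a]] := valueP th0 I0.
have K0 : Kset k (rel x0) by apply: (HK eps0) => //; rewrite subrr normr0 ltW.
have [d3 [d30 H3]] := action_continuous sfP anP anDP th0 I0 (Kgap _ K0) e0.
pose d := Num.min d1 (Num.min d2 d3).
have [k1 k2 k3] : [/\ d <= d1, d <= d2 & d <= d3].
  by split; rewrite !ge_min lexx ?orbT.
exists d; split; first by rewrite !lt_min d10 d20.
move=> eps th Ie ed td; have [x [xth xm xa]] := valueP th Ie.
have Kx := HK eps Ie (le_trans ed k1) x xm.
rewrite ltr_norml; apply/andP; split.
  have := H2 _ Kx eps th Ie (le_trans ed k2) (le_trans td k2) Kx.
  by rewrite -xth rel_action xa xth; lra.
have := H3 eps th (rel x0) Ie (le_trans ed k3) (le_trans td k3) _ (Kgap _ K0).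
have {1}-> : config_action P eps0 th0 n (rel x0) = value eps0 th0.
  by rewrite -x00 rel_action x0a x00.
move=> /(_ _); rewrite ltr_norml => H4.
have /andP[_] := H4 (fun i _ => ltac:(by rewrite subrr normr0 ltW)).
have := value_le Ie (Kset_config th k0 K0).
have -> : th + rel x0 0%N = th by rewrite /rel/= subrr addr0.
by rewrite /config_action; lra.
Unshelve. all: by end_near.
Qed.

Definition flat_at eps := exists c, flat (P eps) N w c.

Lemma flat_value eps : I eps -> flat_at eps <-> forall s t, value eps s = value eps t.
Proof.
move=> Ie; split=> [[c [ex le]] s t|H].
  suff K r : value eps r = c by rewrite !K.
  have [x [x0 cx ax]] := ex r; have [y [y0 [cy ym] ay]] := valueP r Ie.
  apply: le_anti; rewrite -ay {2}ay -{1}ax ym ?x0//=.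
  by rewrite -ay; exact: le.
exists (value eps 0); split=> [t|x cx].
  by have [x [x0 [cx _] ax]] := valueP t Ie; exists x; split=> //; rewrite ax; exact: H.
by rewrite (H 0 (x 0%N)); exact: value_le.
Qed.

(** Flatness is an equation for the minimal action, which is continuous. *)
Lemma flat_closed eps0 : I eps0 ->
  (forall d, 0 < d -> exists eps, [/\ I eps, `|eps - eps0| <= d & flat_at eps]) ->
  flat_at eps0.
Proof.
move=> I0 H; apply/flat_value => // s t; apply/eqP; rewrite -subr_eq0 -normr_le0.
apply/ler_addgt0Pr => e e0; rewrite add0r.
have e20 : 0 < e / 2 by rewrite divr_gt0.
have [d1 [d10 H1]] := value_continuous s I0 e20.
have [d2 [d20 H2]] := value_continuous t I0 e20.
have [|eps [Ie ed /(flat_value Ie) fl]] := H (Num.min d1 d2); first by rewrite lt_min d10.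
have [k1 k2] : Num.min d1 d2 <= d1 /\ Num.min d1 d2 <= d2.
  by split; rewrite ge_min lexx ?orbT.
have := H1 eps s Ie (le_trans ed k1) _; rewrite subrr normr0 => /(_ (ltW d10)).
have := H2 eps t Ie (le_trans ed k2) _; rewrite subrr normr0 => /(_ (ltW d20)).
rewrite (fl s t) !ltr_norml => /andP[? ?] /andP[? ?].
by rewrite ler_norml; apply/andP; split; lra.
Qed.

(** Minimizers depend continuously on the parameters wherever they are unique. *)
Lemma min_close eps0 th0 x0 rho : I eps0 -> 0 < rho ->
  is_min (P eps0) n w x0 -> x0 0%N = th0 ->
  (forall x, is_min (P eps0) n w x -> x 0%N = th0 -> forall i, (i <= n)%N -> x i = x0 i) ->
  exists d, 0 < d /\ forall eps th x, I eps -> `|eps - eps0| <= d -> `|th - th0| <= d ->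
    is_min (P eps) n w x -> x 0%N = th -> forall i, (i <= n)%N -> `|x i - x0 i| <= rho.
Proof.
move=> I0 rho0 x0m x00 uniq; have [k [d1 [k0 d10 HK]]] := min_Kset I0.
have Kgap y : Kset k y -> forall i, (i < n)%N -> 0 <= y i.+1 - y i < pi.
  by move=> [_ [_ _ yg]] i iN; have /andP[-> ?] := yg i iN; rewrite /=; lra.
have K0 : Kset k (rel x0) by apply: (HK eps0) => //; rewrite subrr normr0 ltW.
pose Q d y := forall eps th, I eps -> `|eps - eps0| <= d -> `|th - th0| <= d ->
  Kset k y -> config_action P eps th n y <= config_action P eps th n (rel x0) ->
  forall i, (i <= n)%N -> `|y i - rel x0 i| <= rho / 2.
have rho40 : 0 < rho / 4 by rewrite divr_gt0.
have [|y0 Ky0|d2 [d20 H2]] := compact_uniform (Q := Q) (@Kset_compact k).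
- move=> d d' y d'0 dd H eps th Ie ed td; apply: H => //; exact: le_trans dd.
- have [E|nE] := pselect (forall i, (i <= n)%N -> y0 i = rel x0 i).
    exists 1; split=> //; near=> y => eps th _ _ _ _ _ i iN.
    rewrite -E//; have : forall i, (i <= n)%N -> `|y i - y0 i| <= rho / 4.
      by near: y; exact: near_coords.
    by move=> /(_ i iN); lra.
  have lt0 : config_action P eps0 th0 n (rel x0) < config_action P eps0 th0 n y0.
    have y00 : th0 + y0 0%N = th0 by have [_ [-> _ _]] := Ky0; rewrite addr0.
    rewrite ltNge; apply/negP => le0; apply: nE => i iN.
    have cy := Kset_config th0 k0 Ky0.
    have ym : is_min (P eps0) n w (fun i => th0 + y0 i).
      split=> // z cz; rewrite y00 => z0; apply: le_trans le0 _.
      by rewrite -x00 rel_action; apply: (proj2 x0m); rewrite ?x00.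
    have := uniq _ ym y00 i iN; rewrite /rel iN x00 => <-; ring.
  pose e := (config_action P eps0 th0 n y0 - config_action P eps0 th0 n (rel x0)) / 2.
  have e0 : 0 < e by rewrite divr_gt0// subr_gt0.
  have [d3 [d30 H3]] := action_continuous sfP anP anDP th0 I0 (Kgap _ Ky0) e0.
  have [d4 [d40 H4]] := action_continuous sfP anP anDP th0 I0 (Kgap _ K0) e0.
  pose d := Num.min d3 d4; have [k1 k2] : d <= d3 /\ d <= d4.
    by split; rewrite ge_min lexx ?orbT.
  exists d; split; first by rewrite lt_min d30.
  near=> y => eps th Ie ed td Ky le_y.
  have A : `|config_action P eps th n y - config_action P eps0 th0 n y0| < e.
    apply: H3 => //; [exact: le_trans k1|exact: le_trans k1| |exact: Kgap].
    by near: y; exact: near_coords.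
  have B : `|config_action P eps th n (rel x0) - config_action P eps0 th0 n (rel x0)| < e.
    apply: H4 => //; [exact: le_trans k2|exact: le_trans k2| |exact: Kgap].
    by move=> i _; rewrite subrr normr0 ltW.
  by move: A B; rewrite !ltr_norml /e => /andP[? ?] /andP[? ?]; exfalso; lra.
pose d := Num.min d1 (Num.min d2 (rho / 2)).
have [k1 k2 k3] : [/\ d <= d1, d <= d2 & d <= rho / 2].
  by split; rewrite !ge_min lexx ?orbT.
exists d; split; first by rewrite !lt_min d10 d20 divr_gt0.
move=> eps th x Ie ed td xm xth i iN.
have Kx := HK eps Ie (le_trans ed k1) x xm.
have A : config_action P eps th n (rel x) <= config_action P eps th n (rel x0).
  rewrite -{1}xth rel_action; apply: (proj2 xm); first exact: Kset_config K0.
  by rewrite /rel/= subrr addr0.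
have := H2 _ Kx eps th Ie (le_trans ed k2) (le_trans td k2) Kx A i iN.
rewrite /rel iN xth x00 => H.
rewrite (_ : x i - x0 i = (x i - th - (x0 i - th0)) + (th - th0)); last by ring.
by apply: le_trans (ler_normD _ _) _; lra.
Unshelve. all: by end_near.
Qed.
End Minimizers.

(** * Analytic dependence of nondegenerate solutions *)

Section AnalyticSolutions.
Context {R : realType} (X : set R) (X0 : X 0) (N : nat).
Local Notation NN := N.+3.
Implicit Types (r rho d x tau : R) (E : nat -> R -> (nat -> R) -> R) (l : nat -> nat -> R).

Lemma functional_sum k E l : (forall i, (i < k)%N -> analytic_functional X NN (E i) (l i)) ->
  analytic_functional X NN (fun x a => \sum_(i < k) E i x a) (fun j => \sum_(i < k) l i j).
Proof.
elim: k => [|k IH] H.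
  have := @functional_cst R X NN 0; rewrite (_ : (fun j => _) = (fun=> 0)); last first.
    by apply/funext => j; rewrite big_ord0.
  by apply: (functional_ext X0) => x a _; rewrite big_ord0.
rewrite (_ : (fun j => _) = (fun j => \sum_(i < k) l i j + l k j)); last first.
  by apply/funext => j; rewrite big_ord_recr.
apply: (functional_ext X0 _ (functional_add (IH (fun i ik => H i (leqW ik))) (H k (ltnSn k)))) => x a _.
by rewrite big_ord_recr.
Qed.

Lemma lin_ends (c v : nat -> R) : lin NN c v = c 0%N * v 0%N +
  (\sum_(i < N.+1) c i.+1 * v i.+1 + c N.+2 * v N.+2).
Proof. by rewrite /lin big_ord_recl big_ord_recr /=; congr (_ + (_ + _)). Qed.

(** The equations, linearized in the inner unknowns with fixed ends, have only the
  trivial solution. *)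
Definition regular_system l := forall v : nat -> R, v 0%N = 0 -> v N.+2 = 0 ->
  (forall i, (i < N.+1)%N -> lin NN (l i) v = 0) ->
  forall j, (j < N.+1)%N -> v j.+1 = 0.

(** Newton's map: solutions of [E] are fixed points, and its linear part only
  involves the two end coordinates. *)
Lemma newton_map E l : (forall i, (i < N.+1)%N -> analytic_functional X NN (E i) (l i)) ->
  regular_system l -> exists Phi m,
    [/\ forall k, (k < N.+1)%N -> analytic_functional X NN (Phi k) (m k),
        forall k j, (k < N.+1)%N -> (j < N.+1)%N -> m k j.+1 = 0 &
        forall x a, (forall i, (i < N.+1)%N -> E i x a = 0) ->
          forall k, (k < N.+1)%N -> Phi k x a = a k.+1].
Proof.
move=> gE nd.
(* The Jacobian in the inner unknowns, transposed so as to act on row vectors. *)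
pose A := \matrix_(j < N.+1, i < N.+1) l i j.+1.
have uA : A \in unitmx.
  rewrite -row_free_unit -kermx_eq0; apply/eqP/row_matrixP => i; rewrite row0.
  set v := row i _; have vA : v *m A = 0 by rewrite -row_mul mulmx_ker row0.
  pose xi (j : nat) : R := if j is j'.+1 then (if (j' < N.+1)%N then v 0 (inord j') else 0) else 0.
  have := nd xi erefl _ _; rewrite /xi ltnn => /(_ erefl) H.
  apply/rowP => j; rewrite [RHS]mxE; have := H _ j (ltn_ord j).
  rewrite /= ltn_ord inord_val; apply => k kN.
  have := congr1 (fun B : 'rV_N.+1 => B 0 (Ordinal kN)) vA; rewrite !mxE => vk.
  rewrite lin_ends mulr0 add0r ltnn mulr0 addr0 -[RHS]vk.
  by apply: eq_bigr => j' _; rewrite !mxE ltn_ord inord_val mulrC.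
pose L := invmx A.
have AL j k : \sum_i A j i * L i k = (j == k)%:R.
  by have := congr1 (fun B : 'M[R]_N.+1 => B j k) (mulmxV uA); rewrite !mxE.
pose Phi k x (a : nat -> R) := a k.+1 - \sum_(i < N.+1) L (inord i) (inord k) * E i x a.
pose m k j := (j == k.+1)%:R + -1 * \sum_(i < N.+1) L (inord i) (inord k) * l i j.
exists Phi, m; split.
- move=> k kN; have kNN : (k.+1 < NN)%N by rewrite ltnS leqW.
  have gs : analytic_functional X NN (fun x a => \sum_(i < N.+1) L (inord i) (inord k) * E i x a)
      (fun j => \sum_(i < N.+1) L (inord i) (inord k) * l i j).
    apply: (@functional_sum N.+1 (fun i x a => L (inord i) (inord k) * E i x a)
      (fun i j => L (inord i) (inord k) * l i j)) => i iN.
    exact: functional_scale (gE i iN).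
  have := functional_add (functional_coord X 0 kNN) (functional_opp X0 gs).
  by apply: (functional_ext X0) => x a _; rewrite add0r.
- move=> k j kN jN; rewrite /m eqSS -(AL (Ordinal jN) (Ordinal kN)).
  rewrite mulN1r; apply/eqP; rewrite subr_eq0; apply/eqP; apply: eq_bigr => i _.
  rewrite mxE /= inord_val mulrC; congr (L _ _ * _).
  by apply: val_inj; rewrite /= inordK.
- move=> x a Ea k kN; rewrite /Phi big1 ?subr0// => i _.
  by rewrite Ea ?mulr0.
Qed.

Lemma functional_uniform K (Phi : nat -> R -> (nat -> R) -> R) m :
  (forall k, (k < K)%N -> analytic_functional X NN (Phi k) (m k)) -> exists C rho0,
    [/\ 1 <= C, 0 < rho0, rho0 <= 1 &
      forall k, (k < K)%N -> strictly_diff X NN (Phi k) (m k) C rho0].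
Proof.
elim: K => [|K IH] H; first by exists 1, 1.
have [C [p [C1 p0 p1 Hp]]] := IH (fun k kK => H k (leqW kK)).
have [C' [p' [C1' p0' p1' Hp']]] := H K (ltnSn K).
exists (C + C'), (Num.min p p'); split; [lra|by rewrite lt_min p0|by rewrite ge_min p1|].
move=> k; rewrite ltnS leq_eqVlt => /predU1P[->|kK].
  by apply: strictly_diff_le Hp'; [lra|rewrite ge_min lexx orbT].
by apply: strictly_diff_le (Hp k kK); [lra|rewrite ge_min lexx].
Qed.

(** Both end unknowns are equal to [tau], being the displacement of one and the same base
  point; the unknowns of index larger than [N.+2] are set to zero. *)
Definition ends tau : nat -> R := fun i => if (i == 0%N) || (i == N.+2) then tau else 0.

Lemma ends0 tau : ends tau 0%N = tau. Proof. by []. Qed.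

Lemma endsn tau : ends tau N.+2 = tau. Proof. by rewrite /ends eqxx orbT. Qed.

Fixpoint newton_iter (Phi : nat -> R -> (nat -> R) -> R) tau (k : nat) : nat -> R -> R :=
  if k is k'.+1 then fun i x =>
    if i is j.+1 then
      if (j < N.+1)%N then Phi j x ((newton_iter Phi tau k')^~ x) else ends tau i
    else ends tau i
  else fun i _ => ends tau i.

Lemma newton_iter_end Phi tau k i x : (i == 0%N) || (N.+1 < i)%N ->
  newton_iter Phi tau k i x = ends tau i.
Proof. by case: k => [//|k]; case: i => [//|i] /= H; rewrite ltnS leqNgt -ltnS H. Qed.

Lemma ps_ball_cst_le r M k : 0 < r -> `|k| <= M -> ps_ball X r M (fun=> k).
Proof. by move=> r0 kM; apply: ps_ball_le kM _; exact: ps_ball_cst. Qed.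

(** A solution of a nondegenerate analytic system depends analytically on the
  parameter, since it is the pointwise limit of Newton iterates that stay in a
  fixed ball of power series; hence an analytic function of it that vanishes on
  a set of parameters accumulating at the base point vanishes nearby, on a disc
  that does not depend on the end coordinate [tau]. *)
Lemma solution_identity E l F lF :
  (forall i, (i < N.+1)%N -> analytic_functional X NN (E i) (l i)) ->
  (forall i, (i < N.+1)%N -> E i 0 (fun=> 0) = 0) -> regular_system l ->
  analytic_functional X NN F lF -> F 0 (fun=> 0) = 0 ->
  exists rho, 0 < rho /\ forall r0, 0 < r0 -> exists r delta,
    [/\ 0 < r, r <= r0, 0 < delta & forall tau, `|tau| <= delta ->
      forall alpha : R -> nat -> R,
      (forall x, X x -> `|x| <= r / 2 ->
        [/\ alpha x 0%N = tau, alpha x N.+2 = tau,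
            forall i, (N.+2 < i)%N -> alpha x i = 0,
            forall i, `|alpha x i| <= rho
          & forall i, (i < N.+1)%N -> E i x (alpha x) = 0]) ->
      (forall d, 0 < d -> exists x, [/\ X x, x != 0, `|x| < d
          & `|x| <= r / 2 -> F x (alpha x) = 0]) ->
      forall x, X x -> `|x| <= r / 2 -> F x (alpha x) = 0].
Proof.
move=> gE E0 nd gF F0.
have [Phi [m [gPhi m0 fixPhi]]] := newton_map gE nd.
have [C [p [C1 p0 p1 HC]]] := functional_uniform gPhi.
have [CF [pF [CF1 pF0 pF1 _ HF]]] := functional_lip gF.
pose Lam := 1 + \sum_(k < N.+1) (`|m k 0%N| + `|m k N.+2|).
have Lam1 k : (k < N.+1)%N -> `|m k 0%N| + `|m k N.+2| <= Lam.
  move=> kN; rewrite /Lam (bigD1 (Ordinal kN))//=.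
  have : 0 <= \sum_(i < N.+1 | i != Ordinal kN) (`|m i 0%N| + `|m i N.+2|).
    by apply: sumr_ge0 => i _; rewrite addr_ge0.
  by lra.
have Lam0 : 1 <= Lam.
  by rewrite /Lam lerDl sumr_ge0// => i _; rewrite addr_ge0.
(* The remainder, the end unknowns and the parameter will each contribute at most [rho / 3]
  to the size of an iterate. *)
pose rho := Num.min (Num.min p pF) (3 * C)^-1.
have rho0 : 0 < rho by rewrite !lt_min p0 pF0 invr_gt0 mulr_gt0//; lra.
have [k1 k2 k3] : [/\ rho <= p, rho <= pF & rho <= (3 * C)^-1].
  by split; rewrite !ge_min lexx ?orbT.
have Crho : C * rho <= 1 / 3.
  have : rho * (3 * C) <= 1 by rewrite -ler_pdivlMr ?mul1r// mulr_gt0//; lra.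
  by lra.
clearbody rho; exists rho; split=> // r0 r00.
pose r := Num.min r0 (Num.min rho (rho / (3 * C))).
have r_gt0 : 0 < r by rewrite !lt_min r00 rho0 divr_gt0// mulr_gt0//; lra.
have [k4 k5 k6] : [/\ r <= r0, r <= rho & r <= rho / (3 * C)].
  by split; rewrite !ge_min lexx ?orbT.
pose delta := rho / (3 * Lam).
have delta0 : 0 < delta by rewrite divr_gt0// mulr_gt0//; lra.
have deltaE : 3 * Lam * delta = rho by rewrite /delta mulrC divfK// gt_eqF// mulr_gt0//; lra.
have rC : 3 * C * r <= rho by rewrite mulrC -ler_pdivlMr// mulr_gt0//; lra.
clearbody r delta; exists r, delta; split=> // tau taud alpha Halpha acc.
have taurho : `|tau| <= rho by have := ler_wpM2r (ltW delta0) Lam0; lra.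
pose b := newton_iter Phi tau.
have zero_ball M : 0 <= M -> ps_ball X r M (fun=> 0).
  by move=> M0; apply: ps_ball_cst_le; rewrite ?normr0.
have Phi0 k : (k < N.+1)%N -> Phi k 0 (fun=> 0) = 0.
  by move=> kN; apply: (fixPhi 0 (fun=> 0)).
have ends_ball M i : `|tau| <= M -> ps_ball X r M (fun=> ends tau i).
  move=> tM; apply: ps_ball_cst_le => //; rewrite /ends; case: ifP => // _.
  by rewrite normr0 (le_trans _ tM).
have bball k i : ps_ball X r rho (b k i).
  elim: k i => [|k IH] [|i] /=; rewrite /b /=; try exact: ends_ball.
  case: ltnP => iN; last exact: ends_ball.
  have [H1 H2] := HC i iN r rho r_gt0 k5 k1.
  have Hd j : ps_ball X r rho (fun x => b k j x - (fun (_ : nat) (_ : R) => 0) j x).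
    by apply: ps_ball_ext (IH j) => x _ _; rewrite subr0.
  have H3 := H2 (b k) (fun _ _ => 0) rho IH (fun j => zero_ball _ (ltW rho0)) Hd.
  have H4 : ps_ball X r (Lam * delta)
      (fun x => lin NN (m i) (fun j => b k j x - 0)).
    apply: (@ps_ball_ext _ _ _ _ (fun=> m i 0%N * tau + m i N.+2 * tau)).
      move=> x _ _; rewrite lin_ends big1 => [|j _]; last by rewrite m0 ?mul0r.
      by rewrite /b !newton_iter_end//= ?ltnSn// ends0 endsn; ring.
    apply: ps_ball_cst_le => //; apply: le_trans (ler_normD _ _) _.
    rewrite !normrM -mulrDl ler_pM ?addr_ge0//; exact: Lam1.
  have := ps_ball_add (ps_ball_add H3 H4) H1.
  set M := (X in ps_ball _ _ X) => H5.
  have MM : M <= rho.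
    by have := ler_wpM2r (ltW rho0) Crho; rewrite /M /=; lra.
  apply: ps_ball_le MM _; apply: ps_ball_ext H5 => x _ _; rewrite (Phi0 i iN).
  by rewrite /b; ring.
have contr k x : X x -> `|x| <= r / 2 ->
    forall i, `|b k i x - alpha x i| <= 2 * rho * (1 / 3) ^+ k.
  move=> Xx xr; have [a0 an agt abd aE] := Halpha x Xx xr.
  have aends i : (i == 0%N) || (N.+1 < i)%N -> alpha x i = ends tau i.
    move=> /orP[/eqP->|]; first by rewrite a0.
    rewrite leq_eqVlt => /predU1P[<-|iN]; first by rewrite an endsn.
    by rewrite agt// /ends (gtn_eqF iN) orbF; case: (i) iN.
  elim: k => [|k IH] i.
    rewrite expr0 mulr1; apply: le_trans (ler_normB _ _) _.
    have := abd i; have := ps_ball_bound (bball 0%N i) Xx xr; lra.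
  have [iend|iN] := boolP ((i == 0%N) || (N.+1 < i)%N).
    rewrite /b newton_iter_end// -aends// subrr normr0.
    by rewrite mulr_ge0 ?exprn_ge0 ?mulr_ge0 ?(ltW rho0)//; lra.
  case: i iN => [//|i]; rewrite -leqNgt ltnS => iN.
  rewrite {1}/b /= ltnS iN -/b.
  have {1}<- : Phi i x (alpha x) = alpha x i.+1 by exact: fixPhi.
  have [_ H2] := HC i iN r rho r_gt0 k5 k1.
  pose D := 2 * rho * (1 / 3) ^+ k.
  have brho j : `|b k j x| <= rho by exact: (ps_ball_bound (bball k j) Xx xr).
  have := H2 (fun j _ => b k j x) (fun j _ => alpha x j) D
    (fun j => ps_ball_cst_le r_gt0 (brho j)) (fun j => ps_ball_cst_le r_gt0 (abd j))
    (fun j => ps_ball_cst_le r_gt0 (IH j)).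
  move=> /ps_ball_bound/(_ Xx xr).
  rewrite lin_ends big1 => [|j _]; last by rewrite m0 ?mul0r.
  rewrite a0 an /b !newton_iter_end//= ?ltnSn// ends0 endsn !subrr !mulr0 !addr0 subr0.
  move=> H; apply: le_trans H _; rewrite exprS.
  have D0 : 0 <= D.
    by rewrite /D mulr_ge0 ?exprn_ge0 ?mulr_ge0 ?(ltW rho0)//; lra.
  have := ler_wpM2r D0 Crho; rewrite /D; lra.
have alpha_ball i : ps_ball X r rho (alpha^~ i).
  apply: (ps_ball_lim (fun k => bball k i)) => x Xx xr.
  apply/cvgrPdist_le => e e0.
  have : (fun k : nat => 2 * rho * (1 / 3) ^+ k) @ \oo --> 2 * rho * 0.
    by apply: cvgM; [exact: cvg_cst|apply: cvg_expr; rewrite ger0_norm; lra].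
  rewrite mulr0 => /cvgrPdist_le/(_ e e0); apply: filterS => k.
  rewrite sub0r normrN => H; rewrite distrC; apply: le_trans (contr k x Xx xr i) _.
  exact: le_trans (ler_norm _) H.
have [HF1 _] := HF r rho r_gt0 k5 k2 (fun i x => alpha x i) alpha_ball.
have HF2 : ps_ball X r (CF * rho) (fun x => F x (alpha x)).
  by apply: ps_ball_ext HF1 => x _ _; rewrite F0 subr0.
apply: (ps_ball_identity HF2) => d d0.
have [|x [Xx x0 xd Fx]] := acc (Num.min d (r / 2)).
  by rewrite lt_min d0 divr_gt0.
move: xd; rewrite lt_min => /andP[xd xr]; exists x; split=> //.
by apply: Fx; exact: ltW.
Qed.

End AnalyticSolutions.

(** * The reflection law as an analytic equation *)

Section TrigonometricSeries.
Context {R : realType} (X : set R) (X0 : X 0).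

Lemma series_cvg_trig (u : R -> nat -> R) (f : R -> R) (x : R) :
  (series (u x)) @ \oo --> f x -> (fun N => \sum_(j < N) u x j) @ \oo --> f x.
Proof. by apply: cvg_seq_eq => N; rewrite /series /= big_mkord. Qed.

Lemma sin_cvg (x : R) : (fun N => \sum_(j < N) sin_coeff x j) @ \oo --> sin x.
Proof.
apply: (series_cvg_trig (u := sin_coeff) (f := sin)).
rewrite sin.unlock; exact: is_cvg_series_sin_coeff.
Qed.

Lemma cos_cvg (x : R) : (fun N => \sum_(j < N) cos_coeff x j) @ \oo --> cos x.
Proof.
apply: (series_cvg_trig (u := cos_coeff) (f := cos)).
rewrite cos.unlock; exact: is_cvg_series_cos_coeff.
Qed.

Lemma trig_analytic (u : nat -> R) (f : R -> R -> R) (y0 : R) :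
  (forall j, `|u j| <= 2) ->
  (forall s, (fun N : nat => \sum_(j < N) u j * s ^+ j) @ \oo --> f 0 (y0 + s)) ->
  (forall x y, f x y = f 0 y) -> smooth_at X f y0.
Proof.
move=> u2 Hu f0; apply: (analytic_at_smooth X0).
exists (fun i j => if i == 0%N then u j else 0), (1 / 2), 4; split=> [|N|x s _ _ _].
- by rewrite divr_gt0.
- case: N => [|N]; first by rewrite big_ord0.
  rewrite big_ord_recl /= [X in _ + X]big1 => [|i _]; last first.
    by rewrite big1// => j _; rewrite normr0 mul0r.
  rewrite addr0; apply: (@le_trans _ _ (2 * \sum_(j < N.+1) (1 / 2) ^+ j)).
    rewrite mulr_sumr; apply: ler_sum => j _; rewrite add0n.
    by rewrite ler_wpM2r ?exprn_ge0//; lra.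
  suff : \sum_(j < N.+1) (1 / 2) ^+ j = 2 - 2 * (1 / 2) ^+ N.+1 :> R.
    by move=> ->; have : 0 <= (1 / 2) ^+ N.+1 :> R; [rewrite exprn_ge0//; lra|lra].
  elim: N => [|N IH]; first by rewrite big_ord_recr big_ord0/= expr0 expr1; lra.
  by rewrite big_ord_recr IH /= !exprS; lra.
rewrite f0 -(cvg_shiftn 1); have := cvg_shift 1 (Hu s).
apply: cvg_seq_eq => N; rewrite /dsum /= addn1 [RHS]big_ord_recl /= [X in _ + X]big1.
  by rewrite addr0; apply: eq_bigr => j _; rewrite expr0 mulr1.
by move=> i _; rewrite big1// => j _; rewrite !mul0r.
Qed.

(** The Taylor coefficients of the sine, then of the cosine. *)
Definition sinc j : R := (odd j)%:R * (-1) ^+ j.-1./2 / j`!%:R.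
Definition cosc j : R := (~~ odd j)%:R * (-1) ^+ j./2 / j`!%:R.

Lemma sinc_le j : `|sinc j| <= 1.
Proof.
rewrite /sinc !normrM normrX normrN1 expr1n mulr1 normfV !normr_nat.
by rewrite ler_pdivrMr ?ltr0n ?fact_gt0// mul1r ler_nat (leq_trans (leq_b1 _))// fact_gt0.
Qed.

Lemma cosc_le j : `|cosc j| <= 1.
Proof.
rewrite /cosc !normrM normrX normrN1 expr1n mulr1 normfV !normr_nat.
by rewrite ler_pdivrMr ?ltr0n ?fact_gt0// mul1r ler_nat (leq_trans (leq_b1 _))// fact_gt0.
Qed.

Lemma sin_series s : (fun N => \sum_(j < N) sinc j * s ^+ j) @ \oo --> sin s.
Proof.
rewrite (_ : (fun N => _) = (fun N => \sum_(j < N) sin_coeff s j)); first exact: sin_cvg.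
by apply/funext => N; apply: eq_bigr => j _; rewrite sin_coeffE.
Qed.

Lemma cos_series s : (fun N => \sum_(j < N) cosc j * s ^+ j) @ \oo --> cos s.
Proof.
rewrite (_ : (fun N => _) = (fun N => \sum_(j < N) cos_coeff s j)); first exact: cos_cvg.
by apply/funext => N; apply: eq_bigr => j _; rewrite cos_coeffE.
Qed.

Lemma trig_combination a b s :
  (fun N => \sum_(j < N) (a * cosc j + b * sinc j) * s ^+ j) @ \oo -->
  a * cos s + b * sin s.
Proof.
apply: (@cvg_seq_eq _ (fun N => a * (\sum_(j < N) cosc j * s ^+ j) +
    b * (\sum_(j < N) sinc j * s ^+ j))) => [N|].
  by rewrite !mulr_sumr -big_split; apply: eq_bigr => j _; rewrite mulrDl !mulrA.
by apply: cvgD; (apply: cvgM; [exact: cvg_cst|]); [exact: cos_series|exact: sin_series].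
Qed.

Lemma trig_coef a b j : `|a| <= 1 -> `|b| <= 1 -> `|a * cosc j + b * sinc j| <= 2.
Proof.
move=> a1 b1; apply: le_trans (ler_normD _ _) _; rewrite (normrM a) (normrM b).
have A : `|a| * `|cosc j| <= 1 * 1 by rewrite ler_pM// cosc_le.
have B : `|b| * `|sinc j| <= 1 * 1 by rewrite ler_pM// sinc_le.
by lra.
Qed.

Lemma sin_norm_le1 (y : R) : `|sin y| <= 1. Proof. by rewrite ler_norml sin_geN1 sin_le1. Qed.
Lemma cos_norm_le1 (y : R) : `|cos y| <= 1. Proof. by rewrite ler_norml cos_geN1 cos_le1. Qed.

Lemma smooth_at_sin y0 : smooth_at X (fun _ y => sin y) y0.
Proof.
apply: (@trig_analytic (fun j => sin y0 * cosc j + cos y0 * sinc j)) => //.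
  by move=> j; apply: trig_coef; [exact: sin_norm_le1|exact: cos_norm_le1].
by move=> s; rewrite sinD; exact: trig_combination.
Qed.

Lemma smooth_at_cos y0 : smooth_at X (fun _ y => cos y) y0.
Proof.
apply: (@trig_analytic (fun j => cos y0 * cosc j + - sin y0 * sinc j)) => //.
  by move=> j; apply: trig_coef; rewrite ?normrN; [exact: cos_norm_le1|exact: sin_norm_le1].
by move=> s; rewrite cosD -mulNr; exact: trig_combination.
Qed.

End TrigonometricSeries.

Section Residual.
Context {R : realType}.

(** The defect in the reflection law, cleared of its denominators so that it is
  analytic for all angles ([residE]). *)
Definition resid (p dp : R -> R) y0 y1 y2 :=
  (p y2 - p y1 * cos (y2 - y1)) * sin (y1 - y0) +
  (p y1 * cos (y1 - y0) - p y0) * sin (y2 - y1) -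
  2 * dp y1 * (sin (y1 - y0) * sin (y2 - y1)).

Lemma residE p dp y0 y1 y2 : 0 < y1 - y0 < pi -> 0 < y2 - y1 < pi ->
  resid p dp y0 y1 y2 =
  sin (y1 - y0) * sin (y2 - y1) * (fwd p dp y1 y2 - bwd p dp y0 y1).
Proof.
move=> /sin_neq0 s0 /sin_neq0 s1; rewrite /resid /fwd /bwd.
move: s0 s1; set s := sin (y1 - y0); set s' := sin (y2 - y1) => s0 s1.
by field; rewrite s0.
Qed.

Context (I : set R) (P DP : R -> R -> R) (eps0 : R).
Hypothesis (anP : analytic_fam I P) (anDP : analytic_fam I DP) (I0 : I eps0).
Local Notation X := (fun x => I (eps0 + x)).

(** Built from coordinates by sums, products and composition with the analytic
  functions [p], [p'], [sin] and [cos]. *)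
Lemma functional_resid NN (j0 j1 j2 : nat) (k0 k1 k2 : R) :
  (j0 < NN)%N -> (j1 < NN)%N -> (j2 < NN)%N ->
  exists l, analytic_functional X NN (fun x a => resid (P (eps0 + x)) (DP (eps0 + x))
    (k0 + a j0) (k1 + a j1) (k2 + a j2)) l.
Proof.
move=> J0 J1 J2; have X0 : X 0 by rewrite addr0.
have g0 := functional_coord X k0 J0; have g1 := functional_coord X k1 J1; have g2 := functional_coord X k2 J2.
have gd1 := functional_add g1 (functional_opp X0 g0); have gd2 := functional_add g2 (functional_opp X0 g1).
have [? s1] := functional_comp gd1 (smooth_at_sin X0 _).
have [? s2] := functional_comp gd2 (smooth_at_sin X0 _).
have [? c1] := functional_comp gd1 (smooth_at_cos X0 _).
have [? c2] := functional_comp gd2 (smooth_at_cos X0 _).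
have [? p0] := functional_comp g0 (analytic_fam_smooth _ anP I0).
have [? p1] := functional_comp g1 (analytic_fam_smooth _ anP I0).
have [? p2] := functional_comp g2 (analytic_fam_smooth _ anP I0).
have [? q1] := functional_comp g1 (analytic_fam_smooth _ anDP I0).
have [? p1c2] := functional_mul X0 p1 c2; have [? p1c1] := functional_mul X0 p1 c1.
have [? A] := functional_mul X0 (functional_add p2 (functional_opp X0 p1c2)) s1.
have [? B] := functional_mul X0 (functional_add p1c1 (functional_opp X0 p0)) s2.
have [? ss] := functional_mul X0 s1 s2.
have [? C] := functional_mul X0 (functional_scale 2 q1) ss.
have := functional_add (functional_add A B) (functional_opp X0 C).
set l := (X in analytic_functional _ _ _ X) => H; exists l.
by apply: (functional_ext X0) H => x a _.
Qed.
End Residual.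

(** * Nondegeneracy along an invariant circle *)

Section TangentBounds.
Context {R : realType} (p dp : R -> R) (sf : support_fun p dp).
Local Notation S := (fwd p dp).
Local Notation T := (bwd p dp).

(** By monotonicity it suffices to bound the lengths for a gap of exactly [k], where
  periodicity and continuity give a positive minimum. *)
Lemma tangent_lower k : 0 < k < pi -> exists mu, 0 < mu /\
  forall a b, k <= b - a < pi -> mu <= S a b /\ mu <= T a b.
Proof.
move=> kpi; have /andP[k0 kp] := kpi.
have cshift (f : R -> R) c : (forall t, {for t, continuous f}) ->
    forall t, {for t, continuous (fun s => f (s + c))}.
  move=> cf t; apply: (@continuous_comp _ _ _ (fun s : R => s + c) f); last exact: cf.
  by apply: cvgD; [exact: cvg_id|exact: cvg_cst].
have cp t : {for t, continuous p} := drv_continuous (sf_der sf t).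
have cdp := dp_continuous sf.
have [||s1 [s1' H1]] := @periodic_bounds R (fun t => S t (t + k)).
- by move=> t; rewrite addrAC /fwd shiftB !(sf_per sf) (dp_per sf).
- move=> t; rewrite (_ : (fun _ => _) =
      (fun t => (p (t + k) - p t * cos k) / sin k - dp t)); last first.
    by apply/funext => s; rewrite /fwd addrAC subrr add0r.
  apply: cvgB; last exact: cdp.
  apply: cvgM; last exact: cvg_cst.
  by apply: cvgB; [exact: cshift|apply: cvgM; [exact: cp|exact: cvg_cst]].
have [||s2 [s2' H2]] := @periodic_bounds R (fun t => T (t - k) t).
- by move=> t; rewrite addrAC /bwd shiftB !(sf_per sf) (dp_per sf).
- move=> t; rewrite (_ : (fun _ => _) =
      (fun t => dp t - (p t * cos k - p (t - k)) / sin k)); last first.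
    by apply/funext => s; rewrite /bwd opprB addrCA subrr addr0.
  apply: cvgB; first exact: cdp.
  apply: cvgM; last exact: cvg_cst.
  by apply: cvgB; [apply: cvgM; [exact: cp|exact: cvg_cst]|exact: cshift].
have m1 : 0 < S s1 (s1 + k) by apply: (sf_fwd sf); apply/andP; split; lra.
have m2 : 0 < T (s2 - k) s2 by apply: (sf_bwd sf); apply/andP; split; lra.
exists (Num.min (S s1 (s1 + k)) (T (s2 - k) s2)); split; first by rewrite lt_min m1.
move=> a b /andP[kab abpi]; split.
  apply: (@le_trans _ _ (S s1 (s1 + k))); first by rewrite ge_min lexx.
  have /andP[H _] := H1 a; apply: (le_trans H); apply: (fwd_le sf); lra.
apply: (@le_trans _ _ (T (s2 - k) s2)); first by rewrite ge_min lexx orbT.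
have /andP[H _] := H2 b; apply: (le_trans H); apply: (bwd_ge sf); lra.
Qed.

Lemma bwd_upper k : 0 < k -> exists B, 0 < B /\
  forall a b, k <= b - a <= pi - k -> T a b <= B.
Proof.
move=> k0; have [M bnd] := sf_bnd sf.
have pM t : p t <= M by have [] := bnd t.
have dpM t : `|dp t| <= M by have [] := bnd t.
have M0 : 0 <= M by apply: le_trans (dpM 0).
have k20 : 0 < k / 2 by rewrite divr_gt0.
have kM : 0 <= 2 * M / (k / 2) by rewrite divr_ge0 ?mulr_ge0// ltW.
exists (M + 2 * M / (k / 2) + 1); split=> [|a b kab]; first by lra.
have s2 := sin_lower k0 kab; have s0 : 0 < sin (b - a) by lra.
have dpb : dp b <= M by apply: le_trans (ler_norm _) (dpM b).
suff : - ((p b * cos (b - a) - p a) / sin (b - a)) <= 2 * M / (k / 2).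
  by rewrite /bwd; lra.
apply: le_trans (ler_norm _) _; rewrite normrN normrM normfV (gtr0_norm s0).
rewrite ler_pM ?invr_ge0 ?(ltW s0)// ?lef_pV2 ?posrE//.
apply: le_trans (ler_normB _ _) _; rewrite normrM.
have pM' t : `|p t| <= M by rewrite gtr0_norm// (sf_pos sf).
have : `|p b| * `|cos (b - a)| <= M * 1 by rewrite ler_pM// cos_norm_le1.
by have := pM' a; lra.
Qed.

(** On steps bounded away from [0] and [pi] the derivative [bwd / sin] is bounded
  above and below by positive constants. *)
Lemma fwd_bilip k : 0 < k < pi -> exists mu L, [/\ 0 < mu, 0 < L &
  forall b c c', c <= c' -> k <= c - b -> c' - b <= pi - k ->
    mu * (c' - c) <= S b c' - S b c <= L * (c' - c)].
Proof.
move=> kpi; have /andP[k0 kp] := kpi; have [mu [mu0 Hmu]] := tangent_lower kpi.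
have [B [B0 HB]] := bwd_upper k0.
exists mu, (B / (k / 2)); split=> //; first by rewrite !divr_gt0.
move=> b c c'; rewrite le_eqVlt => /predU1P[->|cc] kc kc'.
  by rewrite !subrr !mulr0 lexx.
have [|d [/andP[cd dc] ->]] := mean_value (f := S b) (df := fun d => T b d / sin (d - b)) cc.
  by move=> d /andP[cd dc]; apply: (der_fwd_r sf); apply/andP; split; lra.
have [_ T1] := Hmu b d (ltac:(apply/andP; split; lra)).
have T2 := HB b d (ltac:(apply/andP; split; lra)).
have s1 := sin_lower k0 (ltac:(apply/andP; split; lra) : k <= d - b <= pi - k).
have s2 := sin_le1 (d - b); have s0 : 0 < sin (d - b) by lra.
have T0 : 0 < T b d by lra.
rewrite !ler_pM2r ?subr_gt0//; apply/andP; split.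
  by rewrite ler_pdivlMr//; nra.
by rewrite ler_pM ?invr_ge0 ?(ltW T0) ?(ltW s0)// lef_pV2 ?posrE//; lra.
Qed.

Lemma bwd_lower_lip k : 0 < k < pi -> exists mu, 0 < mu /\
  forall a s b, a <= s -> b - a <= pi - k -> k <= b - s ->
    mu * (s - a) <= T a b - T s b.
Proof.
move=> kpi; have /andP[k0 kp] := kpi; have [mu [mu0 Hmu]] := tangent_lower kpi.
exists mu; split=> // a s b; rewrite le_eqVlt => /predU1P[->|as_] kc kc'.
  by rewrite !subrr !mulr0 lexx.
rewrite -lerN2 opprB.
have [|d [/andP[cd dc] ->]] := mean_value (f := T^~ b)
    (df := fun d => - (S d b / sin (b - d))) as_.
  by move=> d /andP[cd dc]; apply: (der_bwd_l sf); apply/andP; split; lra.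
have [S1 _] := Hmu d b (ltac:(apply/andP; split; lra)).
have s1 := sin_lower k0 (ltac:(apply/andP; split; lra) : k <= b - d <= pi - k).
have s2 := sin_le1 (b - d); have s0 : 0 < sin (b - d) by lra.
rewrite mulNr lerN2 ler_pM2r ?subr_gt0//.
by rewrite ler_pdivlMr//; nra.
Qed.
End TangentBounds.

Section Nondegenerate.
Context {R : realType} (p dp : R -> R) (sf : support_fun p dp).
Context (N : nat) (w : R) (w0 : 0 < w).
Local Notation n := N.+2.
Local Notation S := (fwd p dp).
Local Notation T := (bwd p dp).
Hypothesis (pw : forall t, p (t + w) = p t) (dpw : forall t, dp (t + w) = dp t).
Context (g u : R -> R) (ci : circle p dp N w g u).
Hypothesis (gper : forall t, g (t + 2 * pi) = g t + 2 * pi).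
Hypothesis (ulip : exists L, forall s t, `|u s - u t| <= L * `|s - t|).

Lemma circle_gap_bounds : exists k, 0 < k /\ forall t, k <= g t - t <= pi - k.
Proof.
have [||s1 [s2 H]] := @periodic_bounds R (fun t => g t - t).
- by move=> t; rewrite gper; ring.
- by move=> t; apply: cvgB; [exact: (circle_cont sf ci)|exact: cvg_id].
have /andP[? _] := ci_gap ci s1; have /andP[_ ?] := ci_gap ci s2.
exists (Num.min (g s1 - s1) (pi - (g s2 - s2))); split.
  by rewrite lt_min; apply/andP; split; lra.
move=> t; have /andP[? ?] := H t.
set k := Num.min _ _.
have k1 : k <= g s1 - s1 by rewrite ge_min lexx.
have k2 : k <= pi - (g s2 - s2) by rewrite ge_min lexx orbT.
by apply/andP; split; lra.
Qed.

Lemma circle_map_lip : exists G, 0 < G /\ forall s t, s <= t -> g t - g s <= G * (t - s).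
Proof.
have [k [k0 Hk]] := circle_gap_bounds.
have kpi : 0 < k / 2 < pi.
  by have := Hk 0; have := pi_gt0 R => ? /andP[? ?]; apply/andP; split; lra.
have /andP[k20 _] := kpi.
have [mu [L [mu0 L0 Hmu]]] := fwd_bilip sf kpi.
have [L1 [L10 H1]] := fwd_lip_l sf k20.
have [Lu HLu] := ulip.
have Lu0 : 0 <= Lu by have := HLu 1 0; rewrite subr0 normr1 mulr1; apply: le_trans.
have G0 : 0 < (Lu + L1) / mu + 1.
  by have : 0 <= (Lu + L1) / mu; [rewrite divr_ge0 ?(ltW mu0)//; lra|lra].
exists ((Lu + L1) / mu + 1); split=> //.
have incr s t : s <= t -> g s <= g t.
  by rewrite le_eqVlt => /predU1P[->//|/(circle_incr sf ci)/ltW].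
have H s t : `|g s - g t| <= ((Lu + L1) / mu + 1) * `|s - t|.
  move: s t; apply: (local_lipschitz k20) => s t st tsk.
  have /andP[gs1 gs2] := Hk s; have /andP[gt1 gt2] := Hk t.
  have gst := incr _ _ st; rewrite ger0_norm ?subr_ge0//.
  have /andP[A _] := Hmu t (g s) (g t) gst (ltac:(lra)) (ltac:(lra)).
  have := H1 s t (g s) st (ltac:(lra)) (ltac:(lra)).
  rewrite ler_norml (ci_fwd ci) => /andP[B _]; rewrite (ci_fwd ci) in A.
  have := HLu t s; rewrite ler_norml (ger0_norm (_ : 0 <= t - s)) ?subr_ge0// => /andP[_ C].
  have D : mu * (g t - g s) <= (Lu + L1) * (t - s) by lra.
  have ts0 : 0 <= t - s by rewrite subr_ge0.
  apply: (@le_trans _ _ ((Lu + L1) / mu * (t - s))); last by rewrite ler_wpM2r//; lra.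
  by rewrite mulrAC ler_pdivlMr// mulrC.
by move=> s t st; have := H t s; rewrite !ger0_norm ?subr_ge0// incr.
Qed.

Context (x : nat -> R) (xw : x n = x 0%N + w) (xg : forall i, (i < n)%N -> x i.+1 = g (x i)).

(** If [b] lies beyond the circle map at [a], then the backward length from [b] to
  the tangent at [a] exceeds the one on the circle; when the reflection law holds up
  to a small error, so does the forward length, and the next point is again beyond
  the circle map. All estimates are linear in the gap. *)
Lemma circle_ahead k : 0 < k < pi -> (forall t, k <= g t - t <= pi - k) ->
  exists kap, 0 < kap /\ forall a b b' d, 0 < d -> d <= b - g a ->
    k <= b - a <= pi - k -> k <= b' - b <= pi - k ->
    `|S b b' - T a b| <= kap * d -> kap * d <= b' - g b.
Proof.
move=> kpi Hk.
have [mu [L [mu0 L0 Hmu]]] := fwd_bilip sf kpi.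
have [mu' [mu'0 Hmu']] := bwd_lower_lip sf kpi.
have [G [G0 HG]] := circle_map_lip.
pose z := mu' / (2 * G).
have z0 : 0 < z by rewrite divr_gt0// mulr_gt0.
have zE : mu' / G = 2 * z by rewrite /z; field; rewrite gt_eqF.
exists (Num.min z (z / L)); split; first by rewrite lt_min z0 divr_gt0.
move=> a b b' d d0 dgap /andP[ga1 ga2] /andP[gb1 gb2] err.
have tail : z * d <= S b b' - S b (g b).
  have [q Eq] := circle_surj ci b.
  have aq : a < q by rewrite -(circle_mono sf ci) Eq; lra.
  have := HG a q (ltW aq); rewrite Eq => dG.
  have qa : d / G <= q - a by rewrite ler_pdivrMr// mulrC; lra.
  have /andP[gq1 _] := Hk q; rewrite Eq in gq1.
  have := Hmu' a q b (ltW aq) ga2 gq1; rewrite -{2}Eq (ci_bwd ci) Eq -(ci_fwd ci) => Tab.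
  have := ler_wpM2l (ltW mu'0) qa; rewrite mulrCA zE => dz.
  have : `|S b b' - T a b| <= z * d.
    by apply: le_trans err _; rewrite ler_pM2r// ge_min lexx.
  by rewrite ler_norml => /andP[err1 _]; lra.
have zd : 0 < z * d by rewrite mulr_gt0.
have /andP[_ gb4] := Hk b.
have gbb' : g b <= b'.
  rewrite leNgt; apply/negP => lt_.
  by have : S b b' < S b (g b); [apply: (fwd_incr sf); lra|lra].
have /andP[gb3 _] := Hk b.
have /andP[_ Lb] := Hmu b (g b) b' gbb' gb3 gb2.
apply: (@le_trans _ _ (z / L * d)); first by rewrite ler_pM2r// ge_min lexx orbT.
by rewrite mulrAC ler_pdivrMr// [leRHS]mulrC; exact: le_trans Lb.
Qed.

(** The denominators cleared in [resid] are bounded below when the steps are. *)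
Lemma resid_lower k y0 y1 y2 : 0 < k -> k <= y1 - y0 <= pi - k ->
  k <= y2 - y1 <= pi - k ->
  (k / 2) ^+ 2 * `|S y1 y2 - T y0 y1| <= `|resid p dp y0 y1 y2|.
Proof.
move=> k0 g0 g1.
have s0 := sin_lower k0 g0; have s1 := sin_lower k0 g1.
rewrite residE; first last.
- by move/andP: g1 => [? ?]; apply/andP; split; lra.
- by move/andP: g0 => [? ?]; apply/andP; split; lra.
have k20 : 0 <= k / 2 by lra.
rewrite normrM ler_wpM2r// ger0_norm; first by rewrite expr2 ler_pM.
by rewrite mulr_ge0//; lra.
Qed.

(** A first-order deformation of a closed orbit on an invariant circle that keeps
  the ends fixed and satisfies the orbit equations up to second order is trivial:
  if its first component were positive, the deformed sequence would run ahead of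
  the circle map at every step by an amount linear in [t], so it could not close. *)
Lemma deformation_trivial (xi : nat -> R) K t0 : xi 0%N = 0 -> xi n = 0 -> 0 < t0 ->
  (forall t, `|t| <= t0 -> forall i, (i < N.+1)%N ->
    `|resid p dp (x i + t * xi i) (x i.+1 + t * xi i.+1) (x i.+2 + t * xi i.+2)|
      <= K * t ^+ 2) ->
  forall j, (j <= n)%N -> xi j = 0.
Proof.
move=> xi0 xin t00 HK.
have [k [k0 Hk]] := circle_gap_bounds.
have kpi : 0 < k / 2 < pi.
  by have := Hk 0; have := pi_gt0 R => ? /andP[? ?]; apply/andP; split; lra.
have /andP[k20 k2pi] := kpi.
pose Xi := 1 + \sum_(i < N.+3) `|xi i|.
have Xi1 : 1 <= Xi by rewrite lerDl sumr_ge0.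
have xiX i : (i <= n)%N -> `|xi i| <= Xi.
  move=> iN; rewrite /Xi (bigD1 (Ordinal (iN : (i < N.+3)%N)))//=.
  have : 0 <= \sum_(j < N.+3 | j != Ordinal (iN : (i < N.+3)%N)) `|xi j| by apply: sumr_ge0.
  by lra.
pose t1 := Num.min t0 (k / (4 * Xi)).
have t10 : 0 < t1 by rewrite lt_min t00 divr_gt0// mulr_gt0//; lra.
have t1k : t1 * Xi <= k / 4.
  have : t1 <= k / (4 * Xi) by rewrite ge_min lexx orbT.
  by rewrite ler_pdivlMr; [lra|rewrite mulr_gt0//; lra].
have t1t0 : t1 <= t0 by rewrite ge_min lexx.
clearbody t1.
have ygap t i : `|t| <= t1 -> (i < n)%N ->
    k / 2 <= x i.+1 + t * xi i.+1 - (x i + t * xi i) <= pi - k / 2.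
  move=> tt1 iN; have := Hk (x i); rewrite -(xg iN) => /andP[? ?].
  have B j : (j <= n)%N -> `|t * xi j| <= k / 4.
    by move=> jN; rewrite normrM; apply: le_trans t1k; rewrite ler_pM// xiX.
  have := B i (ltnW iN); have := B i.+1 iN.
  rewrite !ler_norml => /andP[? ?] /andP[? ?].
  by apply/andP; split; lra.
pose K1 := `|K| / (k / 2 / 2) ^+ 2 + 1.
have kk0 : 0 < k / 2 / 2 by rewrite !divr_gt0.
have K10 : 0 < K1.
  by rewrite /K1; have : 0 <= `|K| / (k / 2 / 2) ^+ 2; [rewrite divr_ge0// sqr_ge0|lra].
have HST t i : `|t| <= t1 -> (i < N.+1)%N ->
    `|S (x i.+1 + t * xi i.+1) (x i.+2 + t * xi i.+2) -
      T (x i + t * xi i) (x i.+1 + t * xi i.+1)| <= K1 * t ^+ 2.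
  move=> tt1 iN; have g0 := ygap t i tt1 (ltnW iN); have g1 := ygap t i.+1 tt1 iN.
  have := HK t (le_trans tt1 t1t0) i iN.
  set y0 := x i + _; set y1 := x i.+1 + _; set y2 := x i.+2 + _.
  rewrite -/y0 -/y1 in g0; rewrite -/y1 -/y2 in g1.
  move=> H; have := le_trans (resid_lower k20 g0 g1) H.
  rewrite mulrC -ler_pdivlMr ?exprn_gt0// => /le_trans; apply.
  rewrite mulrAC ler_wpM2r ?sqr_ge0// /K1 (le_trans (_ : _ <= `|K| / (k / 2 / 2) ^+ 2))//.
    by rewrite ler_wpM2r ?invr_ge0 ?sqr_ge0// ler_norm.
  by rewrite lerDl.
have [mu [L [mu0 L0 Hmu]]] := fwd_bilip sf kpi.
have Hk2 t : k / 2 <= g t - t <= pi - k / 2.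
  by have /andP[h1 h2] := Hk t; apply/andP; split; lra.
have [kap [kap0 Hkap]] := circle_ahead kpi Hk2.
clearbody K1; clear Xi1 xiX t1k HK Hk t1t0 kk0.
pose y t i := x i + t * xi i.
(* [e] is a sign, so that both signs of the deformation are treated at once. *)
have key (e : R) : `|e| = 1 -> 0 < e * xi 1%N -> False.
  move=> e1 exi1.
  have A i : (i <= N.+1)%N -> exists c t2, [/\ 0 < c, 0 < t2 & forall s, 0 < s -> s <= t2 ->
      c * s <= y (e * s) i.+1 - g (y (e * s) i)].
    elim: i => [_|i IH iN].
      exists (e * xi 1%N), 1; split=> // s s0 _.
      rewrite /y xi0 mulr0 addr0 xg// addrAC subrr add0r.
      by rewrite mulrAC.
    have [c [t2 [c0 t20 Hc]]] := IH (ltnW iN).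
    pose t3 := Num.min (Num.min t1 t2) (kap * c / K1).
    have t30 : 0 < t3 by rewrite !lt_min t10 t20 divr_gt0// mulr_gt0.
    have [q1 q2 q3] : [/\ t3 <= t1, t3 <= t2 & t3 <= kap * c / K1].
      by split; rewrite !ge_min lexx ?orbT.
    exists (kap * c), t3; split=> //; first by rewrite mulr_gt0.
    move=> s s0 st3; have es : `|e * s| <= t1.
      by rewrite normrM e1 mul1r gtr0_norm// (le_trans st3).
    rewrite -mulrA; apply: (Hkap (y (e * s) i) _ _ _ (mulr_gt0 c0 s0)).
    + exact: Hc s s0 (le_trans st3 q2).
    + by have H := ygap (e * s) i es (ltnW iN); exact: H.
    + exact: (ygap (e * s) i.+1 es iN).
    + apply: le_trans (HST _ _ es iN) _.
      rewrite exprMn -(real_normK (num_real e)) e1 expr1n mul1r expr2 !mulrA ler_pM2r//.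
      by rewrite mulrC -ler_pdivlMr// (le_trans st3).
  have B i : (i <= N.+1)%N -> exists t2, 0 < t2 /\ forall s, 0 < s -> s <= t2 ->
      forall j, (j <= i)%N -> g (y (e * s) j) < y (e * s) j.+1.
    elim: i => [|i IH] iN.
      have [c [t2 [c0 t20 Hc]]] := A 0%N isT; exists t2; split=> // s s0 st j.
      by rewrite leqn0 => /eqP->; have := Hc s s0 st; have := mulr_gt0 c0 s0; lra.
    have [t2 [t20 H2]] := IH (ltnW iN).
    have [c [t3 [c0 t30 Hc]]] := A i.+1 iN.
    exists (Num.min t2 t3); split; first by rewrite lt_min t20.
    move=> s s0; rewrite le_min => /andP[st2 st3] j.
    rewrite leq_eqVlt => /predU1P[->|]; last by rewrite ltnS; exact: H2.
    by have := Hc s s0 st3; have := mulr_gt0 c0 s0; lra.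
  have [t2 [t20 H2]] := B N.+1 (leqnn _).
  have {}H2 := H2 t2 t20 (lexx _).
  have J i : (i <= N.+1)%N -> iter i.+1 g (y (e * t2) 0%N) < y (e * t2) i.+1.
    elim: i => [|i IH] iN; first exact: H2.
    rewrite iterS; apply: lt_trans (H2 _ iN).
    by rewrite (circle_mono sf ci); apply: IH; exact: ltnW.
  have := J N.+1 (leqnn _); rewrite (ci_iter ci) /y xi0 xin !mulr0 !addr0 xw.
  by rewrite ltxx.
have xi1 : xi 1%N = 0.
  have [pos|neg|->//] := ltrgtP (xi 1%N) 0.
    by case: (key (-1)); rewrite ?normrN1// mulN1r oppr_gt0.
  by case: (key 1); rewrite ?normr1// mul1r.
clear key kap0 Hkap.
have step j : (j <= N)%N -> xi j = 0 -> xi j.+1 = 0 -> xi j.+2 = 0.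
  move=> jN E0 E1; apply/eqP; rewrite -normr_le0; apply/ler_addgt0Pr => d d0.
  rewrite add0r.
  pose t := Num.min t1 (d * mu / K1).
  have t_gt0 : 0 < t by rewrite lt_min t10 divr_gt0// mulr_gt0.
  have [q1 q2] : t <= t1 /\ t <= d * mu / K1 by split; rewrite ge_min lexx ?orbT.
  have C t' : `|t'| = t -> 0 <= t' * xi j.+2 -> `|xi j.+2| <= d.
    move=> t't tx; have tt1 : `|t'| <= t1 by rewrite t't.
    have := HST t' j tt1 jN; rewrite E0 E1 !mulr0 !addr0.
    have xg1 : x j.+2 = g (x j.+1) by exact: xg.
    have Tx : T (x j) (x j.+1) = S (x j.+1) (x j.+2).
      by rewrite xg1 (xg (i := j)) 1?ltnW// (ci_bwd ci) (ci_fwd ci).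
    rewrite Tx => H.
    have := ygap t' j.+1 tt1 jN; rewrite E1 mulr0 addr0 => /andP[_ gg].
    have := Hk2 (x j.+1); rewrite -xg1 => /andP[gk1 gk2].
    have xx : x j.+2 <= x j.+2 + t' * xi j.+2 by rewrite lerDl.
    have /andP[M1 _] := Hmu (x j.+1) _ _ xx (ltac:(lra)) gg.
    move: H; rewrite ler_norml => /andP[_ H].
    have E : t' * xi j.+2 = t * `|xi j.+2| by rewrite -t't -normrM ger0_norm.
    have t2 : t' ^+ 2 = t * t by rewrite -(real_normK (num_real t')) t't expr2.
    have HH : mu * (t * `|xi j.+2|) <= K1 * (t * t).
      by rewrite -E -t2; apply: le_trans H; apply: le_trans M1; rewrite ler_wpM2l ?(ltW mu0)//; lra.
    have : t * (mu * `|xi j.+2|) <= t * (K1 * t) by lra.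
    rewrite ler_pM2l// => H3.
    have H4 : t * K1 <= d * mu by rewrite -ler_pdivlMr.
    by rewrite -(ler_pM2l mu0); lra.
  have [tx|tx] := lerP 0 (xi j.+2).
    by apply: (C t); rewrite ?gtr0_norm// mulr_ge0// ltW.
  by apply: (C (- t)); rewrite ?normrN ?gtr0_norm// mulNr oppr_ge0 mulr_ge0_le0// ltW.
suff : forall j, (j <= N.+1)%N -> xi j = 0 /\ xi j.+1 = 0.
  by move=> H [|j] jN; [exact: xi0|case: (H j jN)].
elim=> [//|j IH] jN; have [E0 E1] := IH (ltnW jN).
by split=> //; apply: step.
Qed.
End Nondegenerate.

(** * Flatness is an open condition at accumulation points *)

Section OpenStep.
Context {R : realType} (I : set R) (P DP : R -> R -> R).
Hypothesis sfP : forall eps, I eps -> support_fun (P eps) (DP eps).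
Hypothesis (anP : analytic_fam I P) (anDP : analytic_fam I DP).
Context (N : nat) (w : R) (w0 : 0 < w).
Local Notation n := N.+2.
Local Notation NN := N.+3.
Hypothesis wn : w < pi * n%:R.
Hypothesis pw : forall eps, I eps -> forall t, P eps (t + w) = P eps t.
Hypothesis dpw : forall eps, I eps -> forall t, DP eps (t + w) = DP eps t.
Implicit Types (eps d e t a b : R) (x y : nat -> R).

(** The reflection law at the base point, for a configuration with [x n = x 0 + w]. *)
Definition closes eps x :=
  bwd (P eps) (DP eps) (x N.+1) (x n) = fwd (P eps) (DP eps) (x 0%N) (x 1%N).

Lemma flat_closes eps x : I eps -> flat_at P N w eps -> is_min (P eps) n w x ->
  closes eps x.
Proof.
move=> Ie [c fl] xm.
have [g [u [ci _ _ _]]] := flat_circle (sfP Ie) w0 (pw Ie) (dpw Ie) fl.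
exact: (circle_closing (sfP Ie) w0 (pw Ie) (dpw Ie) ci xm).
Qed.

Lemma resid_closing eps x : I eps -> is_min (P eps) n w x ->
  closes eps x <-> resid (P eps) (DP eps) (x N.+1) (x n) (x 1%N + w) = 0.
Proof.
move=> Ie xm; have gap := min_gap (sfP Ie) w0 xm; have [[xn _] _] := xm.
have g0 := gap 0%N isT; have gN := gap N.+1 (ltnSn _).
have g1 : 0 < x 1%N + w - x n < pi by rewrite xn (shiftB w).
have fw : fwd (P eps) (DP eps) (x n) (x 1%N + w) = fwd (P eps) (DP eps) (x 0%N) (x 1%N).
  by rewrite xn (fwd_w (pw Ie) (dpw Ie)).
rewrite residE// /closes fw.
have s0 := sin_neq0 gN; have s1 := sin_neq0 g1.
split=> [->|/eqP]; first by rewrite subrr mulr0.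
by rewrite !mulf_eq0 (negPf s0) (negPf s1) /= subr_eq0 => /eqP.
Qed.

Lemma resid_min eps x i : I eps -> is_min (P eps) n w x -> (i < N.+1)%N ->
  resid (P eps) (DP eps) (x i) (x i.+1) (x i.+2) = 0.
Proof.
move=> Ie xm iN; have gap := min_gap (sfP Ie) w0 xm.
rewrite residE ?gap// 1?ltnW// (min_crit (sfP Ie) w0 xm)//.
by rewrite subrr mulr0.
Qed.

(** Around one base point: write the minimizers near the base parameter as
  [xs + alpha], where [xs] is the minimizer at the base parameter. By uniqueness
  ([circle_follow]) they are close to it, and they solve an analytic system that
  is nondegenerate by [deformation_trivial], so the identity principle applies to
  the defect in the reflection law at the base point. *)
Lemma local_closing eps0 th0 : I eps0 -> flat_at P N w eps0 ->
  (forall d, 0 < d -> exists eps,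
     [/\ I eps, eps != eps0, `|eps - eps0| < d & flat_at P N w eps]) ->
  exists d, 0 < d /\ forall eps x, I eps -> `|eps - eps0| <= d ->
    is_min (P eps) n w x -> `|x 0%N - th0| <= d -> closes eps x.
Proof.
move=> I0 fl0 acc; have [c fl] := fl0.
have sf0 := sfP I0; have pw0 := pw I0; have dpw0 := dpw I0.
have [g [u [ci _ gper ulip]]] := flat_circle sf0 w0 pw0 dpw0 fl.
have [xs [xs0 xsm _]] := valueP sfP anP anDP w0 wn th0 I0.
have follow := circle_follow sf0 w0 ci xsm.
have [[xsn _] _] := xsm.
pose X : set R := fun x : R => I (eps0 + x).
have X0 : X 0 by rewrite /X addr0.
pose E i (x : R) (a : nat -> R) := resid (P (eps0 + x)) (DP (eps0 + x))
   (xs i + a i) (xs i.+1 + a i.+1) (xs i.+2 + a i.+2).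
have /choice[l Hl] : forall i, exists l, (i < N.+1)%N -> analytic_functional X NN (E i) l.
  move=> i; have [iN|iN] := boolP (i < N.+1)%N; last by exists (fun=> 0).
  have i2 : (i.+2 < NN)%N := iN; have i1 : (i.+1 < NN)%N := ltnW i2.
  have [l Hl] := functional_resid anP anDP I0 (xs i) (xs i.+1) (xs i.+2) (ltnW i1) i1 i2.
  by exists l.
have E0 i : (i < N.+1)%N -> E i 0 (fun=> 0) = 0.
  by move=> iN; rewrite /E !addr0; exact: resid_min.
pose F (x : R) (a : nat -> R) := resid (P (eps0 + x)) (DP (eps0 + x))
   (xs N.+1 + a N.+1) (xs n + a n) (xs 1%N + w + a 1%N).
have [lF gF] : exists lF, analytic_functional X NN F lF.
  by apply: (functional_resid anP anDP I0).
have F0 : F 0 (fun=> 0) = 0.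
  by rewrite /F !addr0; apply/resid_closing => //; exact: flat_closes.
(* A kernel vector is a deformation of [xs] that solves the equations to second order. *)
have nd : regular_system N l.
  move=> v v0 vn vl.
  have [C [p [C1 p0 p1 HC]]] := functional_uniform Hl.
  pose V := 1 + \sum_(i < NN) `|v i|.
  have V1 : 1 <= V by rewrite lerDl sumr_ge0.
  have vV i : (i < NN)%N -> `|v i| <= V.
    move=> iN; rewrite /V (bigD1 (Ordinal iN))//=.
    have : 0 <= \sum_(j < NN | j != Ordinal iN) `|v j| by apply: sumr_ge0.
    by lra.
  have p0V : 0 < p / V by rewrite divr_gt0//; lra.
  suff D : forall j, (j <= n)%N -> v j = 0 by move=> j jN; apply: D; rewrite ltnS ltnW.
  apply: (deformation_trivial sf0 ci gper ulip xsn follow (K := C * V ^+ 2)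
    (t0 := p / V)) => // t tp i iN.
  have [->|t0] := eqVneq t 0.
    rewrite !mul0r !addr0 (resid_min I0 xsm iN) normr0 !mulr_ge0 ?exprn_ge0//; lra.
  have tV : 0 < `|t| * V by rewrite mulr_gt0 ?normr_gt0//; lra.
  have tVp : `|t| * V <= p by rewrite -ler_pdivlMr//; lra.
  have [_ H] := HC i iN _ _ tV (lexx _) tVp.
  pose a (j : nat) (_ : R) : R := if (j < NN)%N then t * v j else 0.
  have aV j : ps_ball X (`|t| * V) (`|t| * V) (a j).
    apply: ps_ball_cst_le => //; case: ifP => [jN|_]; last by rewrite normr0 ltW.
    by rewrite normrM ler_wpM2l// vV.
  have z j : ps_ball X (`|t| * V) (`|t| * V) ((fun (_ : nat) (_ : R) => 0 : R) j).
    by apply: ps_ball_cst_le; rewrite ?normr0// ltW.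
  have az j : ps_ball X (`|t| * V) (`|t| * V) (fun x : R => a j x - (fun (_ : nat) (_ : R) => 0 : R) j x).
    by apply: ps_ball_ext (aV j) => x _ _; rewrite subr0.
  have := ps_ball_bound (H _ _ _ aV z az) X0; rewrite normr0 divr_ge0 ?(ltW tV)// => /(_ isT).
  rewrite (E0 i iN) subr0.
  have -> : lin NN (l i) (fun j => a j 0 - 0) = t * lin NN (l i) v.
    rewrite /lin mulr_sumr; apply: eq_bigr => j _.
    by rewrite /a ltn_ord subr0 mulrCA.
  have i2 : (i.+2 < NN)%N := iN; have i1 : (i.+1 < NN)%N := ltnW i2.
  rewrite (vl i iN) mulr0 subr0 /E /a addr0 (ltnW i1) i1 i2.
  move=> /le_trans; apply.
  by rewrite -(real_normK (num_real t)) !expr2; nra.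
have [rho [rho0 Hrho]] := solution_identity X0 Hl E0 nd gF F0.
have uniq x : is_min (P eps0) n w x -> x 0%N = th0 ->
    forall i, (i <= n)%N -> x i = xs i.
  move=> xm x0; have F2 := circle_follow sf0 w0 ci xm.
  by elim=> [_|i IH iN]; [rewrite x0 xs0|rewrite F2// follow// IH// ltnW].
have [d1 [d10 H1]] := min_close sfP anP anDP w0 wn I0 rho0 xsm xs0 uniq.
have [r [delta [r0 rd1 delta0 H2]]] := Hrho d1 d10.
pose d := Num.min (r / 2) (Num.min delta d1).
have [k1 k2 k3] : [/\ d <= r / 2, d <= delta & d <= d1].
  by split; rewrite !ge_min lexx ?orbT.
exists d; split; first by rewrite !lt_min delta0 d10 divr_gt0.
move=> eps1 x1 Ie1 ed1 x1m x1d.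
pose th1 := x1 0%N; pose tau := th1 - th0.
have taud : `|tau| <= delta by exact: le_trans k2.
(* An arbitrary choice of minimizers with base point [th1], except that [x1] is imposed at
  [eps1]. *)
have /choice[z Hz] : forall eps, exists x, I eps ->
    [/\ is_min (P eps) n w x, x 0%N = th1 & eps = eps1 -> x = x1].
  move=> eps; have [->|ne] := eqVneq eps eps1; first by exists x1.
  have [Ie|nI] := pselect (I eps); last by exists x1.
  have [y [y0 ym _]] := valueP sfP anP anDP w0 wn th1 Ie.
  by exists y => _; split=> // Ee; rewrite Ee eqxx in ne.
pose alpha (x : R) (i : nat) := if (i <= n)%N then z (eps0 + x) i - xs i else 0.
have alphaE (x : R) i : (i <= n)%N -> xs i + alpha x i = z (eps0 + x) i.
  by move=> iN; rewrite /alpha iN subrKC.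
have FE (x : R) : X x -> F x (alpha x) = 0 <-> closes (eps0 + x) (z (eps0 + x)).
  move=> Xx; have [zm _ _] := Hz _ Xx.
  by rewrite resid_closing// /F !alphaE// addrAC alphaE.
have := H2 tau taud alpha _ _ (eps1 - eps0).
rewrite /X subrKC => H3.
suff : F (eps1 - eps0) (alpha (eps1 - eps0)) = 0.
  by move=> /FE; rewrite /X subrKC => /(_ Ie1); have [_ _ ->] := Hz eps1 Ie1.
apply: H3 => //; last exact: le_trans k1.
- move=> x Xx xr; have [zm z0 _] := Hz _ Xx.
  have [[zn _] _] := zm.
  split.
  + by rewrite /alpha/= z0 xs0.
  + by rewrite /alpha leqnn zn xsn z0 xs0 /tau; ring.
  + by move=> i iN; rewrite /alpha leqNgt iN.
  + move=> i; rewrite /alpha; case: ifP => [iN|_]; last by rewrite normr0 ltW.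
    apply: (H1 (eps0 + x) th1) => //; last exact: le_trans k3.
    by rewrite addrAC subrr add0r; lra.
  + move=> i iN; have i2 : (i.+2 <= n)%N := iN; have i1 : (i.+1 <= n)%N := ltnW i2.
    by rewrite /E (alphaE _ _ i2) (alphaE _ _ i1) (alphaE _ _ (ltnW i1)); exact: resid_min.
- move=> e e0; have [eps [Ie ne ee fl1]] := acc e e0.
  exists (eps - eps0); split=> //; first by rewrite subrKC.
    by rewrite subr_eq0.
  have Xe : X (eps - eps0) by rewrite /X subrKC.
  move=> _; apply/FE => //; rewrite subrKC; apply: flat_closes => //.
  by have [] := Hz eps Ie.
Qed.

(** Used for translations by a period in either direction. *)
Lemma is_min_translate (p : R -> R) k m x : (forall t, p (t + k) = p t) ->
  is_min p m w x -> is_min p m w (fun i => x i + k).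
Proof.
move=> pk [[xm gap] H].
have act y : action p m (fun i => y i + k) = action p m y.
  by apply: eq_bigr => i _; rewrite (gen_w pk).
split; first by split=> [|i im]; rewrite ?xm ?shiftB ?gap//; ring.
move=> y [ym gy] y0; rewrite act.
have -> : action p m y = action p m (fun i => y i - k).
  by rewrite -(act (fun i => y i - k)); apply: eq_bigr => i _; rewrite !subrK.
apply: H; last by rewrite y0 addrK.
by split=> [|i im]; rewrite ?ym ?shiftB ?gy//; ring.
Qed.

Lemma near_dist_le (t d : R) : 0 < d -> \forall s \near t, `|t - s| <= d.
Proof. by move=> d0; apply/nbhs_ballP; exists d => // s /= /ltW. Qed.

(** [closing_flat], the minimal action of the family being continuous. *)
Lemma closes_flat eps : I eps ->
  (forall x, is_min (P eps) n w x -> closes eps x) -> flat_at P N w eps.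
Proof.
move=> Ie H; apply: (closing_flat (sfP Ie) w0 (pw Ie) (dpw Ie)
  (M := value sfP anP anDP w0 wn eps)).
- by move=> th; exact: valueP.
- move=> t; apply/cvgrPdist_lt => e e0.
  have [d1 [d10 Hd]] := value_continuous sfP anP anDP w0 wn t Ie e0.
  have ee : `|eps - eps| <= d1 by rewrite subrr normr0 ltW.
  apply: filterS (near_dist_le t d10) => s st.
  by rewrite distrC; apply: Hd => //; rewrite distrC.
- exact: H.
Qed.

Lemma circle_flat eps g u : I eps -> circle (P eps) (DP eps) N w g u ->
  flat_at P N w eps.
Proof.
move=> Ie ci; apply: closes_flat => // x.
exact: (circle_closing (sfP Ie) w0 (pw Ie) (dpw Ie) ci).
Qed.

(** The radius of [local_closing] is made uniform over one period of base points, then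
  translated to all of them. *)
Lemma flat_open eps0 : I eps0 -> flat_at P N w eps0 ->
  (forall d, 0 < d -> exists eps,
     [/\ I eps, eps != eps0, `|eps - eps0| < d & flat_at P N w eps]) ->
  exists d, 0 < d /\ forall eps, I eps -> `|eps - eps0| <= d -> flat_at P N w eps.
Proof.
move=> I0 fl0 acc.
pose Q d th := forall eps, I eps -> `|eps - eps0| <= d -> forall x,
  is_min (P eps) n w x -> x 0%N = th -> closes eps x.
have [||d [d0 Hd]] := compact_uniform (Q := Q) (segment_compact (a := 0) (b := 2 * pi)).
- by move=> d d' y _ dd H eps Ie ed; apply: H => //; exact: le_trans dd.
- move=> th _; have [d [d0 H]] := local_closing th I0 fl0 acc.
  exists d; split=> //; near=> y => eps Ie ed x xm xy; apply: H => //.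
  by rewrite xy distrC; near: y; exact: near_dist_le.
exists d; split=> // eps Ie ed.
apply: closes_flat => // x xm.
(* The property is periodic in the base point; [f] is its indicator function. *)
pose f th : R :=
  (`[<forall x, is_min (P eps) n w x -> x 0%N = th -> closes eps x>])%:R.
have step k th : (forall t, P eps (t + k) = P eps t) -> (forall t, DP eps (t + k) = DP eps t) ->
    (forall x, is_min (P eps) n w x -> x 0%N = th + k -> closes eps x) ->
    forall x, is_min (P eps) n w x -> x 0%N = th -> closes eps x.
  move=> pk dpk H y ym y0; have := H _ (is_min_translate pk ym).
  by rewrite y0 /closes (fwd_w pk dpk) (bwd_w pk dpk); apply.
have per := sf_per (sfP Ie); have dper := dp_per (sfP Ie).
have fper th : f (th + 2 * pi) = f th.
  rewrite /f; congr (_%:R); congr (nat_of_bool _); apply/asboolP/asboolP.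
    exact: step.
  move=> H; apply: (step (- (2 * pi))) => [t|t|].
  + by rewrite -per subrK.
  + by rewrite -dper subrK.
  + by rewrite addrK.
have [s [s2 fs]] := periodic_reduce fper (x 0%N).
have : f s = 1.
  rewrite /f; case: asboolP => // H; exfalso; apply: H => y ym ys.
  by apply: (Hd s _ eps) => //=; rewrite in_itv.
rewrite fs /f; case: asboolP => [H _|_ /eqP]; first exact: H.
by rewrite eq_sym oner_eq0.
Unshelve. all: by end_near.
Qed.
End OpenStep.

(** * The identity principle for flatness *)

Section Dichotomy.
Context {R : realType}.

(** Connectedness of the interval. *)
Lemma interval_clopen (I A : set R) a : is_interval I -> I a -> A a -> A `<=` I ->
  (forall x, I x -> (forall d, 0 < d -> exists y, A y /\ `|y - x| <= d) -> A x) ->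
  (forall x, A x -> exists d, 0 < d /\ forall y, I y -> `|y - x| <= d -> A y) ->
  I `<=` A.
Proof.
move=> /connected_intervalP cI Ia Aa AI cl op.
suff -> : A = I by [].
apply: cI; first by exists a.
  exists (interior (A `|` ~` I)); first exact: open_interior.
  apply/seteqP; split=> [x Ax|x [Ix /interior_subset[]//]].
  split; first exact: AI.
  have [d [d0 H]] := op x Ax; apply: filterS (near_dist_le x d0) => y yx.
  by have [Iy|nIy] := pselect (I y); [left; apply: H => //; rewrite distrC|right].
exists (closure A); first exact: closed_closure.
apply/seteqP; split=> [x Ax|x [Ix cx]]; first by split; [exact: AI|exact: subset_closure].
apply: cl => // d d0; have [y [Ay yd]] := cx _ (near_dist_le x d0).
by exists y; rewrite distrC.
Qed.

Context (I : set R) (P DP : R -> R -> R) (Iitv : is_interval I).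
Hypothesis sfP : forall eps, I eps -> support_fun (P eps) (DP eps).
Hypothesis (anP : analytic_fam I P) (anDP : analytic_fam I DP).
Context (N : nat) (w : R) (w0 : 0 < w).
Hypothesis wn : w < pi * N.+2%:R.
Hypothesis pw : forall eps, I eps -> forall t, P eps (t + w) = P eps t.
Hypothesis dpw : forall eps, I eps -> forall t, DP eps (t + w) = DP eps t.

(** The flat parameters at which flat parameters accumulate form a relatively open and
  closed set: a neighbourhood of flat parameters in an interval consists of
  accumulation points. *)
Lemma flat_identity eps0 : I eps0 -> flat_at P N w eps0 ->
  (forall d, 0 < d -> exists eps,
     [/\ I eps, eps != eps0, `|eps - eps0| < d & flat_at P N w eps]) ->
  forall eps, I eps -> flat_at P N w eps.
Proof.
move=> I0 fl0 acc0.
pose acc e := forall d, 0 < d -> exists eps,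
  [/\ I eps, eps != e, `|eps - e| < d & flat_at P N w eps].
pose A := [set e | [/\ I e, flat_at P N w e & acc e]].
have sub : I `<=` A.
  apply: (interval_clopen Iitv I0) => //.
  - by move=> e [].
  - move=> e Ie H; have [//|nA] := pselect (A e); split=> //.
      apply: (flat_closed sfP anP anDP w0 wn Ie) => d d0.
      by have [y [[Iy fy _] yd]] := H d d0; exists y.
    move=> d d0; have [|y [[Iy fy ay] yd]] := H (d / 2); first by rewrite divr_gt0.
    have [ye|ye] := eqVneq y e; first by rewrite -ye; exact: ay.
    by exists y; split=> //; lra.
  - move=> e [Ie fe ae].
    have [d [d0 Hd]] := flat_open sfP anP anDP w0 wn pw dpw Ie fe ae.
    exists (d / 2); split=> [|y Iy yd]; first by rewrite divr_gt0.
    split=> //; first by apply: Hd => //; lra.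
    move=> r r0; have [->|ye] := eqVneq y e; first exact: ae.
    have n0 : 0 < `|e - y| by rewrite normr_gt0 subr_eq0 eq_sym.
    pose t := Num.min 1 (r / (2 * `|e - y|)).
    have t0 : 0 < t by rewrite lt_min ltr01 divr_gt0// mulr_gt0.
    have [t1 t2] : t <= 1 /\ t <= r / (2 * `|e - y|) by rewrite !ge_min !lexx orbT.
    pose z := y + t * (e - y).
    have zy : `|z - y| < r.
      rewrite /z addrAC subrr add0r normrM gtr0_norm//.
      rewrite ler_pdivlMr ?mulr_gt0// in t2; nra.
    have Iz : I z.
      have [ey|ey] := lerP e y.
        by apply: (Iitv Ie Iy); apply/andP; split; rewrite /z; nra.
      by apply: (Iitv Iy Ie); apply/andP; split; rewrite /z; nra.
    exists z; split=> //.
      rewrite /z -subr_eq0 addrAC subrr add0r.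
      by apply: mulf_neq0; [rewrite gt_eqF|rewrite subr_eq0 eq_sym].
    apply: Hd => //.
    have -> : z - e = (1 - t) * (y - e) by rewrite /z; ring.
    by rewrite normrM ger0_norm ?subr_ge0//; have := normr_ge0 (y - e); nra.
by move=> e /sub[].
Qed.
End Dichotomy.

(** * Normal and tangential coordinates *)

Section PlaneCurves.
Context {R : realType}.
Implicit Types (g : R -> plane R) (f : R -> R).

(** Turns the two fields of a derivative into one limit, which can be taken
  componentwise. *)
Lemma is_deriveP (V : normedModType R) (f : R -> V) t l : is_derive t (1 : R) f l <->
  (fun h : R => h^-1 *: (f (h *: 1 + t) - f t)) @ 0^' --> l.
Proof.
split=> [[dv <-]|H]; first exact: dv.
by split; [apply/cvg_ex; exists l|exact: cvg_lim].
Qed.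

Lemma drv_plane g t v : is_derive t (1 : R) g v <->
  is_derive t (1 : R) (fun s => (g s).1) v.1 /\ is_derive t (1 : R) (fun s => (g s).2) v.2.
Proof.
split=> [/is_deriveP H|[/is_deriveP H1 /is_deriveP H2]].
  split; apply/is_deriveP.
    exact: (cvg_comp _ _ H (@cvg_fst _ _ (nbhs v.1) (nbhs v.2) _)).
  exact: (cvg_comp _ _ H (@cvg_snd _ _ (nbhs v.1) (nbhs v.2) _)).
apply/is_deriveP; case: v H1 H2 => v1 v2 /= H1 H2.
exact: (cvg_pair H1 H2).
Qed.
End PlaneCurves.

Section NormalCoordinates.
Context {R : realType}.
Implicit Types (x y v : plane R) (theta : R).

(** Coordinates with respect to the outer normal at angle [theta] and to the tangent
  direction [dir theta]. *)
Definition normal_coord theta v : R := v.1 * cos theta + v.2 * sin theta.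
Definition tangent_coord theta v : R := v.2 * cos theta - v.1 * sin theta.
Local Notation nc := normal_coord.
Local Notation tc := tangent_coord.

Lemma ncD theta x y : nc theta (x + y) = nc theta x + nc theta y.
Proof. by rewrite /nc /=; ring. Qed.
Lemma ncN theta x : nc theta (- x) = - nc theta x.
Proof. by rewrite /nc /=; ring. Qed.
Lemma ncB theta x y : nc theta (x - y) = nc theta x - nc theta y.
Proof. by rewrite ncD ncN. Qed.
Lemma ncZ theta (k : R) x : nc theta (k *: x) = k * nc theta x.
Proof. by rewrite /nc /= /GRing.scale/=; ring. Qed.
Lemma tcD theta x y : tc theta (x + y) = tc theta x + tc theta y.
Proof. by rewrite /tc /=; ring. Qed.
Lemma tcN theta x : tc theta (- x) = - tc theta x.
Proof. by rewrite /tc /=; ring. Qed.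
Lemma tcB theta x y : tc theta (x - y) = tc theta x - tc theta y.
Proof. by rewrite tcD tcN. Qed.
Lemma tcZ theta (k : R) x : tc theta (k *: x) = k * tc theta x.
Proof. by rewrite /tc /= /GRing.scale/=; ring. Qed.

Lemma nc0 theta : nc theta 0 = 0. Proof. by rewrite /nc /= !mul0r addr0. Qed.
Lemma tc0 theta : tc theta 0 = 0. Proof. by rewrite /tc /= !mul0r subr0. Qed.

Lemma nc_dir theta phi : nc phi (dir theta) = sin (phi - theta).
Proof. by rewrite /nc /dir /= sinB; ring. Qed.
Lemma tc_dir theta phi : tc phi (dir theta) = cos (phi - theta).
Proof. by rewrite /tc /dir /= cosB; ring. Qed.
Lemma nc_rot90 theta v : nc theta (rot90 v) = - tc theta v.
Proof. by rewrite /nc /tc /rot90 /=; ring. Qed.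
Lemma tc_rot90 theta v : tc theta (rot90 v) = nc theta v.
Proof. by rewrite /nc /tc /rot90 /=; ring. Qed.

Lemma plane_eq theta x y : nc theta x = nc theta y -> tc theta x = tc theta y -> x = y.
Proof.
move=> En Et; have C := cos2Dsin2 theta.
have E1 z : z.1 = nc theta z * cos theta - tc theta z * sin theta :> R.
  have -> : nc theta z * cos theta - tc theta z * sin theta =
    z.1 * (cos theta ^+ 2 + sin theta ^+ 2) by rewrite /nc /tc; ring.
  by rewrite C mulr1.
have E2 z : z.2 = nc theta z * sin theta + tc theta z * cos theta :> R.
  have -> : nc theta z * sin theta + tc theta z * cos theta =
    z.2 * (cos theta ^+ 2 + sin theta ^+ 2) by rewrite /nc /tc; ring.
  by rewrite C mulr1.
by apply: injective_projections; rewrite ?E1 ?E2 En Et.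
Qed.

Lemma enorm_coord theta v : enorm v = Num.sqrt (nc theta v ^+ 2 + tc theta v ^+ 2).
Proof.
rewrite /enorm; congr Num.sqrt; have C := cos2Dsin2 theta.
have -> : nc theta v ^+ 2 + tc theta v ^+ 2 =
  (v.1 ^+ 2 + v.2 ^+ 2) * (cos theta ^+ 2 + sin theta ^+ 2) by rewrite /nc /tc; ring.
by rewrite C mulr1.
Qed.

Lemma dir_neq0 theta : dir theta != 0 :> plane R.
Proof.
apply/eqP => E; have := tc_dir theta theta; rewrite E subrr cos0.
by rewrite /tc /= !mul0r subr0 => /eqP; rewrite eq_sym oner_eq0.
Qed.

(** Through the arccosine, according to the sign of the first coordinate. *)
Lemma polar_dir v : v != 0 -> exists s theta, 0 < s /\ v = s *: dir theta.
Proof.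
move=> v0; pose s := enorm v.
have n0 : 0 < v.1 ^+ 2 + v.2 ^+ 2.
  rewrite lt_neqAle addr_ge0 ?sqr_ge0// andbT eq_sym paddr_eq0 ?sqr_ge0//.
  rewrite !sqrf_eq0; apply: contraNN v0 => /andP[/eqP a /eqP b].
  by apply/eqP/injective_projections.
have s0 : 0 < s by rewrite sqrtr_gt0.
have s2 : s ^+ 2 = v.1 ^+ 2 + v.2 ^+ 2 by rewrite sqr_sqrtr// ltW.
have sn : s != 0 by rewrite gt_eqF.
pose c := v.2 / s.
have c1 : -1 <= c <= 1.
  rewrite -ler_norml -(@ler_pXn2r _ 2)// ?nnegrE//.
  rewrite real_normK ?num_real// expr1n /c exprMn exprVn s2 ler_pdivrMr// mul1r.
  by rewrite lerDr sqr_ge0.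
have c2 : 0 <= 1 - c ^+ 2 by rewrite subr_ge0; nra.
have cs := acosK c1; have sn2 := sin_acos c1.
have E2 : s * c = v.2 by rewrite /c mulrCA divff// mulr1.
have E1 : s * Num.sqrt (1 - c ^+ 2) = `|v.1|.
  rewrite -[LHS]ger0_norm ?mulr_ge0 ?sqrtr_ge0 ?(ltW s0)//.
  apply/eqP; rewrite -(@eqrXn2 _ 2)// ?normr_ge0// !real_normK ?num_real// exprMn.
  by rewrite (sqr_sqrtr c2) mulrBr mulr1 -exprMn E2 s2 addrK eqxx.
have [v1|v1] := lerP v.1 0.
  exists s, (acos c); split=> //; apply: injective_projections => /=.
    by rewrite sn2 /GRing.scale/= mulrN E1 ler0_norm// opprK.
  by rewrite cs /GRing.scale/= E2.
exists s, (- acos c); split=> //; apply: injective_projections => /=.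
  by rewrite sinN sn2 opprK /GRing.scale/= E1 gtr0_norm.
by rewrite cosN cs /GRing.scale/= E2.
Qed.
End NormalCoordinates.

(** * Extremal points of a strictly convex domain *)

Local Notation nc := normal_coord.
Local Notation tc := tangent_coord.

Section CriticalPoints.
Context {R : realType}.

(** Fermat's rule. *)
Lemma drv_at_max (f df : R -> R) t : (forall s, is_derive s (1 : R) f (df s)) ->
  (forall s, f s <= f t) -> df t = 0.
Proof.
move=> fd fmax.
have t1 : t \in `](t - 1), (t + 1)[ by rewrite in_itv/=; apply/andP; split; lra.
have := derive1_at_max (f := f) (a := t - 1) (b := t + 1) (c := t) ltac:(lra).
move=> /(_ (fun s _ => @ex_derive _ _ _ _ _ _ _ (fd s)) t1 (fun s _ => fmax s)).
exact: is_derive_unique (fd t).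
Qed.

Lemma drv_small (f : R -> R) x l k : is_derive x (1 : R) f l -> 0 < k ->
  exists d, 0 < d /\ forall t, `|t - x| < d -> `|f t - f x - l * (t - x)| <= k * `|t - x|.
Proof.
move=> fl k0; have H : is_derive x (1 : R) (fun t => f t - l * t) 0.
  apply: (drv_ext (f := fun t => f t - l * t)) (drv_sub fl (drv_mul (drv_cst x l) (drv_id x))) => //.
  by ring.
have [d [d0 Hd]] := drv0_small H k0; exists d; split=> // t /Hd; congr (`|_| <= _); ring.
Qed.
End CriticalPoints.

Lemma drv_nc {R : realType} phi (g : R -> plane R) t v : is_derive t (1 : R) g v ->
  is_derive t (1 : R) (fun s => nc phi (g s)) (nc phi v).
Proof.
move=> /drv_plane[d1 d2].
apply: drv_ext (drv_add (drv_mul d1 (drv_cst t (cos phi))) (drv_mul d2 (drv_cst t (sin phi)))) => //.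
by rewrite /nc; ring.
Qed.

Lemma drv_tc {R : realType} phi (g : R -> plane R) t v : is_derive t (1 : R) g v ->
  is_derive t (1 : R) (fun s => tc phi (g s)) (tc phi v).
Proof.
move=> /drv_plane[d1 d2].
apply: drv_ext (drv_sub (drv_mul d2 (drv_cst t (cos phi))) (drv_mul d1 (drv_cst t (sin phi)))) => //.
by rewrite /tc; ring.
Qed.

Lemma nc_comb {R : realType} phi (k : R) (a b x : plane R) :
  nc phi ((1 - k) *: a + k *: b - x) = (1 - k) * nc phi (a - x) + k * nc phi (b - x).
Proof. by rewrite !ncB !ncD !ncZ; ring. Qed.

Lemma tc_comb {R : realType} phi (k : R) (a b x : plane R) :
  tc phi ((1 - k) *: a + k *: b - x) = (1 - k) * tc phi (a - x) + k * tc phi (b - x).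
Proof. by rewrite !tcB !tcD !tcZ; ring. Qed.

Section ConvexTable.
Context {R : realType} (Om : set (plane R)).
Hypothesis (sc : strictly_convex_domain Om).
Implicit Types (x y z v : plane R) (theta t : R).

Lemma Om_interior : interior Om = Om.
Proof. by have [oO _ _ _] := sc; exact/interior_id. Qed.

Lemma segment_in x y t : closure Om x -> closure Om y -> x != y -> 0 < t < 1 ->
  Om ((1 - t) *: x + t *: y).
Proof. by have [_ _ _ H] := sc => cx cy xy t01; rewrite -Om_interior; exact: H. Qed.

Lemma boundary_closure x : boundary Om x -> closure Om x. Proof. by case. Qed.

Lemma boundary_notin x : boundary Om x -> ~ Om x.
Proof. by rewrite /boundary Om_interior => -[]. Qed.

Lemma closure_compact : compact (closure Om).
Proof.
have [_ _ [M [_ HM]] _] := sc.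
pose K := M + 1.
have OK : Om `<=` [set` `[- K, K] ] `*` [set` `[- K, K] ].
  move=> x Ox; have /= := HM K ltac:(rewrite /K; lra) x Ox.
  rewrite prod_normE ge_max => /andP[k1 k2].
  by split; rewrite /= in_itv /= -ler_norml.
apply: (@subclosed_compact _ _ ([set` `[- K, K] ] `*` [set` `[- K, K] ])).
- exact: closed_closure.
- by apply: compact_setX; exact: segment_compact.
- rewrite closureE => x; apply; split=> //.
  have -> : [set` `[- K, K] ] `*` [set` `[- K, K] ] =
    (@fst R R @^-1` [set` `[- K, K] ]) `&` (@snd R R @^-1` [set` `[- K, K] ]) by [].
  by apply: closedI; apply: closed_comp => [z _|]; [exact: cvg_fst|exact: interval_closed|exact: cvg_snd|exact: interval_closed].
Qed.

Lemma nc_continuous theta : continuous (nc theta : plane R -> R).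
Proof.
move=> x; rewrite /normal_coord; apply: cvgD; apply: cvgM; try exact: cvg_cst.
  exact: cvg_fst.
exact: cvg_snd.
Qed.

(** Such a point has the given direction as an outer normal. *)
Definition extremal theta x :=
  closure Om x /\ forall y, closure Om y -> nc theta y <= nc theta x.

Lemma extremal_exists theta : exists x, extremal theta x.
Proof.
have [_ [x0 Ox0] _ _] := sc.
have [||x Kx H] := compact_EVT_max (f := nc theta) (A := closure Om) _ closure_compact.
- by exists x0; exact: subset_closure.
- by apply: continuous_subspaceT; exact: nc_continuous.
by exists x; split=> [|y Ky]; [exact: set_mem|apply: H; exact: mem_set].
Qed.

(** An interior point can be moved in the direction of the normal. *)
Lemma inner_improve theta x : Om x -> exists y, Om y /\ nc theta x < nc theta y.
Proof.
rewrite -{1}Om_interior => /nbhs_ballP[e /= e0 He].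
pose y := x + (e / 2) *: (cos theta, sin theta) : plane R.
exists y; split.
  apply: He; split; rewrite /ball /= /GRing.scale /= opprD addNKr normrN normrM.
    have := cos_norm_le1 theta; rewrite gtr0_norm; last by rewrite divr_gt0.
    by have := normr_ge0 (cos theta); nra.
  have := sin_norm_le1 theta; rewrite gtr0_norm; last by rewrite divr_gt0.
  by have := normr_ge0 (sin theta); nra.
rewrite /y ncD ncZ /nc /= -!expr2 cos2Dsin2 mulr1; lra.
Qed.

Lemma extremal_boundary theta x : extremal theta x -> boundary Om x.
Proof.
move=> [cx xm]; split=> //; rewrite Om_interior => Ox.
have [y [Oy]] := inner_improve theta Ox; apply/negP; rewrite -leNgt.
by apply: xm; exact: subset_closure.
Qed.

(** The midpoint of two extremal points would be interior by strict convexity. *)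
Lemma extremal_unique theta x y : extremal theta x -> closure Om y ->
  nc theta x <= nc theta y -> y = x.
Proof.
move=> [cx xm] cy xy; apply/eqP; apply/negP => /negP ne.
have [z [Oz]] := inner_improve theta (segment_in (t := 2^-1) cy cx ne ltac:(apply/andP; split; lra)).
apply/negP; rewrite -leNgt; apply: le_trans (xm _ (subset_closure Oz)) _.
by rewrite ncD !ncZ; lra.
Qed.

Lemma extremal_lt theta x y : extremal theta x -> closure Om y -> y != x ->
  nc theta y < nc theta x.
Proof. by move=> xm cy; rewrite ltNge; apply: contraNN => /(extremal_unique xm cy) ->. Qed.

(** If a boundary curve has velocity [dir theta] at [x], the domain contains points on
  the normal line of [x], on the same side as any given [y] off the tangent line.
  Indeed a point of the curve on the side of [x] opposite to [y] can be joined to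
  [y]; the segment crosses the normal line, and as the curve is tangent to
  [dir theta] the crossing is dominated by the contribution of [y]. *)
Lemma tangent_crossing theta x y (g : R -> plane R) :
  closure Om x -> closure Om y -> g 0 = x ->
  is_derive (0 : R) (1 : R) g (dir theta) -> (\forall t \near (0 : R), boundary Om (g t)) ->
  nc theta (y - x) != 0 ->
  exists z, [/\ Om z, tc theta (z - x) = 0 & 0 < nc theta (z - x) * nc theta (y - x)].
Proof.
move=> cx cy g0 gd gb; set h := nc theta (y - x) => h0; pose u := tc theta (y - x).
have h2 : 0 < h ^+ 2 by rewrite exprn_even_gt0.
have yx : x != y by apply: contraNneq h0 => E; rewrite /h E subrr nc0.
have [u0|u0] := eqVneq u 0.
  exists ((1 - 2^-1) *: x + 2^-1 *: y); split.
  - by apply: segment_in => //; apply/andP; split; lra.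
  - by rewrite tc_comb -/u u0 subrr tc0 !mulr0 addr0.
  - by rewrite nc_comb -/h subrr nc0 mulr0 add0r -mulrA -expr2 mulr_gt0.
have h0' : 0 < `|h| by rewrite normr_gt0.
have u0' : 0 < `|u| by rewrite normr_gt0.
(* With this tolerance the normal coordinate of [g t] cannot compensate that of [y]. *)
pose e := `|h| / (4 * `|u|).
have e0 : 0 < e by rewrite divr_gt0// mulr_gt0.
have [d1 [d10 H1]] := drv_small (drv_tc theta gd) (k := 2^-1) ltac:(lra).
have [d2 [d20 H2]] := drv_small (drv_nc theta gd) e0.
move/nbhs_ballP: (gb) => [d3 /= d30 H3].
pose d := Num.min d1 (Num.min d2 d3).
have d0 : 0 < d by rewrite !lt_min d10 d20 d30.
pose tau := d / (2 * `|u|); have tau0 : 0 < tau by rewrite divr_gt0// mulr_gt0.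
(* The sign of [t] puts [g t] on the side of the normal line opposite to [y]. *)
pose t := - u * tau.
have tE : `|t| = d / 2.
  by rewrite normrM normrN [`|tau|]gtr0_norm// /tau; field; rewrite gt_eqF.
have td : `|t - 0| < d by rewrite subr0 tE; lra.
have [k1 k2 k3] : [/\ d <= d1, d <= d2 & d <= d3] by split; rewrite !ge_min lexx ?orbT.
have := H1 t (lt_le_trans td k1); have := H2 t (lt_le_trans td k2).
rewrite g0 tc_dir nc_dir !subrr sin0 cos0 mul0r mul1r !subr0 -ncB -tcB => Hb Ha.
have gc : closure Om (g t).
  by apply/boundary_closure/H3; rewrite /ball /= sub0r normrN -(subr0 t); exact: lt_le_trans k3.
pose al := tau + (tc theta (g t - x) - t) / - u.
set b := nc theta (g t - x) in Hb *.
have aE : tc theta (g t - x) = - u * al.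
  by rewrite /al mulrDr -/t mulrCA divff ?oppr_eq0// mulr1; ring.
have al1 : tau / 2 <= al.
  have : `|(tc theta (g t - x) - t) / - u| <= tau / 2.
    rewrite normrM normfV normrN ler_pdivrMr//; apply: le_trans Ha _.
    by rewrite normrM normrN [`|tau|]gtr0_norm//; nra.
  by rewrite ler_norml /al => /andP[? _]; lra.
have al0 : 0 < al by lra.
have l1 : 1 + al != 0 by rewrite gt_eqF//; lra.
pose k := al / (1 + al).
have k01 : 0 < k < 1.
  by apply/andP; split; rewrite /k ?ltr_pdivrMr ?divr_gt0//; lra.
have gy : g t != y.
  apply/eqP => E; move: aE; rewrite E -/u => aE.
  have : u * (1 + al) = 0 by rewrite mulrDr mulr1 {1}aE; ring.
  by move/eqP; rewrite mulf_eq0 (negPf u0) (negPf l1).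
exists ((1 - k) *: g t + k *: y); split.
- exact: segment_in.
- by rewrite tc_comb aE -/u /k; field.
- rewrite nc_comb -/h -/b.
  have -> : ((1 - k) * b + k * h) * h = (b * h + al * h ^+ 2) / (1 + al) by rewrite /k; field.
  apply: divr_gt0; last by lra.
  have bh : - (tau * h ^+ 2 / 4) <= b * h.
    have : `|b * h| <= tau * h ^+ 2 / 4.
      rewrite normrM; apply: le_trans (ler_wpM2r (normr_ge0 h) Hb) _.
      rewrite /e tE -(real_normK (num_real h)) le_eqVlt; apply/orP; left; apply/eqP.
      by rewrite /tau; field; rewrite gt_eqF.
    by rewrite ler_norml => /andP[].
  by nra.
Qed.
End ConvexTable.

(** * Tangent points *)

Section TangentPoints.
Context {R : realType} (Om : set (plane R)).
Hypothesis (sc : strictly_convex_domain Om).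
Implicit Types (x y z v : plane R) (theta t : R).

(** Reparametrize the boundary curve and the inward ray. *)
Lemma pos_tangent_scale k x v : 0 < k -> pos_tangent Om x v -> pos_tangent Om x (k *: v).
Proof.
move=> k0 [bx v0 [g [g0 gd gb]] ray]; split=> //.
- by rewrite scaler_eq0 negb_or v0 gt_eqF.
- exists (fun t => g (k * t)); split; first by rewrite mulr0.
  + have kd : is_derive (0 : R) (1 : R) (fun t => k * t) k.
      by apply: drv_ext (drv_mul (drv_cst 0 k) (drv_id 0)) => //; ring.
    have /drv_plane[d1 d2] := gd.
    apply/drv_plane; split.
      rewrite -{1}(mulr0 k) in d1.
      by apply: drv_ext (drv_comp kd d1) => //; rewrite mulrC.
    rewrite -{1}(mulr0 k) in d2.
    by apply: drv_ext (drv_comp kd d2) => //; rewrite mulrC.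
  + move/nbhs_ballP: gb => [d /= d0 H]; apply/nbhs_ballP; exists (d / k); first exact: divr_gt0.
    move=> t /=; rewrite /ball/= sub0r normrN ltr_pdivlMr// => td.
    by apply: H; rewrite /ball/= sub0r normrN normrM gtr0_norm// mulrC.
- move/nbhs_ballP: ray => [d /= d0 H]; apply/nbhs_ballP; exists (d / k); first exact: divr_gt0.
  move=> t /=; rewrite /ball/= sub0r normrN ltr_pdivlMr// => td t0.
  have -> : x + t *: rot90 (k *: v) = x + (k * t) *: rot90 v.
    by apply: injective_projections; rewrite /= /GRing.scale/=; ring.
  apply: H; last by rewrite mulr_gt0.
  by rewrite /ball/= sub0r normrN normrM gtr0_norm// mulrC.
Qed.

(** A point of the domain beyond the tangent line would give, by [tangent_crossing], an
  inner point on the outer normal ray; as the inward ray is also inner, the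
  boundary point would be inner by convexity. *)
Lemma pos_tangent_extremal theta x : pos_tangent Om x (dir theta) -> extremal Om theta x.
Proof.
move=> [bx _ [g [g0 gd gb]] ray]; have cx := boundary_closure bx.
split=> // y cy; rewrite leNgt; apply/negP => xy.
have h0 : 0 < nc theta (y - x) by rewrite ncB; lra.
have [z [Oz tz]] := tangent_crossing sc cx cy g0 gd gb (lt0r_neq0 h0).
rewrite pmulr_lgt0// => nz.
move/nbhs_ballP: ray => [d /= d0 H].
have Ow := H (d / 2) ltac:(rewrite /ball/= sub0r normrN gtr0_norm; lra) ltac:(lra).
set w := (x + _) in Ow.
have tw : tc theta (w - x) = 0.
  by rewrite /w addrAC subrr add0r tcZ tc_rot90 nc_dir subrr sin0 mulr0.
have nw : nc theta (w - x) = - (d / 2).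
  by rewrite /w addrAC subrr add0r ncZ nc_rot90 tc_dir subrr cos0 mulrN1.
set r := nc theta (z - x) in nz.
have wz : w != z.
  apply: contraTneq nz => Ewz; rewrite /r -Ewz nw -leNgt; lra.
have rd : r + d / 2 != 0 by rewrite gt_eqF//; lra.
pose k := (d / 2) / (r + d / 2).
have k01 : 0 < k < 1.
  by apply/andP; split; rewrite /k ?ltr_pdivrMr ?divr_gt0//; lra.
apply: (boundary_notin sc bx).
suff -> : x = (1 - k) *: w + k *: z.
  by apply: (segment_in sc) => //; exact: subset_closure.
apply/eqP; rewrite eq_sym -subr_eq0; apply/eqP/(plane_eq (theta := theta)).
  rewrite nc_comb nw -/r nc0 /k; field.
  by apply: contraNneq rd => E; apply/eqP; lra.
by rewrite tc_comb tw tz !mulr0 addr0 tc0.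
Qed.

Hypothesis ab : analytic_boundary Om.

(** The normal coordinate is maximal along the boundary parametrization, so its
  velocity is tangential; rescaling makes it [dir theta]. The inward ray comes from
  [tangent_crossing] with an inner point. *)
Lemma extremal_pos_tangent theta x : extremal Om theta x -> pos_tangent Om x (dir theta).
Proof.
move=> xm; have bx := extremal_boundary sc xm; have cx := boundary_closure bx.
have [c [_ c'0 _ _ cE]] := ab.
have cb t : boundary Om (c t) by rewrite -cE; exists t.
have [t0 _ ct0] : range c x by rewrite cE.
have cd t : is_derive t (1 : R) c ('D_1 c t).
  split=> //; apply: contrapT => H.
  by have /eqP := c'0 t; apply; rewrite /derive dvgP.
have n0 : nc theta ('D_1 c t0) = 0.
  apply: (@drv_at_max _ (fun t => nc theta (c t)) (fun t => nc theta ('D_1 c t))) => [s|s].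
    exact: drv_nc.
  by rewrite ct0; apply: (proj2 xm); exact: boundary_closure.
pose k := tc theta ('D_1 c t0).
have cE0 : 'D_1 c t0 = k *: dir theta.
  by apply: (plane_eq (theta := theta)); rewrite ?ncZ ?tcZ ?nc_dir ?tc_dir subrr ?sin0 ?cos0 ?mulr0 ?mulr1.
have k0 : k != 0 by apply: contraNneq (c'0 t0) => E; rewrite cE0 E scale0r.
pose g t := c (t0 + t / k).
have g0 : g 0 = x by rewrite /g mul0r addr0.
have gd : is_derive (0 : R) (1 : R) g (dir theta).
  have kd : is_derive (0 : R) (1 : R) (fun t => t0 + t / k) k^-1.
    apply: drv_ext (drv_add (drv_cst 0 t0) (drv_mul (drv_id 0) (drv_cst 0 k^-1))) => //.
    by rewrite /=; ring.
  have t0E : t0 = t0 + 0 / k by rewrite mul0r addr0.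
  have /drv_plane[d1 d2] := cd t0; rewrite cE0 in d1 d2.
  apply/drv_plane; split.
    rewrite {1}t0E in d1.
    by apply: drv_ext (drv_comp kd d1) => //=; rewrite /GRing.scale /=; field.
  rewrite {1}t0E in d2.
  by apply: drv_ext (drv_comp kd d2) => //=; rewrite /GRing.scale /=; field.
have gb : \forall t \near (0 : R), boundary Om (g t) by apply: filterE => t; exact: cb.
split=> //; first exact: dir_neq0.
  by exists g.
have [_ [q Oq] _ _] := sc.
have Ox : nc theta q < nc theta x.
  apply: (extremal_lt sc xm (subset_closure Oq)).
  by apply: contra_not_neq (boundary_notin sc bx) => <-.
have h0 : nc theta (q - x) < 0 by rewrite ncB; lra.
have [z [Oz tz]] := tangent_crossing sc cx (subset_closure Oq) g0 gd gb (ltr0_neq0 h0).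
rewrite nmulr_lgt0// => nz; set r := nc theta (z - x) in nz.
apply/nbhs_ballP; exists (- r); first by rewrite /= oppr_gt0.
move=> s /=; rewrite /ball/= sub0r normrN => sr s0; rewrite gtr0_norm// in sr.
have -> : x + s *: rot90 (dir theta) = (1 - s / - r) *: x + (s / - r) *: z.
  apply/eqP; rewrite -(inj_eq (subIr x)); apply/eqP/(plane_eq (theta := theta)).
    rewrite nc_comb -/r subrr nc0 mulr0 add0r addrAC subrr add0r.
    by rewrite ncZ nc_rot90 tc_dir subrr cos0; field; rewrite lt_eqF.
  rewrite tc_comb tz subrr tc0 !mulr0 addr0 addrAC subrr add0r.
  by rewrite tcZ tc_rot90 nc_dir subrr sin0 mulr0.
apply: (segment_in sc) => //; first exact: subset_closure.
  by apply: contraTneq nz => E; rewrite /r -E subrr nc0 ltxx.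
by rewrite divr_gt0 ?oppr_gt0//= ltr_pdivrMr ?oppr_gt0// mul1r.
Qed.

Lemma alphaP theta : extremal Om theta (alpha Om theta).
Proof.
have [x xm] := extremal_exists sc theta.
apply: pos_tangent_extremal; apply: (getPex (P := [set x | pos_tangent Om x (dir theta)])).
by exists x; exact: extremal_pos_tangent.
Qed.

Lemma alpha_unique theta x : extremal Om theta x -> x = alpha Om theta.
Proof. by move=> [cx xm]; apply: (extremal_unique sc (alphaP theta)) => //; apply: xm; case: (alphaP theta). Qed.

Lemma pos_tangent_alpha theta x : pos_tangent Om x (dir theta) -> x = alpha Om theta.
Proof. by move/pos_tangent_extremal/alpha_unique. Qed.

Lemma alpha_pos_tangent theta : pos_tangent Om (alpha Om theta) (dir theta).
Proof. exact/extremal_pos_tangent/alphaP. Qed.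

End TangentPoints.

(** * The support function of a table *)

Section SupportFunction.
Context {R : realType} (Om : set (plane R)).
Hypothesis (sc : strictly_convex_domain Om) (ab : analytic_boundary Om).
Implicit Types (x y z v : plane R) (theta phi a b t : R).
Local Notation al := (alpha Om).

Lemma nc_rotate a b v : nc b v = nc a v * cos (b - a) + tc a v * sin (b - a).
Proof.
have C := cos2Dsin2 a; rewrite cosB sinB /nc /tc -[v.1 in LHS]mulr1 -[v.2 in LHS]mulr1 -C.
ring.
Qed.

Lemma dir_2pi theta (k : int) : dir (theta + 2 * pi * k%:~R) = dir theta :> plane R.
Proof.
have step t : dir (t + 2 * pi) = dir t :> plane R.
  by rewrite /dir sinD cosD mulr_natl cos2pi sin2pi; congr (_, _); ring.
have nat_step (j : nat) t : dir (t + 2 * pi * j%:R) = dir t :> plane R.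
  elim: j => [|j IH]; first by rewrite mulr0 addr0.
  by rewrite -(natr1 j) mulrDr mulr1 addrA step.
case: k => j; first exact: nat_step.
by rewrite NegzE mulrNz mulrN -{2}(subrK (2 * pi * j.+1%:R) theta) nat_step.
Qed.

Lemma alpha_2pi theta (k : int) : al (theta + 2 * pi * k%:~R) = al theta.
Proof. by rewrite /alpha dir_2pi. Qed.

Lemma alpha_closure theta : closure Om (al theta).
Proof. by case: (alphaP sc ab theta). Qed.

(** A boundary curve with velocity [dir a] strictly increases the coordinate of normal
  [b], so its base point is not extremal for [b]. *)
Lemma alpha_neq a b : 0 < b - a < pi -> al a != al b.
Proof.
move=> gap; apply/eqP => E; have s0 := sin_pos gap.
have [_ _ [g [g0 gd gb]] _] := alpha_pos_tangent sc ab a.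
have [d [d0 H]] := drv_small (drv_nc b gd) (k := sin (b - a) / 2) ltac:(lra).
move/nbhs_ballP: gb => [e /= e0 He].
pose t := Num.min d e / 2; have m0 : 0 < Num.min d e by rewrite lt_min d0.
have t0 : 0 < t by rewrite divr_gt0.
have [md me] : Num.min d e <= d /\ Num.min d e <= e by rewrite !ge_min !lexx orbT.
have tn : `|t - 0| = t by rewrite subr0 gtr0_norm.
have := H t ltac:(rewrite tn /t; lra).
rewrite tn subr0 nc_dir g0 => /ler_normlP[]; rewrite opprB => lo _.
have : nc b (g t) <= nc b (al b).
  apply: (proj2 (alphaP sc ab b)); apply/boundary_closure/He.
  by rewrite /ball/= distrC tn /t; lra.
rewrite -E; nra.
Qed.

Context (q : plane R) (Oq : Om q) (p dp : R -> R).
Hypothesis (pE : forall theta, p theta = nc theta (al theta - q)).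
Hypothesis (pd : forall theta, is_derive theta (1 : R) p (dp theta)).

Lemma support_pos theta : 0 < p theta.
Proof.
rewrite pE ncB subr_gt0; apply: (extremal_lt sc (alphaP sc ab theta)).
  exact: subset_closure.
apply: contra_not_neq (boundary_notin sc (extremal_boundary sc (alphaP sc ab theta))).
by move=> <-.
Qed.

(** The extremal point at [theta] is a competitor at all angles, so the difference of
  the two normal coordinates is minimal at [theta]. *)
Lemma support_deriv theta : dp theta = tc theta (al theta - q).
Proof.
set v := al theta - q.
have fd phi : is_derive phi (1 : R) (fun t => nc t v - p t) (tc phi v - dp phi).
  apply: drv_sub => //.
  apply: drv_ext (drv_add (drv_mul (drv_cst phi v.1) (drv_cosB phi 0))
    (drv_mul (drv_cst phi v.2) (drv_sinB phi 0))) => [t|].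
    by rewrite /nc !subr0.
  by rewrite /tc !subr0; ring.
have := drv_at_max fd (t := theta).
rewrite -pE subrr => H; apply/eqP; rewrite eq_sym -subr_eq0; apply/eqP/H => phi.
rewrite subr_le0 pE /v !ncB lerD2r.
by apply: (proj2 (alphaP sc ab phi)); exact: alpha_closure.
Qed.

Lemma support_fwd a b : sin (b - a) != 0 ->
  nc b (al b - al a) = fwd p dp a b * sin (b - a).
Proof.
move=> s0; have -> : al b - al a = (al b - q) - (al a - q) by rewrite opprB addrA subrK.
rewrite ncB -pE (nc_rotate a b) -pE -support_deriv /fwd mulrBl divfK//; ring.
Qed.

Lemma support_bwd a b : sin (b - a) != 0 ->
  nc a (al a - al b) = bwd p dp a b * sin (b - a).
Proof.
move=> s0; have -> : al a - al b = (al a - q) - (al b - q) by rewrite opprB addrA subrK.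
rewrite ncB -pE (nc_rotate b a) -pE -support_deriv /bwd mulrBl divfK//.
by rewrite -(opprB b a) cosN sinN; ring.
Qed.

Lemma support_fwd_gt0 a b : 0 < b - a < pi -> 0 < fwd p dp a b.
Proof.
move=> gap; have s0 := sin_pos gap; rewrite -(pmulr_lgt0 _ s0) -support_fwd ?gt_eqF//.
rewrite ncB subr_gt0; apply: (extremal_lt sc (alphaP sc ab b) (@alpha_closure a)).
exact: alpha_neq.
Qed.

Lemma support_bwd_gt0 a b : 0 < b - a < pi -> 0 < bwd p dp a b.
Proof.
move=> gap; have s0 := sin_pos gap; rewrite -(pmulr_lgt0 _ s0) -support_bwd ?gt_eqF//.
rewrite ncB subr_gt0; apply: (extremal_lt sc (alphaP sc ab a) (@alpha_closure b)).
by rewrite eq_sym; exact: alpha_neq.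
Qed.

(** Both sides are the intersection of the two tangent lines. *)
Lemma tangents_meet a b : sin (b - a) != 0 ->
  al a + fwd p dp a b *: dir a = al b - bwd p dp a b *: dir b.
Proof.
move=> s0; apply: (plane_eq (theta := b)).
  rewrite ncD ncB !ncZ !nc_dir subrr sin0 mulr0 subr0 -support_fwd// ncB.
  by rewrite addrC subrK.
rewrite tcD tcB !tcZ !tc_dir subrr cos0 mulr1.
apply: (mulIf s0); have := support_bwd s0; have := support_fwd s0.
rewrite !ncB !(nc_rotate b a) -(opprB b a) cosN sinN => E1 E2.
set F := fwd _ _ _ _ in E1 *; set B := bwd _ _ _ _ in E2 *.
transitivity (tc b (al a) * sin (b - a) + (F * sin (b - a)) * cos (b - a)); first by ring.
transitivity (tc b (al b) * sin (b - a) - B * sin (b - a)); last by ring.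
by rewrite -E1 -E2; ring.
Qed.
End SupportFunction.

(** * Rays and the outer billiard map *)

Section Rays.
Context {R : realType} (Om : set (plane R)).
Hypothesis (sc : strictly_convex_domain Om) (ab : analytic_boundary Om).
Implicit Types (x y z v : plane R) (theta phi a b s t : R).
Local Notation al := (alpha Om).

Lemma extremal_le a b : nc b (al a) <= nc b (al b).
Proof. by apply: (proj2 (alphaP sc ab b)); exact: alpha_closure. Qed.

Lemma mod_2pi t : exists k : int, 0 <= t - 2 * pi * k%:~R < 2 * pi.
Proof.
have pi2 : 0 < 2 * pi :> R by rewrite mulr_gt0// pi_gt0.
exists (Num.floor (t / (2 * pi))).
have /andP[k1 k2] := floor_itv (t / (2 * pi)).
rewrite ler_pdivlMr// in k1; rewrite ltr_pdivrMr// intrD in k2.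
by apply/andP; split; move: k1 k2; set K := _%:~R; move=> k1 k2; nra.
Qed.

(** Two backward tangent rays meet only if they are the same. After reduction to an
  angle [d] in [[0, 2 pi[], a common point lies on both tangent lines; for
  [0 < d < pi] it would lie strictly inside the half plane of the second line, for
  [pi < d] of the first, and for [d = pi] the two parallel lines would coincide
  although an inner point lies between them. *)
Lemma rays_disjoint a b s t : 0 < s -> 0 < t ->
  al a - s *: dir a = al b - t *: dir b -> exists k : int, b = a + 2 * pi * k%:~R.
Proof.
move=> s0 t0; have [k] := mod_2pi (b - a); set d := b - a - _ => /andP[d0 d2].
have bE : b = a + d + 2 * pi * k%:~R by rewrite /d; ring.
rewrite bE alpha_2pi dir_2pi => E; exists k.
suff -> : d = 0 by rewrite addr0.
apply: contrapT => dn.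
have {d0 dn} d0 : 0 < d by rewrite lt_neqAle d0 andbT eq_sym; apply/eqP.
have En phi : nc phi (al a) - s * sin (phi - a) = nc phi (al (a + d)) - t * sin (phi - (a + d)).
  by rewrite -!nc_dir -!ncZ -!ncB E.
have d1 : a + d - a = d by ring.
have d3 : a - (a + d) = - d by ring.
have := En (a + d); rewrite subrr sin0 mulr0 subr0 d1 => E1.
have := En a; rewrite subrr sin0 mulr0 subr0 d3 sinN mulrN opprK => E2.
have le1 := extremal_le a (a + d); have le2 := extremal_le (a + d) a.
have [dpi|dpi|dpi] := ltrgtP d pi.
- have := sin_pos (x := d) ltac:(by rewrite d0); nra.
- have : 0 < sin (d - pi) by apply: sin_pos; apply/andP; split; lra.
  by rewrite sinB sinpi cospi mulr0 subr0; nra.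
- have [_ [q Oq] _ _] := sc.
  have lt phi : nc phi q < nc phi (al phi).
    apply: (extremal_lt sc (alphaP sc ab phi)); first exact: subset_closure.
    apply: contra_not_neq (boundary_notin sc (extremal_boundary sc (alphaP sc ab phi))).
    by move=> <-.
  have opp v : nc (a + d) v = - nc a v.
    by rewrite (nc_rotate a (a + d)) d1 dpi sinpi cospi; ring.
  have := lt a; have := lt (a + d).
  by move: E1; rewrite dpi sinpi mulr0 subr0 -dpi => <-; rewrite !opp; lra.
Qed.

Lemma ray_outside a s : 0 < s -> ~ closure Om (al a - s *: dir a).
Proof.
move=> s0 cz; have := extremal_unique sc (alphaP sc ab a) cz.
rewrite ncB ncZ nc_dir subrr sin0 mulr0 subr0 lexx => /(_ isT)/eqP.
by rewrite -subr_eq0 addrAC subrr add0r oppr_eq0 scaler_eq0 (negPf (dir_neq0 a)) gt_eqF.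
Qed.

(** Uniqueness of the touching point is [rays_disjoint] in polar coordinates. *)
Lemma touching_ray a s : 0 < s -> touching_point Om (al a - s *: dir a) = al a.
Proof.
move=> s0; set z := al a - _.
have : pos_tangent Om (touching_point Om z) (touching_point Om z - z).
  apply: (getPex (P := [set x | pos_tangent Om x (x - z)])); exists (al a) => /=.
  rewrite /z opprB addrC subrK; apply: pos_tangent_scale => //.
  exact: alpha_pos_tangent.
set x := touching_point Om z => xt; have [_ xz _ _] := xt.
have [t [b [t0 xE]]] := polar_dir xz.
have xb : x = al b.
  apply: (pos_tangent_alpha sc ab); rewrite -[dir b](scalerK (lt0r_neq0 t0)) -xE.
  by apply: pos_tangent_scale => //; rewrite invr_gt0.
have [|k kE] := @rays_disjoint a b s t s0 t0; last by rewrite xb kE alpha_2pi.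
by rewrite -xE xb subKr.
Qed.

Lemma billiard_ray a s : 0 < s ->
  outer_billiard Om (al a - s *: dir a) = al a + s *: dir a.
Proof.
by move=> s0; rewrite /outer_billiard touching_ray// scaler_nat mulr2n opprB -addrA subrKC.
Qed.

Lemma enorm_dir a s : 0 < s -> enorm (s *: dir a) ^+ 2 = s ^+ 2.
Proof.
move=> s0; rewrite (enorm_coord a) ncZ tcZ nc_dir tc_dir subrr sin0 cos0 mulr0 mulr1.
by rewrite expr0n add0r sqr_sqrtr// sqr_ge0.
Qed.

Lemma envelope_ray a s : 0 < s ->
  envelope_coords Om (al a - s *: dir a) (a, s ^+ 2 / 2).
Proof.
move=> s0; split; first exact: ray_outside.
  by exists s => //=; rewrite opprB addrC subrK.
by rewrite /= opprB addrCA subrr addr0 enorm_dir.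
Qed.

Lemma envelope_inv z a c : envelope_coords Om z (a, c) ->
  exists s, [/\ 0 < s, z = al a - s *: dir a & s = Num.sqrt (2 * c)].
Proof.
move=> [_ [s s0 /= zE] /= cE]; exists s; split=> //; first by rewrite -zE opprB addrC subrK.
by rewrite cE zE enorm_dir// mulrC divfK ?pnatr_eq0// sqrtr_sqr gtr0_norm.
Qed.
End Rays.

(** * Lifts and invariant curves *)

Section FwdOnto.
Context {R : realType} (p dp : R -> R) (sf : support_fun p dp).
Local Notation S := (fwd p dp).

(** The forward length tends to zero for short steps and to infinity for steps close to
  a half turn. *)
Lemma fwd_onto a s : 0 < s -> exists b, 0 < b - a < pi /\ S a b = s.
Proof.
move=> s0; have pi0 := pi_gt0 R.
have [M HM] := sf_bnd sf; have [L0 HL0] := sf_lip sf.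
have M0 : 0 < M by have := sf_pos sf 0; have [] := HM 0; lra.
pose L := `|L0|; have L0' : 0 <= L by exact: normr_ge0.
have HL x y : `|dp x - dp y| <= L * `|x - y|.
  by apply: le_trans (HL0 x y) _; rewrite ler_wpM2r// ler_norm.
pose K := 2 * L + 4 * M; have K0 : 0 < K by rewrite /K; lra.
pose t1 := Num.min (pi / 2) (s / K).
have t10 : 0 < t1 by rewrite lt_min !divr_gt0.
have [t1a t1b] : t1 <= pi / 2 /\ t1 <= s / K by rewrite !ge_min !lexx orbT.
have S1 : S a (a + t1) <= s.
  have E : a + t1 - a = t1 by ring.
  have := fwd_small sf (fun t => (HM t).1) (fun t => (HM t).2) L0' HL (a := a) (b := a + t1).
  rewrite E t10 t1a => /(_ isT) /le_trans; apply.
  by rewrite -/K mulrC -ler_pdivlMr.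
have [s1 [s2 Hs]] := periodic_bounds (sf_per sf) (fun t => drv_continuous (sf_der sf t)).
pose m := p s1; have m0 : 0 < m := sf_pos sf s1.
pose t2 := Num.min (pi / 2) (m / (s + M)).
have t20 : 0 < t2 by rewrite lt_min !divr_gt0// addr_gt0.
have [t2a t2b] : t2 <= pi / 2 /\ t2 <= m / (s + M) by rewrite !ge_min !lexx orbT.
pose b2 := a + (pi - t2).
have E2 : b2 - a = pi - t2 by rewrite /b2; ring.
have S2 : s <= S a b2.
  rewrite /fwd E2 cosB sinB sinpi cospi !mul0r !mulN1r addr0 sub0r opprK.
  have sn : 0 < sin t2 by apply: sin_pos; apply/andP; split; lra.
  have sle : sin t2 <= t2 by apply: sin_le_id; lra.
  have c0 : 0 <= cos t2 by apply: cos_ge0_pihalf; apply/andP; split; lra.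
  rewrite lerBrDr ler_pdivlMr//.
  have [_ /ler_normlP[_ dM]] := HM a.
  have /andP[mp _] := Hs b2; have pa := sf_pos sf a.
  rewrite ler_pdivlMr ?addr_gt0// in t2b.
  have : (s + dp a) * sin t2 <= m by nra.
  by rewrite -/m in mp; nra.
have gap b : a + t1 <= b <= b2 -> 0 < b - a < pi.
  by move=> /andP[b1 bb]; apply/andP; split; lra.
have ab2 : a + t1 <= b2 by rewrite /b2; lra.
have [||b] := IVT (f := S a) (v := s) ab2.
- apply: derivable_within_continuous => b; rewrite in_itv/= => /gap g.
  exact: (@ex_derive _ _ _ _ _ _ _ (der_fwd_r sf g)).
- by rewrite ge_min le_max S1 S2 orbT.
by rewrite in_itv/= => /gap g E; exists b.
Qed.
End FwdOnto.

Section Lift.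
Context {R : realType} (Om : set (plane R)).
Hypothesis (sc : strictly_convex_domain Om) (ab : analytic_boundary Om).
Implicit Types (x y z v : plane R) (theta phi a b s t : R) (m : int).
Local Notation al := (alpha Om).

Lemma lipschitzP (f : R -> R) :
  lipschitz f <-> exists L, forall s t, `|f s - f t| <= L * `|s - t|.
Proof.
split=> [[M [_ H]]|[L H]].
  by exists (M + 1) => s t; apply: (H (M + 1) _ (s, t)) => //; rewrite ltrDl.
exists L; split; first exact: num_real.
move=> k Lk [s t] _ /=; apply: le_trans (H s t) _.
by rewrite ler_wpM2r// ltW.
Qed.

(** Each application of the map turns the tangent line by less than a half turn. This
  excludes small values of [n]. *)
Lemma curve_rotation m n : (0 < n)%N -> has_periodic_invariant_curve Om m n ->
  2 * m%:~R < n%:R :> R.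
Proof.
move=> n0 [F [[HF _] [eta [_ etaP inv per]]]].
have step k : exists x : R, [/\ iter k F (0, eta 0) = (x, eta x), x <= k%:R * pi
    & (0 < k)%N -> x < k%:R * pi].
  elim: k => [|k [x [E le lt]]]; first by exists 0; rewrite /= mul0r.
  have [_ /andP[_ x1] _] := HF x (eta x) (etaP x).1.
  have : range (fun theta => (theta, eta theta)) (F (x, eta x)).
    by apply: inv; exists (x, eta x) => //; exists x.
  move=> [y _ yE]; exists y; rewrite iterS E -yE; move: x1; rewrite -yE /= => x1.
  have yk : y < k.+1%:R * pi by rewrite -(natr1 k) mulrDl mul1r; lra.
  by split=> //; exact: ltW.
have [x [E _ /(_ n0) lt]] := step n.
move: E; rewrite per add0r => -[xE _]; have pi0 := pi_gt0 R.
by rewrite -(ltr_pM2r pi0) mulrAC xE.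
Qed.

Context (q : plane R) (Oq : Om q) (p dp : R -> R).
Hypothesis (pE : forall theta, p theta = nc theta (al theta - q)).
Hypothesis (sf : support_fun p dp).
Let pd := sf_der sf.
Local Notation S := (fwd p dp).
Local Notation T := (bwd p dp).

(** Project the midpoint relation on the normals of the two tangent lines. *)
Lemma lift_spec F a c : outer_billiard_lift Om F -> 0 < c ->
  [/\ 0 < (F (a, c)).1 - a < pi, S a (F (a, c)).1 = Num.sqrt (2 * c) &
      T a (F (a, c)).1 = Num.sqrt (2 * (F (a, c)).2)].
Proof.
move=> [HF _] c0; have [] := HF a c c0; case: (F (a, c)) => b d /= d0 /andP[ab1 ab2].
move=> [z [/(envelope_inv)[s [s0 zE sE]] e2]].
have gap : 0 < b - a < pi by apply/andP; split; lra.
have sn := sin_pos gap; have snn := sin_neq0 gap.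
move: e2; rewrite zE billiard_ray// => /envelope_inv[t [t0 E tE]].
split=> //.
  rewrite -sE; apply: (mulIf snn); rewrite -(support_fwd sc ab pE pd snn) ncB.
  have := congr1 (nc b) E; rewrite ncD ncB !ncZ !nc_dir subrr sin0 mulr0 subr0 => <-.
  by rewrite addrAC subrr add0r.
rewrite -tE; apply: (mulIf snn); rewrite -(support_bwd sc ab pE pd snn) ncB.
have := congr1 (nc a) E; rewrite ncD ncB !ncZ !nc_dir subrr sin0 mulr0 addr0 => ->.
by rewrite addrAC subrr add0r -(opprB b a) sinN; ring.
Qed.

(** The next angle is determined by the forward length ([fwd_onto]); its uniqueness
  ([fwd_inj]) makes the map equivariant. *)
Lemma lift_exists : exists F, outer_billiard_lift Om F /\
  forall a b s, 0 < s -> 0 < b - a < pi -> S a b = s ->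
    F (a, s ^+ 2 / 2) = (b, T a b ^+ 2 / 2).
Proof.
have /choice[B HB] : forall r : R * R, exists b, 0 < r.2 ->
    0 < b - r.1 < pi /\ S r.1 b = Num.sqrt (2 * r.2).
  move=> r; have [r0|] := pselect (0 < r.2); last by exists 0.
  have [|b Hb] := fwd_onto sf r.1 (s := Num.sqrt (2 * r.2)); last by exists b.
  by rewrite sqrtr_gt0 mulr_gt0.
have Buniq a b s : 0 < s -> 0 < b - a < pi -> S a b = s -> B (a, s ^+ 2 / 2) = b.
  move=> s0 gap E; have [|/= gB EB] := HB (a, s ^+ 2 / 2).
    by rewrite /= divr_gt0 ?exprn_gt0.
  apply: (fwd_inj sf gB gap); rewrite EB E mulrC divfK ?pnatr_eq0//.
  by rewrite sqrtr_sqr gtr0_norm.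
have half (c : R) : 0 < c -> exists2 s : R, 0 < s & c = s ^+ 2 / 2.
  move=> c0; exists (Num.sqrt (2 * c)); first by rewrite sqrtr_gt0 mulr_gt0.
  by rewrite sqr_sqrtr ?mulr_ge0 ?ltW// mulrC mulKf ?pnatr_eq0.
exists (fun r => (B r, T r.1 (B r) ^+ 2 / 2)); split; last first.
  by move=> a b s s0 gap E /=; rewrite (Buniq a b s).
split=> a c c0.
  have [/= gap E] := HB (a, c) c0; split=> /=.
  - by rewrite divr_gt0// exprn_gt0//; exact: (sf_bwd sf).
  - by move: gap => /andP[? ?]; apply/andP; split; lra.
  have [s s0 cE] := half c c0.
  have sE : S a (B (a, c)) = s.
    by rewrite E cE mulrC divfK ?pnatr_eq0// sqrtr_sqr gtr0_norm.
  exists (al a - s *: dir a); rewrite cE; split; first exact: envelope_ray.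
  rewrite billiard_ray// -cE -sE (tangents_meet sc ab pE pd (sin_neq0 gap)).
  by apply: envelope_ray => //; exact: (sf_bwd sf).
have [/= gap E] := HB (a, c) c0; have [s s0 cE] := half c c0.
have sE : S a (B (a, c)) = s.
  by rewrite E cE mulrC divfK ?pnatr_eq0// sqrtr_sqr gtr0_norm.
have -> : B (a + 2 * pi, c) = B (a, c) + 2 * pi.
  rewrite {1}cE; apply: Buniq => //; first by rewrite shiftB.
  by rewrite (fwd_w (sf_per sf) (dp_per sf)).
by rewrite (bwd_w (sf_per sf) (dp_per sf)); congr (_, _); rewrite addr0.
Qed.

(** The tangent length is the square root of twice the second coordinate. *)
Lemma curve_circle (k N : nat) : has_periodic_invariant_curve Om k%:Z N.+2 ->
  exists g u, circle p dp N (2 * pi * k%:R) g u.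
Proof.
move=> [F [LF [eta [/lipschitzP[L lip] etaP inv per]]]].
pose g t := (F (t, eta t)).1; pose u t := Num.sqrt (2 * eta t).
have Fg t : F (t, eta t) = (g t, eta (g t)).
  have : range (fun theta => (theta, eta theta)) (F (t, eta t)).
    by apply: inv; exists (t, eta t) => //; exists t.
  by rewrite /g => -[y _ <-].
have eta0 t : 0 < eta t by case: (etaP t).
exists g, u; split=> t.
- by have [] := lift_spec t LF (eta0 t).
- by have [_ ->] := lift_spec t LF (eta0 t).
- by have [_ _ ->] := lift_spec t LF (eta0 t); rewrite Fg.
- have it j : iter j F (t, eta t) = (iter j g t, eta (iter j g t)).
    by elim: j => // j IH; rewrite iterS IH Fg.
  by have := congr1 fst (per t); rewrite it /=.
- apply: continuous_comp; last exact: sqrt_continuous.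
  apply: cvgM; first exact: cvg_cst.
  apply/cvgrPdist_lt => e e0; pose K := 2 * (`|L| + 1).
  have K0 : 0 < K by rewrite /K; have := normr_ge0 L; lra.
  apply: filterS (near_dist_le t (divr_gt0 e0 K0)) => s; rewrite ler_pdivlMr// mulrC => st.
  apply: le_lt_trans (lip t s) _; apply: le_lt_trans (_ : `|L| * `|t - s| < e).
    by rewrite ler_wpM2r// ler_norm.
  by move: st; rewrite /K; have := normr_ge0 L; have := normr_ge0 (t - s); nra.
Qed.

(** [u^2 / 2] is Lipschitz because [u] is Lipschitz and bounded. *)
Lemma circle_curve (k N : nat) g u L : circle p dp N (2 * pi * k%:R) g u ->
  (forall t, g (t + 2 * pi) = g t + 2 * pi) ->
  (forall s t, `|u s - u t| <= L * `|s - t|) ->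
  has_periodic_invariant_curve Om k%:Z N.+2.
Proof.
move=> ci gper lip; have [F [LF HF]] := lift_exists.
have u0 t : 0 < u t by rewrite -(ci_fwd ci); apply: (sf_fwd sf); exact: (ci_gap ci).
have uper t : u (t + 2 * pi) = u t.
  by rewrite -!(ci_fwd ci) gper (fwd_w (sf_per sf) (dp_per sf)).
pose eta t := u t ^+ 2 / 2.
have Fg t : F (t, eta t) = (g t, eta (g t)).
  by rewrite (HF t (g t) (u t))// ?(ci_bwd ci)//; [exact: (ci_gap ci)|exact: (ci_fwd ci)].
exists F; split=> //; exists eta; split.
- have [s1 [s2 Hs]] := periodic_bounds uper (ci_cont ci).
  apply/lipschitzP; exists (u s2 * L) => s t.
  have -> : eta s - eta t = (u s + u t) / 2 * (u s - u t) by rewrite /eta; field.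
  rewrite normrM -mulrA; apply: ler_pM => //.
  have /andP[_ H1] := Hs s; have /andP[_ H2] := Hs t; have := u0 s; have := u0 t.
  by move=> ? ?; rewrite ger0_norm; lra.
- by move=> t; split; [rewrite divr_gt0 ?exprn_gt0|rewrite /eta uper].
- by move=> _ [_ [t _ <-] <-]; exists (g t) => //; rewrite Fg.
- move=> t; have it j : iter j F (t, eta t) = (iter j g t, eta (iter j g t)).
    by elim: j => // j IH; rewrite iterS IH Fg.
  rewrite it (ci_iter ci); congr (_, _); rewrite /eta.
  by rewrite (periodic_nat uper).
Qed.
End Lift.

(** * Translations and distances to tangent lines *)

Section Translation.
Context {R : realType}.
Implicit Types (A Om : set (plane R)) (x y z v : plane R) (theta s t : R).

Lemma translateE v A x : translate v A x <-> A (x - v).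
Proof.
split=> [[y Ay <-]|Ax]; first by rewrite addrK.
by exists (x - v) => //; rewrite subrK.
Qed.

Lemma nbhs_translate v A x : nbhs x (translate v A) <-> nbhs (x - v) A.
Proof.
have b (e : R) y z : ball y e z -> ball (y - v) e (z - v).
  by case=> b1 b2; split; rewrite /ball /= opprB subrKA.
have b' (e : R) y z : ball (y - v) e z -> ball y e (z + v).
  have E (a c k : R) : a - (c + k) = a - k - c by ring.
  by case=> b1 b2; split; rewrite /ball /= E.
split=> /nbhs_ballP[e /= e0 He]; apply/nbhs_ballP; exists e => // y.
  by move=> /b' /He /translateE; rewrite addrK.
by move=> /b /He /translateE.
Qed.

Lemma boundary_translate v A x : boundary (translate v A) x <-> boundary A (x - v).
Proof.
have cl : closure (translate v A) x <-> closure A (x - v).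
  split=> H B nB.
    have [|y [/translateE Ay /translateE By]] := H (translate v B); first exact/nbhs_translate.
    by exists (y - v).
  have [|y [Ay By]] := H (translate (- v) B).
    by apply/nbhs_translate; rewrite opprK subrK.
  exists (y + v); split; first by apply/translateE; rewrite addrK.
  by move: By => /translateE; rewrite opprK.
by split=> -[/cl c i]; split=> // /nbhs_translate.
Qed.

Lemma pos_tangent_translate v A x d :
  pos_tangent (translate v A) x d <-> pos_tangent A (x - v) d.
Proof.
have dt (g : R -> plane R) (k e : plane R) : is_derive (0 : R) (1 : R) g e ->
    is_derive (0 : R) (1 : R) (fun t => g t + k) e.
  move=> /drv_plane[d1 d2]; apply/drv_plane; split.
    by apply: drv_ext (drv_add d1 (drv_cst 0 k.1)) => //; rewrite addr0.
  by apply: drv_ext (drv_add d2 (drv_cst 0 k.2)) => //; rewrite addr0.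
split=> -[bx d0 [g [g0 gd gb]] ray]; split=> //.
- exact/boundary_translate.
- exists (fun t => g t - v); split; [by rewrite g0|exact: dt|].
  by apply: filterS gb => t /boundary_translate.
- by apply: filterS ray => t /translateE; rewrite addrAC.
- exact/boundary_translate.
- exists (fun t => g t + v); split; [by rewrite g0 subrK|exact: dt|].
  by apply: filterS gb => t gb; apply/boundary_translate; rewrite addrK.
- by apply: filterS ray => t H; apply/translateE; rewrite addrAC.
Qed.

(** The nearest point of the line is the orthogonal projection. *)
Lemma dist_tangent_line A x theta :
  dist_to x (tangent_line A theta) = `|nc theta (alpha A theta - x)|.
Proof.
set a := alpha A theta; pose D := [set enorm (x - y) | y in tangent_line A theta].
have En t : enorm (x - (a + t *: dir theta)) =
    Num.sqrt (nc theta (a - x) ^+ 2 + (tc theta (x - a) - t) ^+ 2).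
  rewrite (enorm_coord theta) !ncB !tcB ncD tcD ncZ tcZ nc_dir tc_dir subrr sin0 cos0.
  by congr (Num.sqrt _); ring.
have lb t : `|nc theta (a - x)| <= enorm (x - (a + t *: dir theta)).
  by rewrite En -sqrtr_sqr ler_wsqrtr// lerDl sqr_ge0.
have D0 : D `|nc theta (a - x)|.
  exists (a + tc theta (x - a) *: dir theta); first by exists (tc theta (x - a)).
  by rewrite En subrr expr0n addr0 sqrtr_sqr.
apply/eqP; rewrite eq_le; apply/andP; split.
  apply: ge_inf => //; exists `|nc theta (a - x)| => _ [_ [t _ <-] <-]; exact: lb.
apply: lb_le_inf; first by exists `|nc theta (a - x)|.
by move=> _ [_ [t _ <-] <-]; exact: lb.
Qed.

Lemma alpha_translate v Om theta : strictly_convex_domain Om -> analytic_boundary Om ->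
  alpha (translate v Om) theta = alpha Om theta + v.
Proof.
move=> sc ab; set x := alpha _ _.
have : pos_tangent (translate v Om) x (dir theta).
  apply: (getPex (P := [set x | pos_tangent (translate v Om) x (dir theta)])).
  exists (alpha Om theta + v); apply/pos_tangent_translate; rewrite addrK.
  exact: alpha_pos_tangent.
by move=> /pos_tangent_translate/(pos_tangent_alpha sc ab) <-; rewrite subrK.
Qed.

Lemma dist_translate O v Om theta : strictly_convex_domain Om -> analytic_boundary Om ->
  Om (O - v) ->
  dist_to O (tangent_line (translate v Om) theta) = nc theta (alpha Om theta - (O - v)).
Proof.
move=> sc ab Oq; rewrite dist_tangent_line alpha_translate// opprB addrA ger0_norm//.
rewrite -addrA -opprB ncB subr_ge0.
by apply: (proj2 (alphaP sc ab theta)); exact: subset_closure.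
Qed.
End Translation.

(** * The dichotomy *)

Section SupportFamily.
Context {R : realType}.

Lemma drv_periodic (f df : R -> R) : (forall t, f (t + 2 * pi) = f t) ->
  (forall t, is_derive t (1 : R) f (df t)) -> forall t, df (t + 2 * pi) = df t.
Proof.
move=> per fd t.
have := drv_comp (drv_add (drv_id t) (drv_cst t (2 * pi))) (fd (t + 2 * pi)).
rewrite addr0 mulr1 (_ : (fun t => _) = f) => [H|]; first exact: is_derive_unique H (fd t).
by apply/funext => s; rewrite per.
Qed.

Lemma periodic_bounded (f : R -> R) : (forall t, f (t + 2 * pi) = f t) ->
  (forall x, {for x, continuous f}) -> exists M, forall t, `|f t| <= M.
Proof.
move=> per cf; have [s1 [s2 H]] := periodic_bounds per cf.
exists (`|f s1| + `|f s2|) => t; have /andP[h1 h2] := H t.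
have := ler_norm (f s2); have := ler_norm (- f s1); rewrite normrN => ? ?.
have := normr_ge0 (f s1); have := normr_ge0 (f s2).
by move=> ? ?; rewrite ler_norml; apply/andP; split; lra.
Qed.

Lemma nc_2pi theta (v : plane R) : nc (theta + 2 * pi) v = nc theta v.
Proof.
have E : theta + 2 * pi - theta = pi *+ 2 :> R by rewrite mulr2n; ring.
by rewrite (nc_rotate theta) E cos2pi sin2pi mulr1 mulr0 addr0.
Qed.

(** The derivatives are bounded because they are continuous and periodic. *)
Lemma domain_support_fun Om (q : plane R) p dp ddp :
  strictly_convex_domain Om -> analytic_boundary Om -> Om q ->
  (forall theta, p theta = nc theta (alpha Om theta - q)) ->
  (forall t, is_derive t (1 : R) p (dp t)) ->
  (forall t, is_derive t (1 : R) dp (ddp t)) ->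
  (forall t, {for t, continuous ddp}) -> support_fun p dp.
Proof.
move=> sc ab Oq pE pd dpd cddp.
have per t : p (t + 2 * pi) = p t.
  by have := alpha_2pi Om t 1; rewrite mulr1 => E; rewrite !pE E nc_2pi.
have dper := drv_periodic per pd; have ddper := drv_periodic dper dpd.
have [M1 H1] := periodic_bounded per (fun t => drv_continuous (pd t)).
have [M2 H2] := periodic_bounded dper (fun t => drv_continuous (dpd t)).
have [M3 H3] := periodic_bounded ddper cddp.
split=> //.
- by move=> t; exact: (support_pos sc ab Oq pE).
- exists (M1 + M2) => t; have := H1 t; have := H2 t.
  have := normr_ge0 (p t); have := normr_ge0 (dp t); have := ler_norm (p t).
  by move=> *; split; lra.
- exists M3 => s t.
  wlog st : s t / s < t => [H|].
    have [|ts|->] := ltgtP s t; first exact: H.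
      by rewrite distrC [`|s - t|]distrC; exact: H.
    by rewrite !subrr normr0 mulr0.
  have [c [_ E]] := mean_value st (fun x _ => dpd x).
  by rewrite distrC E normrM distrC ler_wpM2r.
- by move=> a b gap; exact: (support_fwd_gt0 sc ab pE pd).
- by move=> a b gap; exact: (support_bwd_gt0 sc ab pE pd).
Qed.

Lemma not_isolated (E : set R) x : E x -> ~ isolated E x ->
  forall d, 0 < d -> exists y, [/\ E y, y != x & `|y - x| < d].
Proof.
move=> Ex nx d d0; apply: contrapT => H; apply: nx; split; first exact: mem_set.
exists (ball x d); first exact: nbhsx_ballx.
apply/seteqP; split=> [y [yx Ey]|_ ->]; last by split=> //; exact: ballxx.
apply: contrapT => ny; apply: H; exists y; split=> //; first exact/eqP.
by move: yx; rewrite /ball /= distrC.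
Qed.
End SupportFamily.

Theorem theorem19 (R : realType) (I : set R) (Om : R -> set (plane R))
  (m : int) (n : nat) :
  is_interval I ->
  (forall eps, I eps ->
     strictly_convex_domain (Om eps) /\ analytic_boundary (Om eps)) ->
  analytic_family I Om ->
  (0 < n)%N ->
  coprimez m n ->
  0 < (m%:~R / n%:R : R) < 1 ->
  let E := [set eps | I eps /\ has_periodic_invariant_curve (Om eps) m n] in
  discrete_subset E \/ E = I.
Proof.
move=> Iitv dom [z [v [inside an2]]] n0 _ /andP[mn _] E.
have [|nd] := pselect (discrete_subset E); [by left|right].
have [eps0 [[I0 E0] niso]] : exists eps, E eps /\ ~ isolated E eps.
  apply: contrapT => H; apply: nd => eps Ee.
  by apply: contrapT => nE; apply: H; exists eps.
have n0' : 0 < n%:R :> R by rewrite ltr0n.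
have m0 : 0 < m%:~R :> R by move: mn; rewrite pmulr_lgt0// invr_gt0.
have [sc0 ab0] := dom _ I0.
have mn2 := curve_rotation n0 E0.
have [k mk] : exists k : nat, m = k%:Z.
  by case: m m0 {E E0 nd niso mn mn2} => k; [exists k|rewrite ltr0z].
have k1 : (0 < k)%N by rewrite mk ltr0z in m0.
have [N nN] : exists N, n = N.+2.
  have : 2 * k%:R < n%:R :> R by rewrite mk in mn2.
  rewrite -natrM ltr_nat => kn; exists n.-2.
  have n2 : (2 < n)%N by apply: leq_ltn_trans kn; rewrite leq_pmulr.
  by case: n n2 {E E0 nd niso mn mn2 kn n0 n0'} => [|[]].
subst m n.
pose w : R := 2 * pi * k%:R; have pi0 := pi_gt0 R.
have w0 : 0 < w by rewrite !mulr_gt0// ltr0n.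
have wn : w < pi * N.+2%:R.
  by rewrite /w mulrAC mulrC ltr_pM2l// pmulrn.
pose P eps theta := dist_to z (tangent_line (translate (v eps) (Om eps)) theta).
have anP : analytic_fam I P := analytic2_on_fam an2.
have [DP [anDP PD]] := analytic_fam_deriv anP.
have [D2 [anD2 DPD]] := analytic_fam_deriv anDP.
have [D3 [_ D2D]] := analytic_fam_deriv anD2.
have Oq eps : I eps -> Om eps (z - v eps) by move=> Ie; apply/translateE; exact: inside.
have PE eps : I eps -> forall theta, P eps theta = nc theta (alpha (Om eps) theta - (z - v eps)).
  move=> Ie theta; have [sc ab] := dom _ Ie.
  by apply: dist_translate => //; exact: Oq.
have sfP eps : I eps -> support_fun (P eps) (DP eps).
  move=> Ie; have [sc ab] := dom _ Ie.
  apply: (domain_support_fun sc ab (Oq _ Ie) (PE _ Ie) (ddp := D2 eps)) => t.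
  - exact: PD.
  - exact: DPD.
  - exact: drv_continuous (D2D _ _ Ie).
have pw eps : I eps -> forall t, P eps (t + w) = P eps t.
  by move=> Ie t; exact: (periodic_nat (sf_per (sfP _ Ie))).
have dpw eps : I eps -> forall t, DP eps (t + w) = DP eps t.
  by move=> Ie t; exact: (periodic_nat (dp_per (sfP _ Ie))).
have curve_flat eps : I eps ->
    has_periodic_invariant_curve (Om eps) k N.+2 <-> flat_at P N w eps.
  move=> Ie; have [sc ab] := dom _ Ie; split=> [hc|[c fl]].
    have [g [u ci]] := curve_circle sc ab (PE _ Ie) (sfP _ Ie) hc.
    exact: (circle_flat sfP anP anDP w0 wn pw dpw Ie ci).
  have [g [u [ci _ gper [L ulip]]]] := flat_circle (sfP _ Ie) w0 (pw _ Ie) (dpw _ Ie) fl.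
  exact: (circle_curve sc ab (PE _ Ie) (sfP _ Ie) ci gper ulip).
have all_flat := flat_identity Iitv sfP anP anDP w0 wn pw dpw I0.
apply/seteqP; split=> [eps []//|eps Ie]; split=> //; apply/curve_flat => //.
apply: all_flat => //; first exact/curve_flat.
move=> d d0; have [|y [[Iy Ey] ye yd]] := not_isolated _ niso d0; first by split.
by exists y; split=> //; exact/curve_flat.
Qed.
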